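(* Let $X$ be a Noetherian $\mathbb{F}_1$-scheme. Then the zeta function of $X$ over $\mathbb{F}_1$ is the product $$\zeta_X(s)=e^{h(s)}\prod_{j=0}^n(s-j)^{\alpha_j}$$ of an exponential of an entire function $h(s)$ by a finite product of fractional powers of simple monomials. The exponents $\alpha_j$ are rational numbers given explicitly by $$\alpha_j=(-1)^{j+1}\sum_{x\in X}(-1)^{n(x)}\binom{n(x)}{j}\sum_d\frac1d\,\nu(d,\mathcal O_{X,x}^\times)$$ where $n(x)$ is the local dimension (i.e. the rank of $\mathcal O_{X,x}^\times$), $n=\max_{x\in X} n(x)$, and $\nu(d,\mathcal O_{X,x}^\times)$ is the number of injective homomorphisms from $\mathbb{Z}/d\mathbb{Z}$ to $\mathcal O_{X,x}^\times$ ($d\ge 1$).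
   Context: Monoids. $\mathfrak{Mo}$ is the category of commutative monoids with unit $1$ and absorbing element $0\neq 1$. For an abelian group $H$, $\mathbb{F}_1[H]=H\cup\{0\}$; $\mathbb{F}_{1^n}=\mathbb{F}_1[\mathbb{Z}/n\mathbb{Z}]$. A geometric $\mathfrak{Mo}$-scheme is a topological space with a sheaf of such monoids which admits an open cover by prime spectra $\mathrm{Spec}(M)$ (set of prime ideals, topology and structure sheaf defined as for rings); morphisms are required to be local on stalks, i.e. stalk maps $\rho$ satisfy $\rho^{-1}(\text{units})=\text{units}$. An $\mathfrak{Mo}$-scheme is a functor $\mathfrak{Mo}\to\mathfrak{Sets}$ admitting an open cover by representable sub-functors; it is equivalent to a geometric $\mathfrak{Mo}$-scheme $X$, via $M\mapsto\mathrm{Hom}(\mathrm{Spec}\,M,X)$. $\mathbb{F}_1$-schemes. Let $\beta:\mathfrak{Mo}\to\mathfrak{Ring}$, $\beta(M)=\mathbb{Z}[M]$ (with the zero of $M$ identified with $0$), and its right adjoint $\beta^*:\mathfrak{Ring}\to\mathfrak{Mo}$, $\beta^*(R)=R$ (multiplicative monoid). Let $\mathfrak{MR}=\mathfrak{Ring}\cup_{\beta,\beta^*}\mathfrak{Mo}$ be the category glued along this adjunction (objects of both; morphisms within each; and $\mathrm{Hom}(M,R)=\mathrm{Hom}_{\mathfrak{Mo}}(M,\beta^*(R))\cong\mathrm{Hom}_{\mathfrak{Ring}}(\beta(M),R)$, no morphisms from rings to monoids). An $\mathbb{F}_1$-scheme is a covariant functor $\mathcal X:\mathfrak{MR}\to\mathfrak{Sets}$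 whose restriction $X_{\mathbb{Z}}$ to $\mathfrak{Ring}$ is a $\mathbb{Z}$-scheme, whose restriction $\underline X$ to $\mathfrak{Mo}$ is an $\mathfrak{Mo}$-scheme, and such that the natural transformation $e:\underline X\circ\beta^*\to X_{\mathbb{Z}}$ evaluated at any field is a bijection. It is Noetherian if $X_{\mathbb{Z}}$ and the $\mathfrak{Mo}$-scheme are Noetherian, the latter meaning that there is a finite open cover by spectra of Noetherian (equivalently finitely generated) monoids. $X$ denotes the geometric $\mathfrak{Mo}$-scheme which is the geometric realization of $\underline X$, and one refers to $X$ as the $\mathbb{F}_1$-scheme; $\mathcal O_{X,x}^\times$ is the group of invertible elements of the stalk $\mathcal O_{X,x}$. Counting function. $N_X(n+1)=\#X(\mathbb{F}_{1^n})=\#\mathrm{Hom}(\mathrm{Spec}\,\mathbb{F}_{1^n},X)=\sum_{x\in X}\#\mathrm{Hom}(\mathcal O_{X,x}^\times,\mathbb{Z}/n\mathbb{Z})$. It extends to a function on $\mathbb{Z}$ of the form $\sum_jT_j(n)n^j$ (finite sum, $T_j$ periodic). Any real function of this form has a canonical extension to an entire function $N(z)=f(z)+\cos(\pi z)Q(z)$, obtained by writing $T_j(n)=\sum_{\alpha\in I}t_{j,\alpha}e^{2\pi i\alpha n}+s_j(-1)^n$ with $I\subset(-\frac12,\frac12)$ a finite set of rationals, and setting $f(z)=\sum_j\sum_\alpha t_{j,\alpha}e^{2\pi i\alpha z}z^j$, $Q(z)=\sum_js_jz^j$. The function $N_X(u)$, $u\in[1,\infty)$, is the restriction of this canonical extension.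 Zeta function. For a continuous real function $N$ on $[1,\infty)$ with $|N(q)|\le Cq^k$, the zeta function $\zeta_N(s)$ over $\mathbb{F}_1$ is defined (up to a multiplicative constant) by $$\frac{\partial_s\zeta_N(s)}{\zeta_N(s)}=-\lim_{q\to1^+}F(q,s)=-\int_1^\infty N(u)u^{-s}\frac{du}{u},\qquad F(q,s)=-\partial_s\sum_{r\ge1}N(q^r)\frac{q^{-rs}}{r},\qquad\Re(s)>k,$$ and $\zeta_X=\zeta_{N_X}$. *)

(* Defs.v *)
From HB Require Import structures.
From mathcomp Require Import all_boot all_order all_algebra.
From mathcomp Require Import all_classical all_reals all_analysis.
From mathcomp Require Import complex.

Set Implicit Arguments.
Unset Strict Implicit.
Unset Printing Implicit Defensive.

Import Order.TTheory GRing.Theory Num.Theory.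
Import numFieldNormedType.Exports.
Local Open Scope classical_set_scope.
Local Open Scope ring_scope.

Record category := Category {
  obj :> Type;
  hom : obj -> obj -> Type;
  idm : forall A, hom A A;
  comp : forall A B C, hom B C -> hom A B -> hom A C;
  comp1m : forall A B (f : hom A B), comp (idm B) f = f;
  compm1 : forall A B (f : hom A B), comp f (idm A) = f;
  compmA : forall A B C D (f : hom A B) (g : hom B C) (h : hom C D),
    comp h (comp g f) = comp (comp h g) f }.
Arguments idm {c} A.
Arguments comp {c A B C}.

Record functor (C : category) := Functor {
  fob :> C -> Type;
  fmap : forall A B, hom A B -> fob A -> fob B;
  fmap1 : forall A (x : fob A), fmap (idm A) x = x;
  fmapM : forall A B D (f : hom A B) (g : hom B D) (x : fob A),
    fmap (comp g f) x = fmap g (fmap f x) }.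
Arguments fmap {C} F {A B} : rename.

Record nattrans (C : category) (F G : functor C) := NatTrans {
  ntfun :> forall A, F A -> G A;
  ntnat : forall A B (f : hom A B) (x : F A),
    ntfun (fmap F f x) = fmap G f (ntfun x) }.

Definition hom_functor (C : category) (A : C) : functor C :=
  @Functor C (hom A) (fun _ _ f g => comp f g)
    (fun _ g => comp1m g) (fun _ _ _ f g x => esym (compmA x f g)).

Record subfunctor (C : category) (F : functor C) := Subfunctor {
  sfset :> forall A, set (F A);
  sfmap : forall A B (f : hom A B) (x : F A),
    sfset x -> sfset (fmap F f x) }.

Definition represented_by (C : category) (F : functor C) (Y : subfunctor F)
    (A : C) : Prop :=
  exists eta : nattrans (hom_functor A) F,
    forall B, injective (eta B) /\ range (eta B) = Y B.

(* [0 = 1] is allowed in [mon0]: this is needed for the sections of a sheaf over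
   the empty open set and for the multiplicative monoid of the zero ring.
   The objects of the category [Mo] below are required to satisfy [0 <> 1]. *)
Record mon0 := Mon0 {
  mcar :> Type;
  one0 : mcar;
  zero0 : mcar;
  mul0 : mcar -> mcar -> mcar;
  mul0A : associative mul0;
  mul0C : commutative mul0;
  mul1m : left_id one0 mul0;
  mul0m : left_zero zero0 mul0 }.
Arguments one0 {m}.
Arguments zero0 {m}.
Arguments mul0 {m}.

Record mhom (M N : mon0) := MHom {
  mfun :> M -> N;
  mfun1 : mfun one0 = one0;
  mfun0 : mfun zero0 = zero0;
  mfunM : {morph mfun : x y / mul0 x y} }.

Lemma mhom_ext (M N : mon0) (f g : mhom M N) : f =1 g -> f = g.
Proof.
case: f => f f1 f0 fM; case: g => g g1 g0 gM /= /funext efg.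
rewrite efg in f1 f0 fM *; congr MHom; exact: Prop_irrelevance.
Qed.

Definition mhom_id (M : mon0) : mhom M M :=
  @MHom M M id erefl erefl (fun _ _ => erefl).

Definition mhom_comp (M N P : mon0) (g : mhom N P) (f : mhom M N) : mhom M P.
Proof.
exists (g \o f).
- by rewrite /= !mfun1.
- by rewrite /= !mfun0.
- by move=> x y; rewrite /= !mfunM.
Defined.

Record mo := Mo_ { mo_mon :> mon0; mo_nontriv : zero0 <> one0 :> mo_mon }.

Definition Mo : category.
Proof.
apply: (@Category mo (fun M N => mhom M N) (fun M => mhom_id M)
  (fun M N P g f => mhom_comp g f)).
- by move=> M N f; apply: mhom_ext.
- by move=> M N f; apply: mhom_ext.
- by move=> M N P Q f g h; apply: mhom_ext.
Defined.

Definition mo_ideal (M : mon0) (I : set M) : Prop :=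
  I zero0 /\ forall a b, I a -> I (mul0 a b).

(* As for rings, an open subfunctor is one that, pulled back to any
   representable functor [Hom(M, -)], is of the form
   [N |-> {rho : M -> N | rho(I) N = N}] for some ideal [I] of [M]. *)
Definition mo_open (F : functor Mo) (Y : subfunctor F) : Prop :=
  forall (M : Mo) (phi : nattrans (hom_functor M) F),
  exists I : set M, mo_ideal I /\
    forall (N : Mo) (rho : mhom M N),
      Y N (phi N rho) <->
      [set mul0 (rho a) n | a in I & n in [set: N]] = [set: N].

Definition F1_mon (H : zmodType) : mon0.
Proof.
refine (@Mon0 (option H) (Some 0) None
  (fun x y => if x is Some a then if y is Some b then Some (a + b) else None
              else None) _ _ _ _).
- by move=> [a|] [b|] [c|] //=; rewrite addrA.
- by move=> [a|] [b|] //=; rewrite addrC.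
- by move=> [a|] //=; rewrite add0r.
- by move=> [a|].
Defined.

Definition F1 (H : zmodType) : mo.
Proof. by exists (F1_mon H). Defined.

(* The "fields" of [Mo] are the F_1[H]; as for rings, covers are tested on
   them. *)
Definition mo_scheme (F : functor Mo) : Prop :=
  exists (J : Type) (Y : J -> subfunctor F),
    [/\ forall i, mo_open (Y i),
        forall i, exists M : Mo, represented_by (Y i) M
      & forall (H : zmodType) (x : F (F1 H)), exists i, Y i (F1 H) x].

Lemma rmorph_ext (A B : comPzRingType) (f g : {rmorphism A -> B}) :
  f =1 g -> f = g.
Proof.
case: f => f [[f1] [f2]]; case: g => g [[g1] [g2]] /= /funext efg.
rewrite efg in f1 f2 *.
by rewrite (Prop_irrelevance f1 g1) (Prop_irrelevance f2 g2).
Qed.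

Definition Ring : category.
Proof.
apply: (@Category comPzRingType (fun A B => {rmorphism A -> B})
  (fun A => idfun) (fun A B C g f => g \o f)).
- by move=> A B f; apply: rmorph_ext.
- by move=> A B f; apply: rmorph_ext.
- by move=> A B C D f g h; apply: rmorph_ext.
Defined.

Definition ring_ideal (A : comPzRingType) (I : set A) : Prop :=
  [/\ I 0, forall a b, I a -> I b -> I (a + b) & forall a b, I a -> I (a * b)].

Definition ideal_generated (A : comPzRingType) (S : set A) : set A :=
  [set x | forall I : set A, ring_ideal I -> S `<=` I -> I x].

Definition noetherian_ring (A : comPzRingType) : Prop :=
  forall I : set A, ring_ideal I ->
  exists s : seq A, I = ideal_generated [set x | x \in s].

Definition ring_open (F : functor Ring) (Y : subfunctor F) : Prop :=
  forall (A : Ring) (phi : nattrans (hom_functor A) F),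
  exists I : set A, ring_ideal I /\
    forall (B : Ring) (rho : {rmorphism A -> B}),
      Y B (phi B rho) <-> ideal_generated (rho @` I) = [set: B].

Definition is_localization (A S : comPzRingType) (f : A)
    (iota : {rmorphism A -> S}) : Prop :=
  [/\ exists v, iota f * v = 1,
      forall a, iota a = 0 -> exists n, f ^+ n * a = 0
    & forall s, exists n a, s * iota (f ^+ n) = iota a].

(* Zariski sheaf condition: exactness of
     F(A) -> prod_i F(A[1/f_i]) => prod_(i, j) F(A[1/(f_i f_j)])
   whenever the f_i generate the unit ideal; it is stated for arbitrary
   models of the localizations. *)
Definition zariski_local (F : functor Ring) : Prop :=
  forall (A : comPzRingType) (m : nat) (f : 'I_m -> A),
  (exists c : 'I_m -> A, \sum_i c i * f i = 1) ->
  forall (S : 'I_m -> comPzRingType) (iota : forall i, {rmorphism A -> S i}),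
  (forall i, is_localization (f i) (iota i)) ->
  forall x : (forall i, F (S i)),
  (forall i j (T : comPzRingType)
      (g : {rmorphism S i -> T}) (h : {rmorphism S j -> T}),
    g \o iota i =1 h \o iota j ->
    is_localization (f i * f j) (g \o iota i : {rmorphism A -> T}) ->
    fmap F (g : hom (_ : Ring) _) (x i) = fmap F (h : hom (_ : Ring) _) (x j)) ->
  exists! y : F A, forall i, fmap F (iota i : hom (_ : Ring) _) y = x i.

Definition ring_cover (F : functor Ring) (J : Type) (Y : J -> subfunctor F) :
    Prop :=
  (forall i, ring_open (Y i)) /\
  forall (K : fieldType) (x : F K), exists i, Y i K x.

Definition z_scheme (F : functor Ring) : Prop :=
  zariski_local F /\
  exists (J : Type) (Y : J -> subfunctor F),
    ring_cover Y /\ forall i, exists A : Ring, represented_by (Y i) A.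

Definition noetherian_z_scheme (F : functor Ring) : Prop :=
  z_scheme F /\
  exists (m : nat) (Y : 'I_m -> subfunctor F),
    ring_cover Y /\
    forall i, exists A : Ring, noetherian_ring A /\ represented_by (Y i) A.

Definition mulmon (A : comPzRingType) : mon0 :=
  @Mon0 A 1 0 *%R (@mulrA A) (@mulrC A) (@mul1r A) (@mul0r A).

Definition rmorph_mhom (A B : comPzRingType) (f : {rmorphism A -> B}) :
    mhom (mulmon A) (mulmon B) :=
  @MHom (mulmon A) (mulmon B) f (rmorph1 f) (rmorph0 f) (rmorphM f).

(* beta^* on nonzero rings *)
Definition beta_star (A : comNzRingType) : mo.
Proof. by exists (mulmon A) => /= /eqP; rewrite eq_sym oner_eq0. Defined.

Inductive mr_obj : Type := OfMo of mo | OfRing of comPzRingType.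

(* [mhom M (mulmon A)] is Hom(M, beta^*(A)) = Hom(Z[M], A). *)
Definition mr_hom (A B : mr_obj) : Type :=
  match A, B with
  | OfMo M, OfMo N => mhom M N
  | OfRing A, OfRing B => {rmorphism A -> B}
  | OfMo M, OfRing B => mhom M (mulmon B)
  | OfRing _, OfMo _ => void
  end.

Definition mr_id (A : mr_obj) : mr_hom A A :=
  match A with OfMo M => mhom_id M | OfRing A => idfun end.

Definition mr_comp (A B C : mr_obj) : mr_hom B C -> mr_hom A B -> mr_hom A C :=
  match A, B, C return mr_hom B C -> mr_hom A B -> mr_hom A C with
  | OfMo _, OfMo _, OfMo _ => fun g f => mhom_comp g f
  | OfMo _, OfMo _, OfRing _ => fun g f => mhom_comp g f
  | OfMo _, OfRing _, OfRing _ => fun g f => mhom_comp (rmorph_mhom g) f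
  | OfRing _, OfRing _, OfRing _ => fun g f => g \o f
  | OfMo _, OfRing _, OfMo _ => fun g _ => match g with end
  | OfRing _, OfRing _, OfMo _ => fun g _ => match g with end
  | OfRing _, OfMo _, _ => fun _ f => match f with end
  end.

Definition MR : category.
Proof.
apply: (@Category mr_obj mr_hom mr_id mr_comp).
- by move=> [M|A] [N|B] //= f; (apply: mhom_ext || apply: rmorph_ext).
- by move=> [M|A] [N|B] //= f; (apply: mhom_ext || apply: rmorph_ext).
- by move=> [M|A] [N|B] [P|C] [Q|D] //= f g h;
    (apply: mhom_ext || apply: rmorph_ext).
Defined.

Definition mo_part (F : functor MR) : functor Mo :=
  @Functor Mo (fun M => F (OfMo M))
    (fun M N f => fmap F (f : hom (OfMo M : MR) (OfMo N)))
    (fun M => @fmap1 _ F (OfMo M))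
    (fun M N P => @fmapM _ F (OfMo M) (OfMo N) (OfMo P)).

Definition ring_part (F : functor MR) : functor Ring :=
  @Functor Ring (fun A => F (OfRing A))
    (fun A B f => fmap F (f : hom (OfRing A : MR) (OfRing B)))
    (fun A => @fmap1 _ F (OfRing A))
    (fun A B C => @fmapM _ F (OfRing A) (OfRing B) (OfRing C)).

(* e_A : F(beta^*(A)) -> F(A) comes from the morphism beta^*(A) -> A of MR
   given by the identity of beta^*(A). *)
Definition comparison (F : functor MR) (A : comNzRingType) :
    F (OfMo (beta_star A)) -> F (OfRing A) :=
  fmap F (mhom_id (mulmon A) : hom (OfMo (beta_star A) : MR) (OfRing A)).

Definition f1_scheme (F : functor MR) : Prop :=
  [/\ z_scheme (ring_part F), mo_scheme (mo_part F)
    & forall K : fieldType, bijective (@comparison F K)].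

Record premon0 := PreMon0 {
  pcar :> Type;
  peq : pcar -> pcar -> Prop;
  pone : pcar;
  pzero : pcar;
  pmul : pcar -> pcar -> pcar;
  peq_refl : forall x, peq x x;
  peq_sym : forall x y, peq x y -> peq y x;
  peq_trans : forall x y z, peq x y -> peq y z -> peq x z;
  pmul_eq : forall x x' y y', peq x x' -> peq y y' ->
    peq (pmul x y) (pmul x' y');
  pmulA : forall x y z, peq (pmul x (pmul y z)) (pmul (pmul x y) z);
  pmulC : forall x y, peq (pmul x y) (pmul y x);
  pmul1 : forall x, peq (pmul pone x) x;
  pmul0 : forall x, peq (pmul pzero x) pzero }.

Section Quotient.
Variable P : premon0.

Definition quot_car : Type := {c : set P | exists a, c = peq a}.

Definition pcls (a : P) : quot_car :=
  exist _ (peq a) (ex_intro _ a erefl).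

Definition prep (c : quot_car) : P := projT1 (cid (projT2 c)).

Lemma prepK c : pcls (prep c) = c.
Proof.
rewrite /prep; case: cid => a /=; case: c => c hc /= e.
by apply: eq_exist; rewrite e.
Qed.

Lemma pcls_eq a b : pcls a = pcls b <-> peq a b.
Proof.
split=> [[e]|ab]; first by rewrite e; exact: peq_refl.
apply: eq_exist; apply/seteqP; split=> x /= h.
  exact: peq_trans (peq_sym ab) h.
exact: peq_trans ab h.
Qed.

Definition quot_mul (c d : quot_car) := pcls (pmul (prep c) (prep d)).

Lemma quot_mulE a b : quot_mul (pcls a) (pcls b) = pcls (pmul a b).
Proof. by apply/pcls_eq/pmul_eq; apply/pcls_eq; rewrite prepK. Qed.

Definition quot : mon0.
Proof.
refine (@Mon0 quot_car (pcls (pone P)) (pcls (pzero P)) quot_mul _ _ _ _).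
- move=> x y z; rewrite -(prepK x) -(prepK y) -(prepK z) !quot_mulE.
  exact/pcls_eq/pmulA.
- move=> x y; rewrite -(prepK x) -(prepK y) !quot_mulE.
  exact/pcls_eq/pmulC.
- move=> x; rewrite -(prepK x) !quot_mulE; exact/pcls_eq/pmul1.
- move=> x; rewrite -(prepK x) !quot_mulE; exact/pcls_eq/pmul0.
Defined.
End Quotient.

HB.instance Definition _ (M : mon0) :=
  Monoid.isComLaw.Build M one0 mul0 (@mul0A M) (@mul0C M) (@mul1m M).

Record spec (M : mon0) := Spec_ {
  pset :> set M;
  p_ideal : mo_ideal pset;
  p_proper : ~ pset one0;
  p_prime : forall a b, pset (mul0 a b) -> pset a \/ pset b }.

Lemma spec_ext (M : mon0) (p q : spec M) : pset p = pset q -> p = q.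
Proof.
case: p => p p1 p2 p3; case: q => q q1 q2 q3 /= e.
by rewrite e in p1 p2 p3 *; congr Spec_; exact: Prop_irrelevance.
Qed.

HB.instance Definition _ (M : mon0) := gen_eqMixin (spec M).
HB.instance Definition _ (M : mon0) := gen_choiceMixin (spec M).

Section SpecTopology.
Variable M : mon0.

Definition spec_open (A : set (spec M)) : Prop :=
  exists2 I : set M, mo_ideal I & A = [set p | ~ (I `<=` pset p)].

Let spec_openT : spec_open setT.
Proof.
exists setT; first by split.
apply/seteqP; split=> // p _ /(_ one0 Logic.I); exact: p_proper.
Qed.

Let spec_openI : setI_closed spec_open.
Proof.
move=> _ _ [I [I0 IM] ->] [J [J0 JM] ->].
exists (I `&` J).
  by split=> // a b [Ia Ja]; split; [exact: IM|exact: JM].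
apply/seteqP; split=> p /=.
  case=> /existsNP[a /not_implyP[Ia pa]] /existsNP[b /not_implyP[Jb pb]] h.
  case: (@p_prime _ p a b) => //; apply: h; split; first exact: IM.
  by rewrite mul0C; exact: JM.
by move=> h; split=> s; apply: h => a [? ?]; exact: s.
Qed.

Let spec_open_bigU (T : Type) (f : T -> set (spec M)) :
  (forall i, spec_open (f i)) -> spec_open (\bigcup_i f i).
Proof.
move=> h.
pose J i : set M := projT1 (cid2 (h i)).
have [J1 J2] : (forall i, mo_ideal (J i)) /\
    forall i, f i = [set p | ~ (J i `<=` pset p)].
  by split=> i; rewrite /J; case: cid2.
exists [set a | a = zero0 \/ exists i, J i a].
  split=> [|a b [->|[i Ja]]]; first by left.
    by left; rewrite mul0m.
  by right; exists i; apply: (J1 i).2.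
apply/seteqP; split=> p /=.
  move=> [i _]; rewrite J2 /= => hn s; apply: hn => a Ja.
  by apply: s; right; exists i.
move=> /existsNP[a /not_implyP[[->|[i Ja]] pa]].
  by case: pa; exact: (p_ideal p).1.
exists i => //; rewrite J2 /= => s; exact: pa (s _ Ja).
Qed.

HB.instance Definition _ := isOpenTopological.Build (spec M)
  spec_openT spec_openI spec_open_bigU.

Lemma spec_openE (A : set (spec M)) : open A <-> spec_open A.
Proof.
split=> [|oA]; rewrite openE.
  move=> AA.
  have -> : A = \bigcup_(B : {B : set (spec M) | spec_open B /\ B `<=` A})
      proj1_sig B.
    apply/seteqP; split=> p.
      move=> /AA [B [oB pB BA]]; have h : spec_open B /\ B `<=` A by [].
      by exists (exist _ B h).
    by move=> [[B [oB BA]] _ /= Bp]; exact: BA.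
  by apply: spec_open_bigU => -[B [oB BA]].
by move=> p Ap; exists A; split.
Qed.
End SpecTopology.

Section Localization.
Variables (M : mon0) (p : spec M).

Record frac := Frac { num : M; den : M; denP : ~ pset p den }.

Lemma compl_mul a b : ~ pset p a -> ~ pset p b -> ~ pset p (mul0 a b).
Proof. by move=> ha hb /p_prime[]. Qed.

Definition frac_eq (x y : frac) : Prop :=
  exists2 h, ~ pset p h &
    mul0 h (mul0 (num x) (den y)) = mul0 h (mul0 (num y) (den x)).

Definition frac_mul (x y : frac) : frac :=
  Frac (mul0 (num x) (num y)) (compl_mul (@denP x) (@denP y)).

Definition frac_premon : premon0.
Proof.
refine (@PreMon0 frac frac_eq (Frac one0 (@p_proper _ p))
  (Frac zero0 (@p_proper _ p)) frac_mul _ _ _ _ _ _ _ _).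
- by move=> x; exists one0 => //; exact: p_proper.
- by move=> x y [h hp e]; exists h.
- move=> x y z [h hp e] [k kp e'].
  exists (mul0 (mul0 h k) (den y)).
    by apply: compl_mul; [exact: compl_mul|exact: denP].
  rewrite [LHS](@mul0 M).[AC (3*2) ((2*5)*(1*(4*3)))] e 
    [LHS](@mul0 M).[AC (2*(1*2)) ((3*5)*(1*(4*2)))] e'.
  by rewrite [LHS](@mul0 M).[AC (2*(1*2)) ((1*3*5)*(4*2))].
- move=> x x' y y' [h hp e] [k kp e']; exists (mul0 h k); first exact: compl_mul.
  rewrite /= [LHS](@mul0 M).[AC (2*(2*2)) ((1*(3*5))*(2*(4*6)))] e e'.
  by rewrite [LHS](@mul0 M).[AC ((1*2)*(1*2)) ((1*4)*((2*5)*(3*6)))].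
- by move=> x y z; exists one0; [exact: p_proper|rewrite /= !mul0A].
- move=> x y; exists one0; [exact: p_proper|rewrite /=].
  by rewrite (mul0C (num y)) (mul0C (den y)).
- move=> x; exists one0; [exact: p_proper|rewrite /=].
  by rewrite !mul1m.
- move=> x; exists one0; [exact: p_proper|rewrite /=].
  by rewrite !mul0m.
Defined.

Definition loc : mon0 := quot frac_premon.

Definition fracc (a f : M) (hf : ~ pset p f) : loc :=
  pcls (Frac a hf : frac_premon).
End Localization.

Record opens (T : topologicalType) := Opens {
  oset :> set T; osetP : open oset }.

Lemma opens_ext (T : topologicalType) (U V : opens T) :
  oset U = oset V -> U = V.
Proof.
case: U => U hU; case: V => V hV /= e.
by rewrite e in hU *; congr Opens; exact: Prop_irrelevance.
Qed.

Definition capo (T : topologicalType) (U V : opens T) : opens T :=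
  Opens (openI (osetP U) (osetP V)).

Lemma capol (T : topologicalType) (U V : opens T) : capo U V `<=` U.
Proof. exact: subIsetl. Qed.

Lemma capor (T : topologicalType) (U V : opens T) : capo U V `<=` V.
Proof. exact: subIsetr. Qed.

Definition open_preim (S T : topologicalType) (f : S -> T)
    (cf : continuous f) (V : opens T) : opens S :=
  Opens (proj1 (continuousP f) cf V (osetP V)).

Record mspace := MSpace {
  space :> topologicalType;
  sect : opens space -> mon0;
  res : forall U V : opens space, V `<=` U -> mhom (sect U) (sect V);
  res_id : forall (U : opens space) (h : U `<=` U) s, res h s = s;
  res_res : forall (U V W : opens space) (VU : V `<=` U) (WV : W `<=` V)
    (WU : W `<=` U) s, res WV (res VU s) = res WU s;
  sheaf : forall (I : Type) (V : I -> opens space) (U : opens space)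
    (VU : forall i, V i `<=` U), U `<=` \bigcup_i V i ->
    forall s : (forall i, sect (V i)),
    (forall i j, res (@capol _ (V i) (V j)) (s i) =
                 res (@capor _ (V i) (V j)) (s j)) ->
    exists! t : sect U, forall i, res (VU i) t = s i }.
Arguments sect {m}.
Arguments res {m U V}.

Lemma res_irr (X : mspace) (U V : opens X) (h h' : V `<=` U) (s : sect U) :
  res h s = res h' s.
Proof. by rewrite (Prop_irrelevance h h'). Qed.

Lemma resT (X : mspace) (U V W : opens X) (VU : V `<=` U) (WV : W `<=` V) s :
  res WV (res VU s) = res (subset_trans WV VU) s.
Proof. exact: res_res. Qed.

Section Stalk.
Variables (X : mspace) (x : X).

Record germ_rep := GermRep {
  gopen : opens X; gmem : oset gopen x; gsec : sect gopen }.

Definition germ_eq (a b : germ_rep) : Prop :=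
  exists (W : opens X) (Wa : W `<=` gopen a) (Wb : W `<=` gopen b),
    oset W x /\ res Wa (gsec a) = res Wb (gsec b).

Definition germ_mul (a b : germ_rep) : germ_rep :=
  @GermRep (capo (gopen a) (gopen b)) (conj (gmem a) (gmem b))
    (mul0 (res (@capol _ (gopen a) (gopen b)) (gsec a))
          (res (@capor _ (gopen a) (gopen b)) (gsec b))).

Definition setT_opens : opens X := Opens openT.

Definition germ_premon : premon0.
Proof.
refine (@PreMon0 germ_rep germ_eq (@GermRep setT_opens Logic.I one0)
  (@GermRep setT_opens Logic.I zero0) germ_mul _ _ _ _ _ _ _ _).
- by move=> a; exists (gopen a), (@subset_refl _ _), (@subset_refl _ _);
    split => //; exact: gmem.
- by move=> a b [W [Wa [Wb [Wx e]]]]; exists W, Wb, Wa; split.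
- move=> a b c [W [Wa [Wb [Wx e]]]] [W' [W'b [W'c [W'x e']]]].
  exists (capo W W').
  have h1 : capo W W' `<=` W by exact: subIsetl.
  have h2 : capo W W' `<=` W' by exact: subIsetr.
  have ha := subset_trans h1 Wa; have hb := subset_trans h1 Wb.
  have hc := subset_trans h2 W'c.
  exists ha, hc; split=> //.
  by rewrite -(res_res Wa h1) e (res_res Wb h1 hb) -(res_res W'b h2) e' res_res.
- move=> a a' b b' [W [Wa [Wa' [Wx e]]]] [W' [Wb [Wb' [W'x e']]]].
  exists (capo W W').
  have h1 : capo W W' `<=` W by exact: subIsetl.
  have h2 : capo W W' `<=` W' by exact: subIsetr.
  have ha := subset_trans h1 Wa; have ha' := subset_trans h1 Wa'.
  have hb := subset_trans h2 Wb; have hb' := subset_trans h2 Wb'.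
  have k : capo W W' `<=` capo (gopen a) (gopen b)
    by move=> y hy; split; [exact: ha|exact: hb].
  have k' : capo W W' `<=` capo (gopen a') (gopen b')
    by move=> y hy; split; [exact: ha'|exact: hb'].
  exists k, k'; split=> //.
  rewrite !mfunM (res_res _ _ ha) (res_res _ _ hb) (res_res _ _ ha').
  rewrite (res_res _ _ hb') -(res_res Wa h1) -(res_res Wa' h1) e.
  by rewrite -(res_res Wb h2) -(res_res Wb' h2) e'.
- move=> a b c.
  set A := gopen a; set B := gopen b; set C := gopen c.
  exists (capo (capo A B) C).
  have k : capo (capo A B) C `<=` capo A (capo B C) by move=> y [[]].
  exists k, (@subset_refl _ _); split.
    by split; [split|]; exact: gmem.
  rewrite res_id /= !mfunM !resT mul0A.
  by congr mul0; [congr mul0|]; exact: res_irr.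
- move=> a b.
  have k : capo (gopen a) (gopen b) `<=` capo (gopen b) (gopen a)
    by move=> y [].
  exists (capo (gopen a) (gopen b)), (@subset_refl _ _), k; split.
    by split; exact: gmem.
  by rewrite res_id /= mfunM !resT mul0C; congr mul0; exact: res_irr.
- move=> a.
  have k : gopen a `<=` capo setT_opens (gopen a) by move=> y.
  exists (gopen a), k, (@subset_refl _ _); split; first exact: gmem.
  by rewrite res_id /= mfunM !mfun1 mul1m resT res_id.
- move=> a.
  have k : capo setT_opens (gopen a) `<=` setT_opens by move=> y.
  exists (capo setT_opens (gopen a)), (@subset_refl _ _), k; split.
    by split=> //; exact: gmem.
  by rewrite res_id /= !mfun0 mul0m.
Defined.

Definition stalk : mon0 := quot germ_premon.

Definition germ (U : opens X) (Ux : oset U x) (s : sect U) : stalk :=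
  pcls (GermRep Ux s : germ_premon).
End Stalk.

Definition is_unit (M : mon0) (u : M) : Prop := exists v, mul0 u v = one0.

(* [mlocal]: the stalk maps rho satisfy rho^-1(units) = units; every element
   of a stalk is the germ of a section. *)
Record morphism (X Y : mspace) := Morphism {
  mpt :> X -> Y;
  mcont : continuous mpt;
  msec : forall V : opens Y, mhom (sect V) (sect (open_preim mcont V));
  mres : forall (U V : opens Y) (VU : V `<=` U) (s : sect U),
    msec V (res VU s) =
    res (preimage_subset VU : open_preim mcont V `<=` open_preim mcont U)
      (msec U s);
  mlocal : forall (x : X) (V : opens Y) (hV : oset V (mpt x)) (s : sect V),
    is_unit (@germ X x (open_preim mcont V) hV (msec V s)) <->
    is_unit (@germ Y (mpt x) V hV s) }.
Arguments msec {X Y} m V.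
Arguments mcont {X Y} m.

Lemma morphism_ext (X Y : mspace) (f g : morphism X Y) :
  mpt f = mpt g ->
  (forall (V : opens Y) (W : opens X)
     (Wf : W `<=` open_preim (mcont f) V) (Wg : W `<=` open_preim (mcont g) V)
     (s : sect V), res Wf (msec f V s) = res Wg (msec g V s)) ->
  f = g.
Proof.
case: f => f cf sf rf lf; case: g => g cg sg rg lg /= e.
rewrite e in cf sf rf lf *; rewrite (Prop_irrelevance cf cg) in sf rf lf *.
move=> h; have es : sf = sg.
  apply: functional_extensionality_dep => V; apply: mhom_ext => s.
  have := h V (open_preim cg V) (@subset_refl _ _) (@subset_refl _ _) s.
  by rewrite !res_id.
by rewrite es in rf lf *; congr Morphism; exact: Prop_irrelevance.
Qed.

Lemma comp_cont (X Y Z : topologicalType) (g : Y -> Z) (f : X -> Y) :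
  continuous g -> continuous f -> continuous (g \o f).
Proof. by move=> cg cf x; apply: continuous_comp; [exact: cf|exact: cg]. Qed.

Lemma germ_res (X : mspace) (x : X) (U V : opens X) (VU : V `<=` U)
    (Ux : oset U x) (Vx : oset V x) (s : sect U) :
  germ Vx (res VU s) = germ Ux s.
Proof.
apply/pcls_eq; exists V, (@subset_refl _ _), VU; split=> //=.
by rewrite res_id.
Qed.

Lemma germ_irr (X : mspace) (x : X) (U : opens X) (Ux Ux' : oset U x)
  (s : sect U) : germ Ux s = germ Ux' s.
Proof. by rewrite (Prop_irrelevance Ux Ux'). Qed.

Lemma germ_unit (X : mspace) (x : X) (U : opens X) (Ux : oset U x)
    (s : sect U) :
  is_unit (germ Ux s) <->
  exists (V : opens X) (VU : V `<=` U), oset V x /\ is_unit (res VU s).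
Proof.
split=> [[v]|[V [VU [Vx [v e]]]]].
  rewrite -(prepK v); case: (prep v) => W Wx t.
  move=> /(etrans (esym (quot_mulE _ _)))/pcls_eq[V [VUW [VT [Vx]]]].
  rewrite /= mfunM !resT mfun1 => e.
  exists V, (subset_trans VUW (@capol _ U W)); split=> //.
  by exists (res (subset_trans VUW (@capor _ U W)) t).
rewrite -(germ_res VU Ux Vx); exists (germ Vx v).
rewrite [LHS]quot_mulE; apply/pcls_eq.
have k : V `<=` capo V V by move=> y.
exists V, k, (@subsetT _ _ : V `<=` setT_opens X); split=> //=.
by rewrite mfunM !resT mfun1 -e; congr mul0; [exact: res_irr|rewrite res_id].
Qed.

Definition morphism_comp (X Y Z : mspace) (g : morphism Y Z)
    (f : morphism X Y) : morphism X Z.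
Proof.
unshelve refine (@Morphism X Z (g \o f) (comp_cont (mcont g) (mcont f)) (fun V =>
   mhom_comp (@res X (open_preim (mcont f) (open_preim (mcont g) V))
                     (open_preim (comp_cont (mcont g) (mcont f)) V) (@subset_refl _ _))
     (mhom_comp (msec f (open_preim (mcont g) V)) (msec g V))) _ _).
- by move=> U V VU s; rewrite /= !mres !resT; exact: res_irr.
- move=> x V hV s /=; rewrite germ_res.
  by rewrite (mlocal (m := f)) (mlocal (m := g)).
Defined.

(* Open immersion: a homeomorphism onto an open subset identifying the
   structure sheaves. *)
Definition open_immersion (X Y : mspace) (j : morphism X Y) : Prop :=
  [/\ injective j, forall U : set X, open U -> open (j @` U)
    & forall V : opens Y, V `<=` range j -> bijective (msec j V)].

Section SpecSheaf.
Variable M : mon0.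

Definition locally_frac (U : opens (spec M))
    (s : forall p : spec M, oset U p -> loc p) : Prop :=
  forall p, oset U p -> exists (V : opens (spec M)) (VU : V `<=` U) (a f : M)
    (hf : forall q, oset V q -> ~ pset q f),
    oset V p /\ forall q (hq : oset V q), s q (VU q hq) = fracc a (hf q hq).

Definition spec_sect_car (U : opens (spec M)) : Type :=
  {s : forall p : spec M, oset U p -> loc p | locally_frac s}.

Lemma spec_sect_ext (U : opens (spec M)) (s t : spec_sect_car U) :
  (forall p h, sval s p h = sval t p h) -> s = t.
Proof.
case: s => s hs; case: t => t ht /= h; apply: eq_exist.
apply: functional_extensionality_dep => p.
by apply: functional_extensionality_dep => hp; exact: h.
Qed.

Lemma fracM (p : spec M) (a b f g : M) (hf : ~ pset p f) (hg : ~ pset p g) :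
  mul0 (fracc a hf) (fracc b hg) = fracc (mul0 a b) (compl_mul hf hg).
Proof. exact: quot_mulE. Qed.

Lemma lf_const (U : opens (spec M)) (c : M) :
  locally_frac (fun (p : spec M) (_ : oset U p) => fracc c (@p_proper _ p)).
Proof.
move=> p Up; exists U, (@subset_refl _ _), c, one0.
by exists (fun q _ => @p_proper _ q).
Qed.

Lemma lf_mul (U : opens (spec M)) (s t : spec_sect_car U) :
  locally_frac (fun p h => mul0 (sval s p h) (sval t p h)).
Proof.
move=> p Up.
have [V [VU [a [f [hf [Vp hs]]]]]] := proj2_sig s p Up.
have [W [WU [b [g [hg [Wp ht]]]]]] := proj2_sig t p Up.
have hU : capo V W `<=` U by move=> q [/VU].
exists (capo V W), hU, (mul0 a b), (mul0 f g).
exists (fun q (hq : oset (capo V W) q) =>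
  compl_mul (hf q hq.1) (hg q hq.2)); split=> // q hq.
rewrite -fracM -hs -ht; congr mul0; congr (sval _ q _);
  exact: Prop_irrelevance.
Qed.

Lemma lf_res (U V : opens (spec M)) (VU : V `<=` U) (s : spec_sect_car U) :
  locally_frac (fun p (h : oset V p) => sval s p (VU p h)).
Proof.
move=> p Vp; have [W [WU [a [f [hf [Wp hs]]]]]] := proj2_sig s p (VU p Vp).
exists (capo V W), (@capol _ _ _), a, f,
  (fun q (hq : oset (capo V W) q) => hf q hq.2).
split=> // q hq; rewrite -hs; congr (sval s q _); exact: Prop_irrelevance.
Qed.

Definition spec_sect (U : opens (spec M)) : mon0.
Proof.
refine (@Mon0 (spec_sect_car U) (exist _ _ (@lf_const U one0))
  (exist _ _ (@lf_const U zero0)) (fun s t => exist _ _ (lf_mul s t)) _ _ _ _).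
- by move=> s t u; apply: spec_sect_ext => p h; exact: mul0A.
- by move=> s t; apply: spec_sect_ext => p h; exact: mul0C.
- by move=> s; apply: spec_sect_ext => p h; exact: (mul1m (m := loc p)).
- by move=> s; apply: spec_sect_ext => p h; exact: (mul0m (m := loc p)).
Defined.

Definition spec_res (U V : opens (spec M)) (VU : V `<=` U) :
  mhom (spec_sect U) (spec_sect V).
Proof.
unshelve refine (@MHom (spec_sect U) (spec_sect V)
  (fun s => exist _ _ (lf_res VU s)) _ _ _).
- exact: spec_sect_ext.
- exact: spec_sect_ext.
- by move=> s t; exact: spec_sect_ext.
Defined.

Definition Spec : mspace.
Proof.
apply: (@MSpace (spec M) spec_sect spec_res).
- move=> U h s; apply: spec_sect_ext => p hp /=.
  by congr (sval s p _); exact: Prop_irrelevance.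
- move=> U V W VU WV WU s; apply: spec_sect_ext => p hp /=.
  by congr (sval s p _); exact: Prop_irrelevance.
- move=> I V U VU cov s glue.
  have idx p (h : oset U p) : {i | oset (V i) p}.
    by apply: cid; have [i _ hi] := cov p h; exists i.
  pose t p (h : oset U p) : loc p := sval (s (projT1 (idx p h))) p (projT2 (idx p h)).
  have tE i p (h : oset U p) (hi : oset (V i) p) : t p h = sval (s i) p hi.
    rewrite /t; case: (idx p h) => k hk /=.
    have /(congr1 (fun u : spec_sect_car (capo (V k) (V i)) => sval u p (conj hk hi))) /=
      := glue k i.
    move=> e; transitivity (sval (s k) p (@capol _ (V k) (V i) p (conj hk hi))).
      by congr (sval (s k) p _); exact: Prop_irrelevance.
    by rewrite e; congr (sval (s i) p _); exact: Prop_irrelevance.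
  have lt : locally_frac t.
    move=> p Up; have [i _ hi] := cov p Up.
    have [W [WU [a [f [hf [Wp hs]]]]]] := proj2_sig (s i) p hi.
    exists W, (subset_trans WU (VU i)), a, f, hf; split=> // q hq.
    by rewrite (tE i q _ (WU q hq)) hs.
  exists (exist _ t lt : spec_sect U); split.
    by move=> i; apply: spec_sect_ext => p hi /=; exact: tE.
  move=> t' ht'; apply: spec_sect_ext => p hp /=.
  have [i _ hi] := cov p hp.
  rewrite (tE i p hp hi) -ht' /=.
  by congr (sval t' p _); exact: Prop_irrelevance.
Defined.
End SpecSheaf.

Section SpecMap.
Variables (M N : mon0) (phi : mhom M N).

Definition spec_pt (q : spec N) : spec M.
Proof.
apply: (@Spec_ M (phi @^-1` pset q)).
- split=> [|a b]; rewrite /preimage /= ?mfun0 ?mfunM.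
    exact: (p_ideal q).1.
  exact: (p_ideal q).2.
- by rewrite /preimage /= mfun1; exact: p_proper.
- by move=> a b; rewrite /preimage /= mfunM => /p_prime.
Defined.

Lemma spec_pt_cont : continuous (spec_pt : spec N -> spec M).
Proof.
apply/continuousP => _ /spec_openE[I hI ->]; apply/spec_openE.
exists [set b | exists2 a, I a & exists c, b = mul0 (phi a) c].
  split; first by exists zero0; [exact: hI.1|exists zero0; rewrite mfun0 mul0m].
  move=> _ b [a Ia [c ->]]; exists a => //; exists (mul0 c b).
  by rewrite mul0A.
apply/seteqP; split=> q /= h s; apply: h.
  by move=> a Ia; apply: s; exists a => //; exists one0; rewrite mul0C mul1m.
move=> _ [a Ia [c ->]]; apply: (p_ideal q).2; exact: s.
Qed.

Definition loc_fun (q : spec N) (x : loc (spec_pt q)) : loc q :=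
  fracc (phi (num (prep x))) (denP (f := prep x) : ~ pset q (phi (den (prep x)))).

Lemma loc_funE (q : spec N) (a f : M) (hf : ~ pset (spec_pt q) f) :
  loc_fun (fracc a hf) = fracc (phi a) (hf : ~ pset q (phi f)).
Proof.
apply/pcls_eq => /=.
have /pcls_eq [h hh e] := prepK (fracc a hf).
by exists (phi h) => //=; rewrite -!mfunM e.
Qed.

Definition loc_map (q : spec N) : mhom (loc (spec_pt q)) (loc q).
Proof.
apply: (@MHom _ _ (@loc_fun q)).
- rewrite [LHS]loc_funE; apply/pcls_eq; exists one0; first exact: p_proper.
  by rewrite /= !mfun1.
- rewrite [LHS]loc_funE; apply/pcls_eq; exists one0; first exact: p_proper.
  by rewrite /= mfun0 !mul0m.
- move=> x y; rewrite -(prepK x) -(prepK y).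
  case: (prep x) => a f hf; case: (prep y) => b g hg.
  rewrite (fracM a b hf hg) (loc_funE a hf) (loc_funE b hg) loc_funE fracM.
  by apply/pcls_eq; exists one0; [exact: p_proper|rewrite /= !mfunM].
Defined.
End SpecMap.
Arguments spec_pt_cont {M N} phi.

Section SpecMorphism.
Variables (M N : mon0) (phi : mhom M N).

Lemma lf_map (V : opens (spec M)) (s : spec_sect_car V) :
  @locally_frac N (open_preim (spec_pt_cont phi) V)
    (fun q hq => loc_map phi q (sval s (spec_pt phi q) hq)).
Proof.
move=> q Vq; have [W [WV [a [f [hf [Wq hs]]]]]] := proj2_sig s _ Vq.
exists (open_preim (spec_pt_cont phi) W), (fun r (hr : oset W _) => WV _ hr).
exists (phi a), (phi f), (fun r hr => hf (spec_pt phi r) hr).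
by split=> // r hr; rewrite hs /= loc_funE.
Qed.

Definition spec_sect_map (V : opens (spec M)) :
  mhom (spec_sect V) (spec_sect (open_preim (spec_pt_cont phi) V)).
Proof.
unshelve refine (@MHom (spec_sect V) (spec_sect _)
  (fun s => exist _ _ (lf_map s)) _ _ _).
- by apply: spec_sect_ext => q hq; exact: (mfun1 (loc_map phi q)).
- by apply: spec_sect_ext => q hq; exact: (mfun0 (loc_map phi q)).
- by move=> s t; apply: spec_sect_ext => q hq; exact: (mfunM (loc_map phi q)).
Defined.

Lemma spec_map_local (q : spec N) (V : opens (spec M))
    (hV : oset V (spec_pt phi q)) (s : spec_sect V) :
  is_unit (@germ (Spec N) q (open_preim (spec_pt_cont phi) V) hV
             (spec_sect_map V s)) <->
  is_unit (@germ (Spec M) (spec_pt phi q) V hV s).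
Proof.
split=> /germ_unit[W [WV [Wq [t e]]]]; apply/germ_unit; last first.
  exists (open_preim (spec_pt_cont phi) W), (preimage_subset WV).
  split=> //; exists (spec_sect_map W t).
  transitivity (spec_sect_map W one0); last exact: mfun1.
  rewrite -e (mfunM (spec_sect_map W)); congr mul0.
  apply: spec_sect_ext => r hr; rewrite /=.
  by congr loc_fun; congr (sval s _ _); exact: Prop_irrelevance.
have [U [UV [a [f [hf [Up hs]]]]]] := proj2_sig s (spec_pt phi q) hV.
have na : ~ pset (spec_pt phi q) a.
  have /(congr1 (fun u : spec_sect_car W => sval u q Wq)) := e.
  rewrite /= (_ : sval s _ _ = fracc a (hf _ Up)); last first.
    by rewrite -hs; congr (sval s _ _); exact: Prop_irrelevance.
  rewrite loc_funE -(prepK (sval t q Wq)); case: (prep _) => b g hg.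
  move=> /(etrans (esym (fracM (phi a) b _ hg)))/pcls_eq[h hh] /=; rewrite (mul0C _ one0) !mul1m => e1 pa.
  have : pset q (mul0 h (mul0 (mul0 (phi a) b) one0)).
    by rewrite mul0C; apply: (p_ideal q).2; rewrite mul0C mul1m;
      exact: (p_ideal q).2.
  rewrite (mul0C _ one0) mul1m e1 => /p_prime[//|/p_prime[|//]].
  exact: hf _ Up.
have oD : open [set p : spec M | ~ pset p a].
  apply/spec_openE; exists [set c | exists b, c = mul0 a b].
    split; first by exists zero0; rewrite mul0C mul0m.
    by move=> _ b [c ->]; exists (mul0 c b); rewrite mul0A.
  apply/seteqP; split=> p /= h s'; apply: h.
    by apply: s'; exists one0; rewrite mul0C mul1m.
  by move=> _ [b ->]; exact: (p_ideal p).2.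
pose D : opens (spec M) := capo U (Opens oD).
have DV : D `<=` V by move=> p [/UV].
have lt : @locally_frac M D (fun p hp => fracc f (hp.2 : ~ pset p a)).
  move=> p hp; exists D, (@subset_refl _ _), f, a.
  exists (fun r (hr : oset D r) => hr.2); split=> // r hr.
  congr fracc; exact: Prop_irrelevance.
exists D, DV; split=> //; exists (exist _ _ lt : spec_sect D).
apply: spec_sect_ext => p hp /=.
rewrite (_ : sval s _ _ = fracc a (hf _ hp.1)); last first.
  by rewrite -hs; congr (sval s _ _); exact: Prop_irrelevance.
apply: (etrans (fracM a f (hf _ hp.1) hp.2)).
apply/pcls_eq; exists one0; first exact: p_proper.
by rewrite /= (mul0C a) (mul0C _ one0).
Qed.

Definition spec_map : morphism (Spec N) (Spec M).
Proof.
apply: (@Morphism (Spec N) (Spec M) (spec_pt phi) (spec_pt_cont phi)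
  spec_sect_map).
- move=> U V VU s; apply: spec_sect_ext => q hq.
  rewrite /=; congr loc_fun; congr (sval s _ _); exact: Prop_irrelevance.
- exact: spec_map_local.
Defined.
End SpecMorphism.

Lemma sect_transport (M : mon0) (U : opens (spec M)) (s : spec_sect_car U)
    (p p' : spec M) (hp : oset U p) (hp' : oset U p') :
  p = p' -> exists a f (hf : ~ pset p f) (hf' : ~ pset p' f),
    sval s p hp = fracc a hf /\ sval s p' hp' = fracc a hf'.
Proof.
move=> e; case: p' / e hp' => hp'; rewrite (Prop_irrelevance hp' hp).
have [W [WU [a [f [hf [Wp hs]]]]]] := proj2_sig s p hp.
exists a, f, (hf p Wp), (hf p Wp).
by rewrite -hs; split; congr (sval s p _); exact: Prop_irrelevance.
Qed.

Definition points (X : mspace) : functor Mo.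
Proof.
unshelve refine (@Functor Mo (fun M => morphism (Spec M) X)
  (fun M N phi g => morphism_comp g (spec_map phi)) _ _).
- move=> M g; apply: morphism_ext.
    apply: funext => p /=; congr (g _); exact: spec_ext.
  move=> V W Wf Wg s; apply: spec_sect_ext => p hp.
  rewrite /=.
  have e : spec_pt (mhom_id M) p = p by exact: spec_ext.
  set h1 := subset_refl _.
  have [a [f [hf [hf' [E ->]]]]] := sect_transport (msec g V s) h1 (Wg p hp) e.
  rewrite E loc_funE; apply/pcls_eq; exists one0 => //; exact: p_proper.
- move=> M N P phi psi g; apply: morphism_ext.
    apply: funext => p /=; congr (g _); exact: spec_ext.
  move=> V W Wf Wg s; apply: spec_sect_ext => p hp.
  rewrite /=.
  have e : spec_pt (mhom_comp psi phi) p = spec_pt phi (spec_pt psi p)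
    by exact: spec_ext.
  set h1 := subset_refl _; set h2 := subset_refl _.
  have [a [f [hf [hf' [E E']]]]] := sect_transport (msec g V s) h1 h2 e.
  rewrite E E' !loc_funE; apply/pcls_eq; exists one0 => //; exact: p_proper.
Defined.

Definition geometric_mo_scheme (X : mspace) : Prop :=
  forall x : X, exists (M : mo) (j : morphism (Spec M) X),
    open_immersion j /\ range j x.

Definition is_realization (X : mspace) (F : functor Mo) : Prop :=
  exists eta : nattrans F (points X), forall M, bijective (eta M).

Definition fg_monoid (M : mon0) : Prop :=
  exists (m : nat) (g : 'I_m -> M), forall S : set M,
    S zero0 -> S one0 -> (forall a b, S a -> S b -> S (mul0 a b)) ->
    (forall i, S (g i)) -> S = setT.

(* A commutative monoid is Noetherian if and only if it is finitely
   generated; the latter is used as the definition. *)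
Definition noetherian_mo_scheme (X : mspace) : Prop :=
  exists (m : nat) (M : 'I_m -> mo) (j : forall i, morphism (Spec (M i)) X),
    [/\ forall i, fg_monoid (M i), forall i, open_immersion (j i)
      & forall x : X, exists i, range (j i) x].

(* The group of invertible elements, as an (additively written) abelian
   group. *)
Definition units (M : mon0) : Type := {u : M | is_unit u}.

Section Units.
Variable M : mon0.

Lemma units_ext (u v : units M) : sval u = sval v -> u = v.
Proof. by case: u => u hu; case: v => v hv /= e; apply: eq_exist. Qed.

Lemma is_unit_mul (a b : M) : is_unit a -> is_unit b -> is_unit (mul0 a b).
Proof.
move=> [a' ha] [b' hb]; exists (mul0 a' b').
by rewrite (mul0C a') -mul0A (mul0A b) hb mul1m.
Qed.

Lemma is_unit_one : is_unit (one0 : M).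
Proof. by exists one0; rewrite mul1m. Qed.

Definition units_add (u v : units M) : units M :=
  exist _ (mul0 (sval u) (sval v)) (is_unit_mul (proj2_sig u) (proj2_sig v)).

Definition units_zero : units M := exist _ one0 is_unit_one.

Lemma is_unit_inv (u : units M) : is_unit (projT1 (cid (proj2_sig u))).
Proof. by case: cid => v /= h; exists (sval u); rewrite mul0C. Qed.

Definition units_opp (u : units M) : units M := exist _ _ (is_unit_inv u).

Lemma units_addA : associative units_add.
Proof. by move=> u v w; apply: units_ext => /=; rewrite mul0A. Qed.

Lemma units_addC : commutative units_add.
Proof. by move=> u v; apply: units_ext => /=; rewrite mul0C. Qed.

Lemma units_add0 : left_id units_zero units_add.
Proof. by move=> u; apply: units_ext => /=; rewrite mul1m. Qed.

Lemma units_addN : left_inverse units_zero units_opp units_add.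
Proof.
by move=> u; apply: units_ext => /=; case: cid => v /= h; rewrite mul0C.
Qed.

HB.instance Definition _ := gen_eqMixin (units M).
HB.instance Definition _ := gen_choiceMixin (units M).
HB.instance Definition _ := GRing.isZmodule.Build (units M)
  units_addA units_addC units_add0 units_addN.
End Units.

(* The number of elements of [A] (0 if [A] is infinite). *)
Definition ncard (T : Type) (A : set T) : nat :=
  xget 0%N [set n | (A #= `I_n)%card].

Definition lin_indep (V : zmodType) (r : nat) (v : 'I_r -> V) : Prop :=
  forall c : 'I_r -> int, \sum_i v i *~ c i = 0 -> forall i, c i = 0.

(* The rank of an abelian group: the maximal number of Z-linearly independent
   elements (0 if there is no maximum). *)
Definition ab_rank (V : zmodType) : nat :=
  \big[maxn/0%N]_(r \in [set r | exists v : 'I_r -> V, lin_indep v]) r.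

(* For [d >= 1], the ordinal type ['I_d.-1.+1] with its modular addition is
   Z/dZ (['Z_1] would be Z/2Z). *)
Notation Zmod d := 'I_d.-1.+1.

Definition nu (d : nat) (V : zmodType) : nat :=
  ncard [set f : {additive Zmod d -> V} | injective f].

Definition F1_ (n : nat) : mo := F1 (Zmod n).

Definition noetherian_f1_scheme (F : functor MR) (X : mspace) : Prop :=
  noetherian_z_scheme (ring_part F) /\ noetherian_mo_scheme X.

Definition local_dim (X : mspace) (x : X) : nat := ab_rank (units (stalk x)).

Definition dimension (X : mspace) : nat :=
  \big[maxn/0%N]_(x \in [set: X]) local_dim x.

Definition zeta_exponent (X : mspace) (j : nat) : rat :=
  (-1) ^+ j.+1 * \sum_(x \in [set: X])
    ((-1) ^+ local_dim x * 'C(local_dim x, j)%:R *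
     \sum_(d \in [set d : nat | (0 < d)%N])
        (d%:R^-1 * (nu d (units (stalk x)))%:R : rat)).

Local Open Scope complex_scope.

Section Zeta.
Variable R : realType.
Local Notation C := (R[i]).
Local Notation Re := (@complex.Re R).
Local Notation Im := (@complex.Im R).

Definition cexp (z : C) : C :=
  (expR (Re z))%:C * (cos (Im z) +i* sin (Im z)).

Definition ccos (z : C) : C := (cexp ('i%C * z) + cexp (- ('i%C * z))) / 2.

Definition cabs (z : C) : R := Num.sqrt (Re z ^+ 2 + Im z ^+ 2).

(* principal argument, in ]-pi, pi] for z != 0 *)
Definition carg (z : C) : R :=
  let t := acos (Re z / cabs z) in if 0 <= Im z then t else - t.

Definition clog (z : C) : C := ln (cabs z) +i* carg z.

(* principal branch of z^a *)
Definition cpow (z : C) (a : R) : C := cexp (a%:C * clog z).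

Definition entire_fun (f : C -> C) : Prop :=
  forall z : C, derivable (f : C^o -> C^o) z 1.

Definition cderive (f : C -> C) (z : C) : C := 'D_1 (f : C^o -> C^o) z.

(* [g] is of the form g(n) = sum_(j < J) T_j(n) n^j with T_j periodic, and [N]
   is its canonical entire extension f(z) + cos(pi z) Q(z). The exponentials
   e^(2 pi i a n), |a| < 1/2, and (-1)^n being distinct characters of Z, [N]
   is determined by [g]; the construction commutes with integer translations
   of the variable. *)
Definition canonical_extension (g : int -> R) (N : C -> C) : Prop :=
  exists (J : nat) (T : nat -> int -> R)
    (I : seq rat) (t : nat -> rat -> C) (s : nat -> C),
  let e (a : rat) (z : C) := cexp ('i%C * (2 * pi * ratr a)%:C * z) in
  [/\ forall j, exists2 m : nat, (0 < m)%N & forall n, T j (n + m%:Z) = T j n,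
      forall n : int, g n = \sum_(j < J) T j n * n%:~R ^+ j,
      uniq I /\ (forall a, a \in I -> `|a| < 1 / 2),
      forall j (n : int),
        (T j n)%:C = \sum_(a <- I) t j a * e a n%:~R + s j * (-1) ^ n
    & forall z, N z = \sum_(j < J) (\sum_(a <- I) t j a * e a z) * z ^+ j
                      + ccos (pi%:C * z) * \sum_(j < J) s j * z ^+ j].

(* N_X(n + 1) = #X(F_{1^n}) for n >= 1, extended canonically to Z, to C, and
   then restricted to [1, oo[. Only the values of [N] on [1, oo[ matter. *)
Definition counting_function (F : functor MR) (N : R -> R) : Prop :=
  exists (g : int -> R) (Ncan : C -> C),
  [/\ forall n : nat, (0 < n)%N ->
        g (n%:Z + 1) = (ncard [set: mo_part F (F1_ n)])%:R,
      canonical_extension g Ncan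
    & forall u : R, 1 <= u -> (N u)%:C = Ncan u%:C].

Definition growth_bound (N : R -> R) (k : R) : Prop :=
  exists c : R, forall q : R, 1 <= q -> `|N q| <= c * q `^ k.

(* q^(-s) for a real q > 0 *)
Definition rpowN (q : R) (s : C) : C := cexp (- (s * (ln q)%:C)).

Definition zetaF (N : R -> R) (q : R) (s : C) : C :=
  - cderive (fun s' : C =>
      limn (series (fun r : nat =>
        (N (q ^+ r.+1))%:C * rpowN q (r.+1%:R * s') / r.+1%:R : C^o))) s.

Definition zeta_integral (N : R -> R) (s : C) : C :=
  let f u := (N u)%:C * rpowN u s / u%:C in
  (\int[lebesgue_measure]_(u in `[1, +oo[) Re (f u)) +i*
  (\int[lebesgue_measure]_(u in `[1, +oo[) Im (f u)).

(* zeta'/zeta = - lim_(q -> 1+) F(q, s) = - int_1^oo N(u) u^(-s) du/u on the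
   half-plane Re(s) > k; this determines zeta there up to a multiplicative
   constant. *)
Definition is_zeta (N : R -> R) (k : R) (zeta : C -> C) : Prop :=
  forall s : C, k < Re s ->
  [/\ derivable (zeta : C^o -> C^o) s 1, zeta s != 0,
      zetaF N q s @[q --> 1^'+] --> (zeta_integral N s : C^o)
    & cderive zeta s / zeta s = - zeta_integral N s].

End Zeta.

(* Main.v *)
Require Import Defs.
From HB Require Import structures.
From mathcomp Require Import all_boot all_order all_algebra.
From mathcomp Require Import all_classical all_reals all_analysis.
From mathcomp Require Import complex ring lra.

Set Implicit Arguments.
Unset Strict Implicit.
Unset Printing Implicit Defensive.

Import Order.TTheory GRing.Theory Num.Theory.
Import numFieldNormedType.Exports.
Local Open Scope classical_set_scope.
Local Open Scope ring_scope.
Local Open Scope complex_scope.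

(** A morphism from Spec F_1[Z/m] to X is a point x of X with a homomorphism
    from the unit group G_x of the stalk at x to Z/m ([ncard_morphisms]). If X
    is Noetherian, it has finitely many points, since a prime ideal of a
    finitely generated monoid is determined by the generators that it contains
    ([noetherian_finite]), and the groups G_x are finitely generated
    ([stalk_units_fg]). A finitely generated group G of rank r has m^r tau(m)
    homomorphisms to Z/m, where tau(m) is the number of elements of G killed by
    m. This number is periodic in m, and its mean value is the sum of 1 / ord(v)
    over the torsion elements v, i.e. the sum over d of nu(d, G) / d
    ([count_hom_fg]). Hence N_X(m + 1) is the sum over x of m^n(x) tau_x(m).

    Expanding the powers of m = (m + 1) - 1 gives a polynomial in u = m + 1 with
    periodic coefficients, and its canonical extension is a finite sum of terms
    a e^(cu) u^j with c imaginary. For c = 0 the coefficient a is the mean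
    value of the j-th periodic coefficient, which is - alpha_j by the formula
    for the exponents ([quasi_poly_zero], [chr_coef], [zeta_of_count]).

    The zeta function is therefore governed by two integrals over the half-line
    u >= 1. The integral of u^(j - s - 1) is 1 / (s - j), whose primitive is
    log (s - j): this accounts for the power of s - j. For c <> 0 the integral
    of e^(cu) u^(j - s - 1) extends to an entire function of s, by repeated
    integration by parts ([osc_parts], [osc_entire]), and a primitive of it
    contributes to h. The function obtained in this way satisfies the
    differential equation of zeta, and the quotient of two solutions on a
    half-plane is constant ([zeta_of_oscillating]).

    That F(q, s) tends to the integral holds for every continuous N of
    polynomial growth: F(q, s) is the Riemann sum of N(u) u^(-s) du/u for the
    subdivision of the half-line by the powers of q ([zetaF_qstep]), and it
    converges by dominated convergence ([qstep_limit]). *)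

(** * Complex modulus and complex derivatives *)

Section ComplexNorm.
Variable R : realType.
Local Notation C := (R[i]).
Local Notation Re := (@complex.Re R).
Local Notation Im := (@complex.Im R).

Lemma cabsE (z : C) : `|z| = (cabs z)%:C.
Proof. by rewrite normc_def. Qed.

Lemma cabs_ge0 (z : C) : 0 <= cabs z.
Proof. exact: sqrtr_ge0. Qed.

Lemma cabsD (z w : C) : cabs (z + w) <= cabs z + cabs w.
Proof. by rewrite -lecR rmorphD /= -!cabsE ler_normD. Qed.

Lemma cabsM (z w : C) : cabs (z * w) = cabs z * cabs w.
Proof. by apply: (@complexI R); rewrite rmorphM /= -!cabsE normrM. Qed.

Lemma cabsN (z : C) : cabs (- z) = cabs z.
Proof. by apply: (@complexI R); rewrite -!cabsE normrN. Qed.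

Lemma cabsB (z w : C) : cabs (z - w) = cabs (w - z).
Proof. by rewrite -cabsN opprB. Qed.

Lemma cabsX (z : C) n : cabs (z ^+ n) = cabs z ^+ n.
Proof. by apply: (@complexI R); rewrite rmorphXn /= -!cabsE normrX. Qed.

Lemma cabs0 : cabs (0 : C) = 0.
Proof. by apply: (@complexI R); rewrite -cabsE normr0. Qed.

Lemma cabs_eq0 (z : C) : (cabs z == 0) = (z == 0).
Proof. by rewrite -[z == 0]normr_eq0 cabsE -(inj_eq (@complexI R)). Qed.

Lemma cabs_gt0 (z : C) : (0 < cabs z) = (z != 0).
Proof. by rewrite lt_def cabs_ge0 andbT cabs_eq0. Qed.

Lemma cabsV (z : C) : cabs z^-1 = (cabs z)^-1.
Proof. by apply: (@complexI R); rewrite fmorphV /= -!cabsE normfV. Qed.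

Lemma cabs_real (x : R) : cabs x%:C = `|x|.
Proof. by rewrite /cabs /= expr0n addr0 sqrtr_sqr. Qed.

Lemma cabs_nat n : cabs (n%:R : C) = n%:R.
Proof. by rewrite -(rmorph_nat (real_complex R)) cabs_real normr_nat. Qed.

Lemma normRe_le (z : C) : `|Re z| <= cabs z.
Proof. by rewrite -sqrtr_sqr ler_wsqrtr// lerDl sqr_ge0. Qed.

Lemma normIm_le (z : C) : `|Im z| <= cabs z.
Proof. by rewrite -sqrtr_sqr ler_wsqrtr// lerDr sqr_ge0. Qed.

Lemma cabs_leD (z : C) : cabs z <= `|Re z| + `|Im z|.
Proof.
rewrite -(@ler_pXn2r _ 2) ?nnegrE ?addr_ge0 ?cabs_ge0//.
rewrite sqr_sqrtr ?addr_ge0 ?sqr_ge0// sqrrD !real_normK ?num_real//.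
by rewrite addrAC lerDl mulrn_wge0// mulr_ge0.
Qed.

Lemma cabs_sum I (r : seq I) (P : pred I) (F : I -> C) :
  cabs (\sum_(i <- r | P i) F i) <= \sum_(i <- r | P i) cabs (F i).
Proof.
elim/big_ind2: _ => [|x1 x2 y1 y2 h1 h2|//]; first by rewrite cabs0.
exact: le_trans (cabsD _ _) (lerD h1 h2).
Qed.

Lemma ReD (z w : C) : Re (z + w) = Re z + Re w. Proof. by case: z; case: w. Qed.
Lemma ImD (z w : C) : Im (z + w) = Im z + Im w. Proof. by case: z; case: w. Qed.
Lemma ReN (z : C) : Re (- z) = - Re z. Proof. by case: z. Qed.
Lemma ImN (z : C) : Im (- z) = - Im z. Proof. by case: z. Qed.
Lemma ReB (z w : C) : Re (z - w) = Re z - Re w. Proof. by rewrite ReD ReN. Qed.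
Lemma ImB (z w : C) : Im (z - w) = Im z - Im w. Proof. by rewrite ImD ImN. Qed.
Lemma ReM (z w : C) : Re (z * w) = Re z * Re w - Im z * Im w.
Proof. by case: z; case: w. Qed.
Lemma ImM (z w : C) : Im (z * w) = Re z * Im w + Im z * Re w.
Proof. by case: z; case: w => c d a b /=; rewrite [b * c]mulrC. Qed.
Lemma ReR (x : R) : Re x%:C = x. Proof. by []. Qed.
Lemma ImR (x : R) : Im x%:C = 0. Proof. by []. Qed.
Lemma Re_nat n : Re (n%:R) = n%:R.
Proof. by rewrite -(rmorph_nat (real_complex R)). Qed.
Lemma eqC (z w : C) : Re z = Re w -> Im z = Im w -> z = w.
Proof. by case: z; case: w => c d a b /= -> ->. Qed.

Lemma Re_sum I (r : seq I) (P : pred I) (F : I -> C) :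
  Re (\sum_(i <- r | P i) F i) = \sum_(i <- r | P i) Re (F i).
Proof. by elim/big_ind2: _ => // [x1 x2 y1 y2 <- <-]; rewrite ReD. Qed.
Lemma Im_sum I (r : seq I) (P : pred I) (F : I -> C) :
  Im (\sum_(i <- r | P i) F i) = \sum_(i <- r | P i) Im (F i).
Proof. by elim/big_ind2: _ => // [x1 x2 y1 y2 <- <-]; rewrite ImD. Qed.

Lemma cvgCP T (F : set_system T) {FF : Filter F} (f : T -> C) (l : C) :
  (f x @[x --> F] --> (l : C^o)) <->
  (forall e : R, 0 < e -> \forall x \near F, cabs (l - f x) < e).
Proof.
split=> [/(@cvgrPdist_lt _ C^o) h e e0|h].
  have := h e%:C; rewrite ltcR => /(_ e0); apply: filterS => x.
  by rewrite cabsE ltcR.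
apply/(@cvgrPdist_lt _ C^o) => -[e e']; rewrite ltcE /= => /andP[/eqP-> e0].
by have := h e e0; apply: filterS => x; rewrite cabsE ltcR.
Qed.

Lemma cvgC_ReIm T (F : set_system T) {FF : Filter F} (f : T -> C) (l : C) :
  (f x @[x --> F] --> (l : C^o)) <->
  (Re (f x) @[x --> F] --> Re l) /\ (Im (f x) @[x --> F] --> Im l).
Proof.
split=> [/cvgCP h|[/(@cvgrPdist_lt _ R^o) hr /(@cvgrPdist_lt _ R^o) hi]].
  split; apply/(@cvgrPdist_lt _ R^o) => e e0; have := h e e0; apply: filterS => x.
    by apply: le_lt_trans; rewrite -ReB; exact: normRe_le.
  by apply: le_lt_trans; rewrite -ImB; exact: normIm_le.
apply/cvgCP => e e0; have e2 : 0 < e / 2 by rewrite divr_gt0.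
have := hi _ e2; have := hr _ e2; apply: filterS2 => x h1 h2.
apply: le_lt_trans (cabs_leD _) _; rewrite ReB ImB [e]splitr.
exact: ltrD.
Qed.

Lemma nbhs0CP (P : C -> Prop) :
  (\forall h \near (0 : C^o), P h) <->
  (exists2 d : R, 0 < d & forall h : C, cabs h < d -> P h).
Proof.
split=> [/nbhs_ballP[d /= d0 h]|[d d0 h]].
  case: d d0 h => d d'; rewrite ltcE /= => /andP[/eqP-> d0] h; exists d => // k kd.
  by apply: h; rewrite -ball_normE /= sub0r normrN cabsE ltcR.
apply/nbhs_ballP; exists d%:C; first by rewrite /= ltcR.
by move=> k; rewrite -ball_normE /= sub0r normrN cabsE ltcR => /h.
Qed.

End ComplexNorm.

Section ComplexDerivative.
Variable R : realType.
Local Notation C := (R[i]).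
Local Notation Re := (@complex.Re R).
Local Notation Im := (@complex.Im R).

Definition is_cder (f : C -> C) (z l : C) : Prop :=
  @is_derive C C^o C^o z 1 f l.

(** The increment estimate in terms of the real modulus, from which the
    derivatives of power series and of the logarithm are computed. *)
Lemma is_cderP (f : C -> C) (z l : C) : is_cder f z l <->
  (forall e : R, 0 < e -> exists2 d : R, 0 < d &
     forall h, cabs h < d -> cabs (f (z + h) - f z - l * h) <= e * cabs h).
Proof.
pose q (h : C^o) : C^o := h^-1 * (f (z + h) - f z).
have qE : (fun h : C => h^-1 *: ((f \o shift z) (h *: (1 : C^o)) - f z)) = q.
  by apply/funext => h; rewrite /q /= [h *: 1]mulr1 addrC [in RHS]addrC [z + h]addrC.
have aux (h : C) : h != 0 -> cabs (l - q h) * cabs h = cabs (f (z + h) - f z - l * h).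
  by move=> h0; rewrite -cabsM mulrBl /q [h^-1 * _]mulrC mulfVK// cabsB.
split.
  move=> [df dfl] e e0.
  have : q x @[x --> (0 : C^o)^'] --> (l : C^o).
    by rewrite -dfl -qE; exact: df.
  move=> /cvgCP /(_ e e0).
  rewrite /= near_withinE => /nbhs0CP[d d0 h].
  exists d => // k kd; have [->|k0] := eqVneq k 0.
    by rewrite addr0 subrr mulr0 subr0 cabs0 mulr0.
  by rewrite -aux// ler_wpM2r ?cabs_ge0// ltW// h.
move=> h.
have cv : q x @[x --> (0 : C^o)^'] --> (l : C^o).
  apply/cvgCP => e e0; have e2 : 0 < e / 2 by rewrite divr_gt0.
  rewrite near_withinE; apply/nbhs0CP; have [d d0 hd] := h _ e2; exists d => // k kd k0.
  have := hd k kd; rewrite -aux// ler_pM2r ?cabs_gt0// => /le_lt_trans; apply.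
  by rewrite ltr_pdivrMr// ltr_pMr// ltr1n.
split.
  by apply/cvg_ex; exists l; rewrite qE.
by apply: cvg_lim => //; rewrite qE.
Qed.

Lemma is_cder_derivable f z l : is_cder f z l ->
  derivable (f : C^o -> C^o) z 1 /\ cderive f z = l.
Proof. by case. Qed.

Lemma is_cder_eq f z l l' : is_cder f z l -> l = l' -> is_cder f z l'.
Proof. by move=> ? <-. Qed.

Lemma derivable_cder f z : derivable (f : C^o -> C^o) z 1 ->
  is_cder f z (cderive f z).
Proof. by move=> h; split. Qed.

Lemma is_cder_ext f g z l (d : R) : 0 < d ->
  (forall w, cabs (w - z) < d -> f w = g w) -> is_cder f z l -> is_cder g z l.
Proof.
move=> d0 fg /is_cderP h; apply/is_cderP => e /h[d' d'0 hd].
exists (Num.min d d'); first by rewrite lt_min d0.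
move=> k; rewrite lt_min => /andP[kd kd'].
by rewrite -!fg ?subrr ?cabs0// ?hd// addrC addKr.
Qed.

Lemma is_cder_cst (a z : C) : is_cder (fun=> a) z 0.
Proof. exact: is_derive_cst. Qed.

Lemma is_cder_id (z : C) : is_cder (fun w => w) z 1.
Proof. exact: is_derive_id. Qed.

Lemma is_cderD f g z a b : is_cder f z a -> is_cder g z b ->
  is_cder (fun w => f w + g w) z (a + b).
Proof. exact: is_deriveD. Qed.

Lemma is_cderN f z a : is_cder f z a -> is_cder (fun w => - f w) z (- a).
Proof. exact: is_deriveN. Qed.

Lemma is_cderB f g z a b : is_cder f z a -> is_cder g z b ->
  is_cder (fun w => f w - g w) z (a - b).
Proof. exact: is_deriveB. Qed.

Lemma is_cderM f g z a b : is_cder f z a -> is_cder g z b ->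
  is_cder (fun w => f w * g w) z (a * g z + f z * b).
Proof.
move=> fa gb; apply: is_cder_eq (is_deriveM fa gb) _.
by rewrite addrC [a * _]mulrC.
Qed.

Lemma is_cderZ c f z a : is_cder f z a -> is_cder (fun w => c * f w) z (c * a).
Proof. exact: is_deriveZ. Qed.

Lemma is_cder_sum I (r : seq I) (P : pred I) (f : I -> C -> C) z (a : I -> C) :
  (forall i, P i -> is_cder (f i) z (a i)) ->
  is_cder (fun w => \sum_(i <- r | P i) f i w) z (\sum_(i <- r | P i) a i).
Proof.
move=> h; elim: r => [|i r ih].
  under eq_fun do rewrite big_nil; rewrite big_nil; exact: is_cder_cst.
under eq_fun do rewrite big_cons; rewrite big_cons.
by case: ifP => // /h hi; exact: is_cderD.
Qed.

Lemma is_cder_comp f g z a b : is_cder f z a -> is_cder g (f z) b ->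
  is_cder (fun w => g (f w)) z (b * a).
Proof.
move=> /is_cderP hf /is_cderP hg; apply/is_cderP => e e0.
have A0 := cabs_ge0 a; have B0 := cabs_ge0 b.
pose e1 := Num.min 1 (e / (2 * (cabs b + 1))).
have e10 : 0 < e1 by rewrite lt_min ltr01 divr_gt0// mulr_gt0// ltr_wpDl.
pose e2 := e / (2 * (cabs a + 1)).
have e20 : 0 < e2 by rewrite divr_gt0// mulr_gt0// ltr_wpDl.
have [d1 d10 h1] := hf _ e10; have [d2 d20 h2] := hg _ e20.
exists (Num.min d1 (d2 / (cabs a + 1))).
  by rewrite lt_min d10 divr_gt0// ltr_wpDl.
move=> h; rewrite lt_min => /andP[hd1]; rewrite ltr_pdivlMr ?ltr_wpDl// => hd2.
have H0 := cabs_ge0 h.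
set k := f (z + h) - f z.
have hk : cabs k <= (cabs a + 1) * cabs h.
  have -> : k = (f (z + h) - f z - a * h) + a * h by rewrite subrK.
  apply: le_trans (cabsD _ _) _; rewrite cabsM addrC mulrDl lerD2l.
  apply: le_trans (h1 _ hd1) _; rewrite ler_wpM2r// /e1.
  by rewrite ge_min lexx.
have fk : f (z + h) = f z + k by rewrite /k [RHS]addrC subrK.
have -> : g (f (z + h)) - g (f z) - b * a * h =
    (g (f z + k) - g (f z) - b * k) + b * (k - a * h).
  by rewrite fk; ring.
apply: le_trans (cabsD _ _) _; rewrite cabsM.
have kd2 : cabs k < d2 by apply: le_lt_trans hk _; rewrite mulrC.
have le1 : cabs (g (f z + k) - g (f z) - b * k) <= e / 2 * cabs h.
  apply: le_trans (h2 _ kd2) _; apply: le_trans (ler_wpM2l (ltW e20) hk) _.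
  rewrite mulrA ler_wpM2r// /e2 invfM -mulrA -mulrA mulVf ?mulr1//.
  by rewrite gt_eqF// ltr_wpDl.
have le2 : cabs b * cabs (k - a * h) <= e / 2 * cabs h.
  apply: le_trans (ler_wpM2l B0 (h1 _ hd1)) _; rewrite mulrA ler_wpM2r//.
  apply: (@le_trans _ _ ((cabs b + 1) * (e / (2 * (cabs b + 1))))).
    by apply: ler_pM => //; [exact: ltW|rewrite lerDl|rewrite /e1 ge_min lexx orbT].
  rewrite invfM mulrCA [_ * (_^-1 * _)]mulrCA mulfV ?mulr1//.
  by rewrite gt_eqF// ltr_wpDl.
by apply: le_trans (lerD le1 le2) _; rewrite -mulrDl -splitr.
Qed.

End ComplexDerivative.

(** * Power series *)

Section PowerSeries.
Variable R : realType.
Local Notation C := (R[i]).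
Local Notation Re := (@complex.Re R).
Local Notation Im := (@complex.Im R).

Definition csum (u : nat -> C) (l : C) : Prop :=
  series (u : nat -> C^o) n @[n --> \oo] --> (l : C^o).

(** For nonnegative terms this is convergence; it is the form in which absolute
    convergence is used below. *)
Definition bounded_sums (v : nat -> R) : Prop :=
  exists S : R, forall n, \sum_(0 <= k < n) v k <= S.

Lemma csum_unique u l l' : csum u l -> csum u l' -> l = l'.
Proof. by move=> h h'; apply: (cvg_unique _ h h'). Qed.

Lemma csum_lim u l : csum u l -> limn (series (u : nat -> C^o)) = l.
Proof. by move=> h; apply: (cvg_lim _ h). Qed.

Lemma csumP u l : csum u l <-> forall e : R, 0 < e ->
  \forall n \near \oo, cabs (l - \sum_(0 <= k < n) u k) < e.
Proof. exact: cvgCP. Qed.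

Lemma csum_ext u v l : (forall n, u n = v n) -> csum u l -> csum v l.
Proof. by move=> /funext ->. Qed.

Lemma csumD u v a b : csum u a -> csum v b -> csum (fun n => u n + v n) (a + b).
Proof.
move=> ha hb; rewrite /csum (_ : series _ = series (u : nat -> C^o) \+ series (v : nat -> C^o)).
  exact: cvgD.
by apply/funext => n; rewrite /series /= big_split.
Qed.

Lemma csumZ c u a : csum u a -> csum (fun n => c * u n) (c * a).
Proof.
move=> ha; rewrite /csum (_ : series _ = fun n => (c : C^o) *: series (u : nat -> C^o) n).
  exact: cvgZr.
by apply/funext => n; rewrite /series /=; apply: esym; exact: mulr_sumr.
Qed.

Lemma csumB u v a b : csum u a -> csum v b -> csum (fun n => u n - v n) (a - b).
Proof.
move=> ha hb; have := csumD ha (csumZ (c := -1) hb); rewrite mulN1r.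
by apply: csum_ext => n; rewrite mulN1r.
Qed.

Lemma csum_ReIm u l : csum u l <->
  (series (fun n => Re (u n)) n @[n --> \oo] --> Re l) /\
  (series (fun n => Im (u n)) n @[n --> \oo] --> Im l).
Proof.
rewrite /csum cvgC_ReIm.
suff [-> ->] : (fun n => Re (series (u : nat -> C^o) n)) = series (fun n => Re (u n)) /\
  (fun n => Im (series (u : nat -> C^o) n)) = series (fun n => Im (u n)) by [].
by split; apply/funext => n; rewrite /series /= ?Re_sum ?Im_sum.
Qed.

Lemma csum_shift u l : csum u l -> csum (fun n => u n.+1) (l - u 0%N).
Proof.
move=> /csumP h; apply/csumP => e /h [N _ hN]; exists N => // n /= Nn.
have /hN : (N <= n.+1)%N by exact: leqW.
by rewrite /= big_nat_recl// opprD addrA.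
Qed.

Lemma csum_unshift u l : csum (fun n => u n.+1) l -> csum u (u 0%N + l).
Proof.
move=> /csumP h; apply/csumP => e /h [N _ hN]; exists N.+1 => // -[|n] //= Nn.
have /hN : (N <= n)%N by [].
by rewrite /= big_nat_recl// opprD addrACA subrr add0r.
Qed.

Lemma bounded_sums_cvg (v : nat -> R) : (forall n, 0 <= v n) -> bounded_sums v -> cvgn (series v).
Proof.
move=> v0 [S hS]; apply: nondecreasing_is_cvgn; last by exists S => _ [n _ <-]; exact: hS.
move=> m n mn; rewrite /series /= (big_cat_nat _ mn)//= lerDl.
exact: sumr_ge0.
Qed.

Lemma cvg_bounded_sums (v : nat -> R) : (forall n, 0 <= v n) -> cvgn (series v) -> bounded_sums v.
Proof.
move=> v0 h; exists (limn (series v)) => n.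
apply: (@nondecreasing_cvgn_le _ (series v)) => // i j ij.
rewrite /series /= (big_cat_nat _ ij)//= lerDl.
exact: sumr_ge0.
Qed.

Lemma bounded_sums_le (u v : nat -> R) : (forall n, u n <= v n) -> bounded_sums v -> bounded_sums u.
Proof.
move=> uv [S hS]; exists S => n; apply: le_trans (hS n); exact: ler_sum.
Qed.

Lemma bounded_sumsZ (c : R) (v : nat -> R) : 0 <= c -> bounded_sums v -> bounded_sums (fun n => c * v n).
Proof.
by move=> c0 [S hS]; exists (c * S) => n; rewrite -mulr_sumr ler_wpM2l.
Qed.

Lemma bounded_sums_geometric (x : R) : 0 <= x < 1 -> bounded_sums (fun n => x ^+ n).
Proof.
move=> /andP[x0 x1]; exists (1 - x)^-1 => n.
have x10 : 0 < 1 - x by rewrite subr_gt0.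
have e : (1 - x) * \sum_(0 <= k < n) x ^+ k = 1 - x ^+ n.
  by rewrite big_mkord -[1 - x]opprB mulNr -subrX1 opprB.
rewrite -(ler_pM2l x10) e mulfV ?gt_eqF// gerBl.
exact: exprn_ge0.
Qed.

Lemma abs_csum u : bounded_sums (fun n => cabs (u n)) -> exists l, csum u l.
Proof.
move=> hS.
have hr : cvgn (series (fun n => Re (u n))).
  apply: (@normed_cvg R R); apply: bounded_sums_cvg => [n|]; first exact: normr_ge0.
  by apply: bounded_sums_le hS => n; exact: normRe_le.
have hi : cvgn (series (fun n => Im (u n))).
  apply: (@normed_cvg R R); apply: bounded_sums_cvg => [n|]; first exact: normr_ge0.
  by apply: bounded_sums_le hS => n; exact: normIm_le.
move: hr hi => /cvg_ex[a ha] /cvg_ex[b hb].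
by exists (a +i* b); apply/csum_ReIm.
Qed.

Lemma csum_cabs_le u l (S : R) : csum u l ->
  (forall n, \sum_(0 <= k < n) cabs (u k) <= S) -> cabs l <= S.
Proof.
move=> /csumP h hS; apply/ler_addgt0Pr => e /h[N _ /(_ N (leqnn N))] /= hN.
rewrite -(subrK (\sum_(0 <= k < N) u k) l).
apply: le_trans (cabsD _ _) _; rewrite addrC lerD//; last exact: ltW.
by apply: le_trans (cabs_sum _ _ _) _.
Qed.

Lemma csum_bounded u l : csum u l -> exists2 B : R, 0 <= B & forall n, cabs (u n) <= B.
Proof.
move=> /csumP /(_ 1 ltr01)[N _ hN].
exists (\sum_(0 <= k < N) cabs (u k) + 2).
  by rewrite addr_ge0// sumr_ge0// => i _; exact: cabs_ge0.
move=> n; have [nN|Nn] := ltnP n N.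
  rewrite big_mkord (bigD1 (Ordinal nN))//= -addrA lerDl addr_ge0//.
  by apply: sumr_ge0 => i _; exact: cabs_ge0.
apply: (@le_trans _ _ 2); last by rewrite lerDr sumr_ge0// => i _; exact: cabs_ge0.
have h1 := hN n Nn; have h2 := hN n.+1 (leqW Nn).
have -> : u n = (l - \sum_(0 <= k < n) u k) - (l - \sum_(0 <= k < n.+1) u k).
  by rewrite big_nat_recr//=; ring.
apply: le_trans (cabsD _ _) _; rewrite cabsN.
by apply: ltW; apply: ltrD.
Qed.

Definition has_ps (a : nat -> C) (r : R) (f : C -> C) : Prop :=
  forall z, cabs z < r -> csum (fun n => a n * z ^+ n) (f z).

(** The terms of a convergent series are bounded, so that at a smaller radius
    they are dominated by a geometric series. *)
Lemma ps_abs (a : nat -> C) r f (s : R) : has_ps a r f -> 0 <= s < r ->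
  bounded_sums (fun n => cabs (a n) * s ^+ n).
Proof.
move=> h /andP[s0 sr]; have r0 : 0 < r by exact: le_lt_trans sr.
pose p := (s + r) / 2.
have ps : s < p by rewrite midf_lt.
have pr : p < r by rewrite midf_lt.
have p0 : 0 < p by exact: le_lt_trans ps.
have /h/csum_bounded[B B0 hB] : cabs (p%:C : C) < r by rewrite cabs_real gtr0_norm.
have hs : bounded_sums (fun n => B * (s / p) ^+ n).
  apply: bounded_sumsZ => //; apply: bounded_sums_geometric.
  by rewrite divr_ge0 ?(ltW p0)//= ltr_pdivrMr// mul1r.
apply: bounded_sums_le hs => n.
have := hB n; rewrite cabsM cabsX cabs_real (gtr0_norm p0) => hn.
rewrite expr_div_n mulrA mulrAC ler_wpM2r ?exprn_ge0//.
by rewrite ler_pdivlMr ?exprn_gt0.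
Qed.

(** The terms of order at least two of the binomial expansion carry a factor
    (|h| / d)^2 once the other factors |h| are replaced by d, and what is left is
    part of the expansion of (|z| + d)^n. *)
Lemma pow_remainder (z h : C) (d : R) n : 0 < d -> cabs h <= d ->
  cabs ((z + h) ^+ n - z ^+ n - n%:R * z ^+ n.-1 * h) <=
  (cabs h / d) ^+ 2 * (cabs z + d) ^+ n.
Proof.
move=> d0 hd; have H0 := cabs_ge0 h; have Z0 := cabs_ge0 z.
have q0 : 0 <= cabs h / d by rewrite divr_ge0// ltW.
case: n => [|n].
  by rewrite !expr0 !mul0r subrr subr0 cabs0 mulr1 exprn_ge0.
have -> : (z + h) ^+ n.+1 - z ^+ n.+1 - n.+1%:R * z ^+ n.+1.-1 * h =
   \sum_(i < n) (z ^+ (n - i.+1) * h ^+ i.+2) *+ 'C(n.+1, i.+2).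
  rewrite exprDn big_ord_recl big_ord_recl /= expr0 mulr1 bin0 mulr1n expr1 bin1 subn0.
  rewrite /bump /= !add1n subSS subn0 (mulr_natl (_ ^+ _)) mulrnAl.
  rewrite (addrC (z ^+ n.+1)) addrK (addrC (_ *+ _)) addrK.
  by apply: eq_bigr => i _; rewrite /bump /= !add1n subSS.
apply: le_trans (cabs_sum _ _ _) _.
apply: (@le_trans _ _ (\sum_(i < n) (cabs h / d) ^+ 2 *
    ((cabs z ^+ (n - i.+1) * d ^+ i.+2) *+ 'C(n.+1, i.+2)))).
  apply: ler_sum => i _.
  have key : cabs h ^+ i.+2 <= (cabs h / d) ^+ 2 * d ^+ i.+2.
    rewrite expr_div_n -mulrA -[i.+2]addn2 !exprD mulrC.
    rewrite [d ^+ i * _]mulrC mulKf ?expf_neq0 ?gt_eqF// ler_wpM2l ?exprn_ge0//.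
    by rewrite lerXn2r ?nnegrE// ltW.
  rewrite -[X in cabs X]mulr_natr -[X in _ <= _ * X]mulr_natr cabsM cabs_nat cabsM !cabsX.
  rewrite [leRHS]mulrA ler_wpM2r// [leRHS]mulrCA ler_wpM2l ?exprn_ge0//.
rewrite -mulr_sumr ler_wpM2l ?exprn_ge0// exprDn big_ord_recl big_ord_recl /=.
rewrite -[leLHS]add0r lerD//; first by rewrite mulrn_wge0// mulr_ge0// exprn_ge0// ltW.
rewrite -[leLHS]add0r lerD//; first by rewrite mulrn_wge0// mulr_ge0// exprn_ge0// ltW.
Qed.
End PowerSeries.

Section PowerSeriesDerivative.
Variable R : realType.
Local Notation C := (R[i]).
Local Notation Re := (@complex.Re R).
Local Notation Im := (@complex.Im R).

(** Termwise differentiation: the errors of the linear approximations of the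
    monomials, bounded by [pow_remainder], add up to at most (|h| / d)^2 times the
    sum of a convergent series. *)
Lemma ps_derivative (a : nat -> C) r f : has_ps a r f ->
  forall z, cabs z < r -> exists l, is_cder f z l /\
    csum (fun n => a n * (n%:R * z ^+ n.-1)) l.
Proof.
move=> h z zr.
have Z0 := cabs_ge0 z.
pose d := (r - cabs z) / 2.
have d0 : 0 < d by rewrite divr_gt0// subr_gt0.
have dr : cabs z + d < r by rewrite /d; lra.
clearbody d.
have zd0 : 0 <= cabs z + d by rewrite addr_ge0// ltW.
have hS : bounded_sums (fun n => cabs (a n) * (cabs z + d) ^+ n).
  by apply: (ps_abs h); rewrite zd0.
have [l hl] : exists l, csum (fun n => a n * (n%:R * z ^+ n.-1)) l.
  apply: abs_csum; have [S hS'] := hS.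
  exists (S / d) => n; rewrite ler_pdivlMr// mulr_suml.
  apply: le_trans (hS' n); apply: ler_sum => i _.
  rewrite !cabsM cabs_nat cabsX -mulrA ler_wpM2l ?cabs_ge0//.
  case: i => [|i]; first by rewrite !mul0r exprn_ge0.
  rewrite exprDn big_ord_recl big_ord_recl /= bin1 expr1 subSS !subn0.
  rewrite addrCA -mulrA mulr_natl -[leLHS]addr0 lerD2l addr_ge0//; first by rewrite mulrn_wge0// mulr_ge0// exprn_ge0// ltW.
  by apply: sumr_ge0 => j _; rewrite mulrn_wge0// mulr_ge0// exprn_ge0// ltW.
exists l; split => //.
have [S hS'] := hS.
have S0 : 0 <= S by apply: le_trans (hS' 0%N); rewrite big_nil.
apply/is_cderP => e e0.
exists (Num.min d (e * d ^+ 2 / (S + 1))).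
  by rewrite lt_min d0 divr_gt0//; [rewrite mulr_gt0// exprn_gt0|rewrite ltr_wpDl].
move=> k; rewrite lt_min ltr_pdivlMr ?ltr_wpDl// => /andP[kd kS].
have K0 := cabs_ge0 k.
have zkr : cabs (z + k) < r.
  by apply: le_lt_trans (cabsD _ _) _; apply: lt_trans dr; rewrite ltrD2l.
have := csumB (csumB (h _ zkr) (h _ zr)) (csumZ (c := k) hl).
rewrite [k * l]mulrC => /csum_cabs_le -> //.
move=> n; apply: (@le_trans _ _ (\sum_(0 <= i < n) (cabs k / d) ^+ 2 *
    (cabs (a i) * (cabs z + d) ^+ i))).
  apply: ler_sum => i _.
  rewrite (_ : _ - _ = a i * ((z + k) ^+ i - z ^+ i - i%:R * z ^+ i.-1 * k)); last first.
    by ring.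
  by rewrite cabsM mulrCA ler_wpM2l ?cabs_ge0// pow_remainder// ltW.
rewrite -mulr_sumr.
apply: (@le_trans _ _ ((cabs k / d) ^+ 2 * (S + 1))).
  rewrite ler_wpM2l ?sqr_ge0//; apply: le_trans (hS' n) _; by rewrite lerDl.
rewrite expr_div_n mulrAC ler_pdivrMr ?exprn_gt0//.
rewrite expr2 -mulrA mulrC [leRHS]mulrAC ler_wpM2r//.
exact: ltW.
Qed.

Lemma ps_cder (a : nat -> C) r f g : has_ps a r f ->
  (forall z, cabs z < r -> csum (fun n => n.+1%:R * a n.+1 * z ^+ n) (g z)) ->
  forall z, cabs z < r -> is_cder f z (g z).
Proof.
move=> h hg z zr; have [l [hl /csum_shift]] := ps_derivative h zr.
rewrite !mul0r mulr0 subr0 => h1; apply: is_cder_eq hl _.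
apply: (csum_unique h1); apply: csum_ext (hg z zr) => n.
by rewrite mulrCA mulrA.
Qed.

(** The first coefficient is the value at 0, and the other ones are, up to
    nonzero factors, the coefficients of the derivative. *)
Lemma ps_zero (a : nat -> C) r : 0 < r -> has_ps a r (fun=> 0) -> forall n, a n = 0.
Proof.
move=> r0 h n; elim: n a h => [|n ih] a h.
  have h0 := h 0; rewrite cabs0 in h0; have := csum_shift (h0 r0).
  rewrite expr0 mulr1 sub0r => /csumP h1.
  apply/eqP; rewrite -cabs_eq0 eq_le cabs_ge0 andbT.
  apply/ler_addgt0Pr => e /h1[N _ /(_ N (leqnn N))] /=.
  rewrite big1 ?subr0 ?cabsN ?add0r; first by move/ltW.
  by move=> i _; rewrite exprS mul0r mulr0.
have /eqP : n.+1%:R * a n.+1 = 0; last first.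
  by rewrite mulf_eq0 pnatr_eq0 /= => /eqP.
apply: (ih (fun n => n.+1%:R * a n.+1)) => z zr.
have [l [hl /csum_shift]] := ps_derivative h zr.
rewrite !mul0r mulr0 subr0.
have -> : l = 0.
  have [_ e1] := is_cder_derivable hl.
  by have [_ e2] := is_cder_derivable (is_cder_cst 0 z); rewrite -e1 e2.
by apply: csum_ext => k; rewrite mulrCA mulrA.
Qed.

Lemma ps_unique (a b : nat -> C) r f : 0 < r -> has_ps a r f -> has_ps b r f -> a = b.
Proof.
move=> r0 ha hb; apply/funext => n; apply/eqP; rewrite -subr_eq0; apply/eqP.
apply: (ps_zero (a := fun n => a n - b n) r0) => z zr.
by have := csumB (ha z zr) (hb z zr); rewrite subrr; apply: csum_ext => k; rewrite mulrBl.
Qed.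

Lemma csum_term0 (c : C) : csum (fun n => c * 0 ^+ n) c.
Proof.
apply/csumP => e e0; exists 1%N => // -[|n] //= _.
rewrite big_nat_recl// expr0 mulr1 big1 ?addr0 ?subrr ?cabs0//.
by move=> i _; rewrite exprS mul0r mulr0.
Qed.

Lemma ps_cst (c : C) (r : R) : has_ps (fun n => if n == 0%N then c else 0) r (fun=> c).
Proof.
move=> z _; apply/csumP => e e0; exists 1%N => // -[|n] //= _.
rewrite big_nat_recl// expr0 mulr1 big1 ?addr0 ?subrr ?cabs0//.
by move=> i _; rewrite mul0r.
Qed.

Lemma psD (a b : nat -> C) (r : R) f g : has_ps a r f -> has_ps b r g ->
  has_ps (fun n => a n + b n) r (fun z => f z + g z).
Proof.
move=> hf hg z zr; apply: csum_ext (csumD (hf z zr) (hg z zr)) => n.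
by rewrite mulrDl.
Qed.

Lemma psZ (c : C) (a : nat -> C) (r : R) f : has_ps a r f -> has_ps (fun n => c * a n) r (fun z => c * f z).
Proof.
by move=> hf z zr; apply: csum_ext (csumZ (c := c) (hf z zr)) => n; rewrite mulrA.
Qed.

Lemma ps_mulX (a : nat -> C) (r : R) f : has_ps a r f ->
  has_ps (fun n => if n is k.+1 then a k else 0) r (fun z => z * f z).
Proof.
move=> hf z zr; rewrite -[z * f z]add0r -[X in X + _](mul0r (z ^+ 0)).
apply: (csum_unshift (u := fun n => (if n is k.+1 then a k else 0) * z ^+ n)).
by apply: csum_ext (csumZ (c := z) (hf z zr)) => n; rewrite exprS mulrCA.
Qed.

End PowerSeriesDerivative.

(** * Paths in the complex plane *)

Section RealPaths.
Variable R : realType.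
Local Notation C := (R[i]).
Local Notation Re := (@complex.Re R).
Local Notation Im := (@complex.Im R).

Lemma is_deriveRP (f : R -> R) (t l : R) : is_derive t 1 f l <->
  (forall e : R, 0 < e -> exists2 d : R, 0 < d &
     forall h, `|h| < d -> `|f (t + h) - f t - l * h| <= e * `|h|).
Proof.
pose q (h : R) : R := h^-1 * (f (t + h) - f t).
have qE : (fun h : R => h^-1 *: ((f \o shift t) (h *: (1 : R^o)) - f t)) = q.
  by apply/funext => h; rewrite /q /= [h *: 1]mulr1 addrC [in RHS]addrC [t + h]addrC.
have aux (h : R) : h != 0 -> `|l - q h| * `|h| = `|f (t + h) - f t - l * h|.
  by move=> h0; rewrite -normrM mulrBl /q [h^-1 * _]mulrC mulfVK// distrC.
have nb (P : R -> Prop) : (\forall h \near (0 : R), P h) <->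
  (exists2 d : R, 0 < d & forall h : R, `|h| < d -> P h).
  split=> [/nbhs_ballP[d /= d0 h]|[d d0 h]].
    by exists d => // k kd; apply: h; rewrite -ball_normE /= sub0r normrN.
  apply/nbhs_ballP; exists d => // k.
  by rewrite -ball_normE /= sub0r normrN => /h.
split.
  move=> [df dfl] e e0.
  have : q x @[x --> (0 : R)^'] --> l.
    by rewrite -dfl -qE; exact: df.
  move=> /(@cvgrPdist_lt _ R^o) /(_ e e0).
  rewrite /= near_withinE => /nb[d d0 h].
  exists d => // k kd; have [->|k0] := eqVneq k 0.
    by rewrite addr0 subrr mulr0 subr0 normr0 mulr0.
  by rewrite -aux// ler_wpM2r// ltW// h.
move=> h.
have cv : q x @[x --> (0 : R)^'] --> l.
  apply/(@cvgrPdist_lt _ R^o) => e e0; have e2 : 0 < e / 2 by rewrite divr_gt0.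
  rewrite near_withinE; apply/nb; have [d d0 hd] := h _ e2; exists d => // k kd k0.
  have := hd k kd; rewrite -aux// ler_pM2r ?normr_gt0// => /le_lt_trans; apply.
  by rewrite ltr_pdivrMr// ltr_pMr// ltr1n.
split.
  by apply/cvg_ex; exists l; rewrite qE.
by apply: cvg_lim => //; rewrite qE.
Qed.

Definition is_rder (f : R -> C) (t : R) (l : C) : Prop :=
  is_derive t 1 (fun x => Re (f x)) (Re l) /\
  is_derive t 1 (fun x => Im (f x)) (Im l).

Lemma is_rderP (f : R -> C) (t : R) (l : C) : is_rder f t l <->
  (forall e : R, 0 < e -> exists2 d : R, 0 < d &
     forall h, `|h| < d -> cabs (f (t + h) - f t - l * h%:C) <= e * `|h|).
Proof.
have aux h : (Re (f (t + h) - f t - l * h%:C) = Re (f (t + h)) - Re (f t) - Re l * h) *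
   (Im (f (t + h) - f t - l * h%:C) = Im (f (t + h)) - Im (f t) - Im l * h).
  by split; rewrite ?(ReB, ImB, ReM, ImM) /=; ring.
split.
  move=> [/is_deriveRP hr /is_deriveRP hi] e e0.
  have e2 : 0 < e / 2 by rewrite divr_gt0.
  have [d1 d10 h1] := hr _ e2; have [d2 d20 h2] := hi _ e2.
  exists (Num.min d1 d2); first by rewrite lt_min d10.
  move=> h; rewrite lt_min => /andP[/h1 k1 /h2 k2].
  apply: le_trans (cabs_leD _) _; rewrite !aux [e]splitr mulrDl.
  exact: lerD.
move=> h; split; apply/is_deriveRP => e /h[d d0 hd]; exists d => // k /hd.
  by apply: le_trans; rewrite -aux normRe_le.
by apply: le_trans; rewrite -aux normIm_le.
Qed.

Lemma is_rder_eq f t l l' : is_rder f t l -> l = l' -> is_rder f t l'.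
Proof. by move=> ? <-. Qed.

Lemma is_rder_cst (a : C) t : is_rder (fun=> a) t 0.
Proof. by split; exact: is_derive_cst. Qed.

Lemma is_rder_real (f : R -> R) (t l : R) : is_derive t 1 f l ->
  is_rder (fun x => (f x)%:C) t l%:C.
Proof. by move=> h; split => //=; exact: is_derive_cst. Qed.

Lemma is_rder_id t : is_rder (fun x => x%:C) t 1.
Proof. by split => //=; [exact: is_derive_id|exact: is_derive_cst]. Qed.

Lemma is_rderD f g t a b : is_rder f t a -> is_rder g t b ->
  is_rder (fun x => f x + g x) t (a + b).
Proof.
move=> [f1 f2] [g1 g2]; split.
  by under eq_fun do rewrite ReD; rewrite ReD; exact: is_deriveD.
by under eq_fun do rewrite ImD; rewrite ImD; exact: is_deriveD.
Qed.

Lemma is_rderM f g t a b : is_rder f t a -> is_rder g t b ->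
  is_rder (fun x => f x * g x) t (a * g t + f t * b).
Proof.
move=> [f1 f2] [g1 g2]; split.
  under eq_fun do rewrite ReM.
  have := is_deriveB (is_deriveM f1 g1) (is_deriveM f2 g2).
  move=> h; apply: is_derive_eq h _.
  by rewrite ReD !ReM /= /GRing.scale /=; ring.
under eq_fun do rewrite ImM.
have := is_deriveD (is_deriveM f1 g2) (is_deriveM f2 g1).
move=> h; apply: is_derive_eq h _.
by rewrite ImD !ImM /= /GRing.scale /=; ring.
Qed.

Lemma is_rderZ c f t a : is_rder f t a -> is_rder (fun x => c * f x) t (c * a).
Proof.
move=> h; apply: is_rder_eq (is_rderM (is_rder_cst c t) h) _.
by rewrite mul0r add0r.
Qed.

Lemma is_rder_comp (f : C -> C) (g : R -> C) t a b : is_rder g t b ->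
  is_cder f (g t) a -> is_rder (fun x => f (g x)) t (a * b).
Proof.
move=> /is_rderP hg /is_cderP hf; apply/is_rderP => e e0.
have A0 := cabs_ge0 a; have B0 := cabs_ge0 b.
pose e1 := Num.min 1 (e / (2 * (cabs a + 1))).
have e10 : 0 < e1 by rewrite lt_min ltr01 divr_gt0// mulr_gt0// ltr_wpDl.
pose e2 := e / (2 * (cabs b + 1)).
have e20 : 0 < e2 by rewrite divr_gt0// mulr_gt0// ltr_wpDl.
have [d1 d10 h1] := hg _ e10; have [d2 d20 h2] := hf _ e20.
exists (Num.min d1 (d2 / (cabs b + 1))).
  by rewrite lt_min d10 divr_gt0// ltr_wpDl.
move=> h; rewrite lt_min => /andP[hd1]; rewrite ltr_pdivlMr ?ltr_wpDl// => hd2.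
set k := g (t + h) - g t.
have hk : cabs k <= (cabs b + 1) * `|h|.
  have -> : k = (g (t + h) - g t - b * h%:C) + b * h%:C by rewrite subrK.
  apply: le_trans (cabsD _ _) _; rewrite cabsM cabs_real addrC mulrDl lerD2l.
  apply: le_trans (h1 _ hd1) _; rewrite ler_wpM2r// /e1.
  by rewrite ge_min lexx.
have gk : g (t + h) = g t + k by rewrite /k [RHS]addrC subrK.
have -> : f (g (t + h)) - f (g t) - a * b * h%:C =
    (f (g t + k) - f (g t) - a * k) + a * (k - b * h%:C).
  by rewrite gk; ring.
apply: le_trans (cabsD _ _) _; rewrite cabsM.
have kd2 : cabs k < d2 by apply: le_lt_trans hk _; rewrite mulrC.
have le1 : cabs (f (g t + k) - f (g t) - a * k) <= e / 2 * `|h|.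
  apply: le_trans (h2 _ kd2) _; apply: le_trans (ler_wpM2l (ltW e20) hk) _.
  rewrite mulrA ler_wpM2r// /e2 invfM -mulrA -mulrA mulVf ?mulr1//.
  by rewrite gt_eqF// ltr_wpDl.
have le2 : cabs a * cabs (k - b * h%:C) <= e / 2 * `|h|.
  apply: le_trans (ler_wpM2l A0 (h1 _ hd1)) _; rewrite mulrA ler_wpM2r//.
  apply: (@le_trans _ _ ((cabs a + 1) * (e / (2 * (cabs a + 1))))).
    by apply: ler_pM => //; [exact: ltW|rewrite lerDl|rewrite /e1 ge_min lexx orbT].
  rewrite invfM mulrCA [_ * (_^-1 * _)]mulrCA mulfV ?mulr1//.
  by rewrite gt_eqF// ltr_wpDl.
by apply: le_trans (lerD le1 le2) _; rewrite -mulrDl -splitr.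
Qed.

(** Applied to the restriction of a function to a segment, this turns uniqueness
    of solutions of complex differential equations into the real mean value
    theorem. *)
Lemma rder0_cst (f : R -> C) (a b : R) : a <= b ->
  (forall t, a <= t <= b -> is_rder f t 0) -> f a = f b.
Proof.
move=> ab h.
have aux (g : R -> R) : (forall t : R, a <= t <= b -> is_derive t 1 g 0) -> g a = g b.
  move=> hg; apply/esym/eqP; rewrite -subr_eq0.
  have [||c _ ->] := @MVT_segment _ g (fun=> 0) a b ab; last by rewrite mul0r.
  - by move=> x; rewrite in_itv /= => /andP[/ltW ax /ltW xb]; apply: hg; rewrite ax.
  - apply: derivable_within_continuous => x; rewrite in_itv /= => axb.
    by have [] := hg x axb.
apply: eqC; [apply: (aux (fun t => Re (f t)))|apply: (aux (fun t => Im (f t)))];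
  by move=> t /h[].
Qed.

Lemma rder_cont f t l : is_rder f t l ->
  {for t, continuous (fun x => Re (f x))} /\ {for t, continuous (fun x => Im (f x))}.
Proof.
move=> [[h1 _] [h2 _]].
by split; apply: differentiable_continuous; apply/derivable1_diffP.
Qed.
End RealPaths.

(** * Exponential, logarithm and powers *)

Section ComplexExponential.
Variable R : realType.
Local Notation C := (R[i]).
Local Notation Re := (@complex.Re R).
Local Notation Im := (@complex.Im R).

Lemma Re_cexp (z : C) : Re (cexp z) = expR (Re z) * cos (Im z).
Proof. by rewrite /cexp ReM /= mul0r subr0. Qed.

Lemma Im_cexp (z : C) : Im (cexp z) = expR (Re z) * sin (Im z).
Proof. by rewrite /cexp ImM /= mul0r addr0. Qed.

(* The exponential is used through its functional equation and its modulus, and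
   simplification must not unfold it. *)
Opaque cexp.

Lemma cexpD (z w : C) : cexp (z + w) = cexp z * cexp w.
Proof.
apply: eqC; rewrite ?[RHS]ReM ?[RHS]ImM ?Re_cexp ?Im_cexp ReD ImD expRD ?cosD ?sinD; ring.
Qed.

Lemma cexp0 : cexp (0 : C) = 1.
Proof. by apply: eqC; rewrite ?Re_cexp ?Im_cexp /= expR0 ?cos0 ?sin0 mul1r. Qed.

Lemma cexpNK (z : C) : cexp z * cexp (- z) = 1.
Proof. by rewrite -cexpD subrr cexp0. Qed.

Lemma cexp_neq0 (z : C) : cexp z != 0.
Proof.
by apply/eqP => h; have := cexpNK z; rewrite h mul0r => /esym/eqP; rewrite oner_eq0.
Qed.

Lemma cexpN (z : C) : cexp (- z) = (cexp z)^-1.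
Proof. by apply: (mulfI (cexp_neq0 z)); rewrite cexpNK mulfV ?cexp_neq0. Qed.

Lemma cexp_natM n (z : C) : cexp (n%:R * z) = cexp z ^+ n.
Proof.
elim: n => [|n ih]; first by rewrite mul0r cexp0.
by rewrite -[n.+1]addn1 natrD mulrDl mul1r cexpD ih addn1 exprSr.
Qed.

Lemma cabs_cexp (z : C) : cabs (cexp z) = expR (Re z).
Proof.
rewrite /cabs Re_cexp Im_cexp !exprMn -mulrDr cos2Dsin2 mulr1 sqrtr_sqr.
by rewrite ger0_norm// expR_ge0.
Qed.

Lemma cexp_real (x : R) : cexp x%:C = (expR x)%:C.
Proof. by apply: eqC; rewrite ?Re_cexp ?Im_cexp /= ?cos0 ?sin0 ?mulr1 ?mulr0. Qed.

Lemma is_rder_cexpZ (z : C) (t : R) :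
  is_rder (fun x => cexp (x%:C * z)) t (z * cexp (t%:C * z)).
Proof.
have e1 x : Re (x%:C * z) = x * Re z by rewrite ReM /= mul0r subr0.
have e2 x : Im (x%:C * z) = x * Im z by rewrite ImM /= mul0r addr0.
have h1 : is_derive t (1 : R) (fun x : R => x * Re z) (Re z).
  by apply: is_derive_eq; rewrite /GRing.scale /= mulr0 add0r mulr1.
have h2 : is_derive t (1 : R) (fun x : R => x * Im z) (Im z).
  by apply: is_derive_eq; rewrite /GRing.scale /= mulr0 add0r mulr1.
have hexp : is_derive t (1 : R) (fun x : R => expR (x * Re z)) (expR (t * Re z) * Re z).
  exact: (@is_derive1_comp _ expR (fun x : R => x * Re z)).
have hcos : is_derive t (1 : R) (fun x : R => cos (x * Im z)) (- sin (t * Im z) * Im z).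
  exact: (@is_derive1_comp _ cos (fun x : R => x * Im z)).
have hsin : is_derive t (1 : R) (fun x : R => sin (x * Im z)) (cos (t * Im z) * Im z).
  exact: (@is_derive1_comp _ sin (fun x : R => x * Im z)).
split.
  under eq_fun do rewrite Re_cexp e1 e2.
  apply: is_derive_eq (is_deriveM hexp hcos) _.
  by rewrite ReM Re_cexp Im_cexp e1 e2 /GRing.scale /=; ring.
under eq_fun do rewrite Im_cexp e1 e2.
apply: is_derive_eq (is_deriveM hexp hsin) _.
by rewrite ImM Re_cexp Im_cexp e1 e2 /GRing.scale /=; ring.
Qed.

Lemma bounded_sums_exp (x : R) : 0 <= x -> bounded_sums (fun n => x ^+ n / n`!%:R).
Proof.
move=> x0; apply: cvg_bounded_sums; last exact: is_cvg_series_exp_coeff.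
by move=> n; rewrite divr_ge0// exprn_ge0.
Qed.

Lemma exp_series_cder (F : C -> C) (z : C) :
  (forall w : C, csum (fun n => (n`!%:R)^-1 * w ^+ n) (F w)) -> is_cder F z (F z).
Proof.
move=> hF; apply: (@ps_cder _ (fun n => (n`!%:R)^-1) (cabs z + 1)) => // [x _|]; last first.
  by rewrite ltrDl.
apply: csum_ext (hF x) => n; congr (_ * _).
by rewrite factS natrM invfM mulrA mulfV ?mul1r// pnatr_eq0.
Qed.

(** Let F be the sum of the exponential series. Then F(tz) exp(-tz) has
    derivative zero in the real variable t, and its values at 0 and 1 are compared. *)
Lemma cexp_csum (z : C) : csum (fun n => z ^+ n / n`!%:R) (cexp z).
Proof.
have ex (w : C) : exists l : C, csum (fun n => (n`!%:R)^-1 * w ^+ n) l.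
  apply: abs_csum; have := bounded_sums_exp (cabs_ge0 w).
  by apply: bounded_sums_le => n; rewrite cabsM cabsV cabs_nat cabsX mulrC.
pose F (w : C) : C := projT1 (cid (ex w)).
have hF (w : C) : csum (fun n => (n`!%:R)^-1 * w ^+ n) (F w) by exact: (projT2 (cid (ex w))).
have dF (w : C) : is_cder F w (F w) by exact: exp_series_cder.
have F0 : F 0 = 1.
  apply: (csum_unique (hF 0)).
  apply: (@csum_ext _ (fun n => 1 * 0 ^+ n)); last exact: csum_term0.
  by move=> [|n]; [rewrite fact0 invr1|rewrite exprS !mul0r !mulr0].
suff -> : cexp z = F z by apply: csum_ext (hF z) => n; rewrite mulrC.
pose g (x : R) := F (x%:C * z) * cexp (x%:C * - z).
have : g 0 = g 1.
  apply: rder0_cst => // t _.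
  have d1 : is_rder (fun x => F (x%:C * z)) t (F (t%:C * z) * z).
    apply: (is_rder_comp (g := fun x => x%:C * z)) => //.
    apply: is_rder_eq (is_rderM (is_rder_id t) (is_rder_cst z t)) _.
    by rewrite mul1r mulr0 addr0.
  apply: is_rder_eq (is_rderM d1 (is_rder_cexpZ (- z) t)) _.
  by ring.
rewrite /g !mul0r F0 cexp0 mulr1 !mul1r cexpN => /(congr1 (fun x => x * cexp z)).
by rewrite mul1r mulfVK// cexp_neq0.
Qed.

Lemma is_cder_cexp (z : C) : is_cder (@cexp R) z (cexp z).
Proof.
have hF (w : C) : csum (fun n => (n`!%:R)^-1 * w ^+ n) (cexp w).
  by apply: csum_ext (@cexp_csum w) => n; rewrite mulrC.
exact: exp_series_cder.
Qed.

Lemma cos_carg (z : C) : 0 < Re z -> cos (atan (Im z / Re z)) = Re z / cabs z.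
Proof.
move=> z0; rewrite cos_atan; have z1 := gt_eqF z0.
have -> : cabs z = Re z * Num.sqrt (1 + (Im z / Re z) ^+ 2).
  rewrite -[X in X * _]ger0_norm ?(ltW z0)// -sqrtr_sqr -sqrtrM ?sqr_ge0//.
  rewrite mulrDr mulr1 -exprMn [Re z * (_ / _)]mulrC mulfVK ?z1//.
by rewrite invfM mulrA mulfV ?mul1r ?z1.
Qed.

Lemma cabs_gt0_Re (z : C) : 0 < Re z -> 0 < cabs z.
Proof.
move=> z0; apply: lt_le_trans (normRe_le z); rewrite normr_gt0.
by rewrite gt_eqF.
Qed.

Lemma sin_carg (z : C) : 0 < Re z -> sin (atan (Im z / Re z)) = Im z / cabs z.
Proof.
move=> z0; have c0 : cos (atan (Im z / Re z)) != 0.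
  by rewrite cos_carg// mulf_neq0 ?invr_eq0 ?gt_eqF// cabs_gt0_Re.
have := atanK (Im z / Re z); rewrite /tan => /(congr1 (fun x => x * cos (atan (Im z / Re z)))).
rewrite mulfVK// => ->; rewrite cos_carg// mulrA mulfVK//.
by rewrite gt_eqF.
Qed.

(** On the right half-plane the argument is given by the arctangent, whose
    continuity yields that of the logarithm. *)
Lemma carg_atan (z : C) : 0 < Re z -> carg z = atan (Im z / Re z).
Proof.
move=> z0; rewrite /carg -cos_carg//.
have h1 := atan_ltpi2 (Im z / Re z); have h2 := atan_gtNpi2 (Im z / Re z).
have p0 := pi_gt0 R.
have [y0|y0] := leP 0 (Im z).
  rewrite cosK// in_itv /=; apply/andP; split; last by lra.
  by rewrite -(@atan0 R); apply: le_atan; rewrite divr_ge0// ltW.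
rewrite cosKN ?opprK//; apply/andP; split; first by lra.
rewrite -[leRHS](@atan0 R); apply: le_atan.
by rewrite pmulr_lle0 ?invr_gt0// ltW.
Qed.

Lemma cexp_clog (z : C) : 0 < Re z -> cexp (clog z) = z.
Proof.
move=> z0; have c0 := cabs_gt0_Re z0.
apply: eqC; rewrite ?Re_cexp ?Im_cexp /clog /= carg_atan// lnK//.
  by rewrite cos_carg// mulrC mulfVK// gt_eqF.
by rewrite sin_carg// mulrC mulfVK// gt_eqF.
Qed.

Lemma cabs_lip (z w : C) : `|cabs z - cabs w| <= cabs (z - w).
Proof.
by have := ler_dist_dist z w; rewrite !cabsE -rmorphB /= cabs_real lecR.
Qed.

Lemma cvg0CP (f : C -> C) (l : C) : (f h @[h --> (0 : C^o)] --> (l : C^o)) <->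
  (forall e : R, 0 < e -> exists2 d : R, 0 < d &
    forall h, cabs h < d -> cabs (l - f h) < e).
Proof.
have P := @cvgCP R C^o (nbhs (0 : C^o)) (nbhs_filter (0 : C^o)) f l.
by split=> [/P h e /h/nbhs0CP //|h]; apply/P => e /h/nbhs0CP.
Qed.

Lemma clog_cont (z : C) : 0 < Re z ->
  forall e : R, 0 < e -> exists2 d : R, 0 < d &
    forall h, cabs h < d -> cabs (clog (z + h) - clog z) < e.
Proof.
move=> z0 e e0.
have id0 : (z + h) @[h --> (0 : C^o)] --> (z : C^o).
  apply/cvg0CP => e' e'0; exists e' => // h.
  by rewrite opprD addrA subrr add0r cabsN.
have P := @cvgC_ReIm R C^o (nbhs (0 : C^o)) (nbhs_filter (0 : C^o)).
have [hr hi] := (P _ _).1 id0.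
have Rpos : \forall h \near (0 : C^o), 0 < Re (z + h).
  by apply: (cvgr_gt _ hr).
have habs : cabs (z + h) @[h --> (0 : C^o)] --> cabs z.
  apply/(@cvgrPdist_lt _ R^o _ (nbhs (0 : C^o)) (nbhs_filter _)) => e' e'0.
  apply/nbhs0CP; exists e' => // h he.
  apply: le_lt_trans (cabs_lip _ _) _.
  by rewrite opprD addrA subrr add0r cabsN.
have hln : ln (cabs (z + h)) @[h --> (0 : C^o)] --> ln (cabs z).
  exact: (cvg_comp _ _ habs (continuous_ln (cabs_gt0_Re z0))).
have hat : atan (Im (z + h) / Re (z + h)) @[h --> (0 : C^o)] --> atan (Im z / Re z).
  have FF := nbhs_filter (0 : C^o); have z1 : Re z != 0 by rewrite gt_eqF.
  have hq : (Im (z + h) / Re (z + h)) @[h --> (0 : C^o)] --> Im z / Re z.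
    exact: (@cvgM _ _ (nbhs (0 : C^o)) FF _ _ _ _ hi (cvgV z1 hr)).
  have ha : atan x @[x --> Im z / Re z] --> atan (Im z / Re z) by exact: continuous_atan.
  exact: (cvg_comp _ _ hq ha).
have hcl : clog (z + h) @[h --> (0 : C^o)] --> (clog z : C^o).
  apply/P; split => //=; rewrite carg_atan//.
  apply: cvg_trans hat; apply: near_eq_cvg.
  by apply: filterS Rpos => h h0; rewrite carg_atan.
move/cvg0CP: hcl => /(_ e e0)[d d0 hd]; exists d => // h /hd.
by rewrite cabsB.
Qed.

(** The logarithm is a continuous inverse of the exponential: its increment k
    satisfies h = z k + o(k), and in particular k = O(h). *)
Lemma is_cder_clog (z : C) : 0 < Re z -> is_cder (@clog R) z z^-1.
Proof.
move=> z0; have c0 := cabs_gt0_Re z0; apply/is_cderP => e e0.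
have z1 : z != 0 by rewrite -cabs_gt0.
pose e1 := Num.min (cabs z / 2) (e * cabs z ^+ 2 / 2).
have e10 : 0 < e1 by rewrite lt_min !divr_gt0// mulr_gt0// exprn_gt0.
have := is_cder_cexp (clog z); rewrite cexp_clog// => /is_cderP/(_ e1 e10)[d1 d10 h1].
have [d2 d20 h2] := clog_cont z0 d10.
exists (Num.min d2 (Re z)); first by rewrite lt_min d20.
move=> h; rewrite lt_min => /andP[hd2 hz].
have zh : 0 < Re (z + h).
  by rewrite ReD; have := normRe_le h; rewrite ler_norml => /andP[]; lra.
have := h1 _ (h2 _ hd2); set k := clog (z + h) - clog z.
have -> : clog z + k = clog (z + h) by rewrite /k addrC subrK.
rewrite !cexp_clog// [z + h]addrC addrK => h3.
have K0 := cabs_ge0 k; have H0 := cabs_ge0 h.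
have hk : cabs z * cabs k <= cabs h + e1 * cabs k.
  rewrite -cabsM (_ : z * k = h - (h - z * k)); last by ring.
  by apply: le_trans (cabsD _ _) _; rewrite cabsN lerD2l.
have e1a : e1 <= cabs z / 2 by rewrite /e1 ge_min lexx.
have e1b : e1 <= e * cabs z ^+ 2 / 2 by rewrite /e1 ge_min lexx orbT.
have hk2 : cabs z * cabs k <= 2 * cabs h.
  have : e1 * cabs k <= cabs z / 2 * cabs k by rewrite ler_wpM2r.
  by move: hk; set X := e1 * _; set Y := cabs z * _; rewrite mulrAC -/Y; lra.
rewrite -(ler_pM2l c0) -cabsM (_ : z * (k - z^-1 * h) = - (h - z * k)); last first.
  by rewrite mulrBr mulrA mulfV// mul1r opprB.
rewrite cabsN; apply: le_trans h3 _.
apply: (@le_trans _ _ (e * cabs z ^+ 2 / 2 * cabs k)); first by rewrite ler_wpM2r.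
have : e / 2 * cabs z * (cabs z * cabs k) <= e / 2 * cabs z * (2 * cabs h).
  by rewrite ler_wpM2l// mulr_ge0// ?ltW// divr_gt0.
congr (_ <= _); first by ring.
by field.
Qed.

Lemma is_cder_cpow (z : C) (a : R) : 0 < Re z ->
  is_cder (fun w => cpow w a) z (a%:C * z^-1 * cpow z a).
Proof.
move=> z0; rewrite [X in is_cder _ _ X]mulrC.
have h := is_cderZ a%:C (is_cder_clog z0).
exact: (is_cder_comp (f := fun w => a%:C * clog w) h (is_cder_cexp _)).
Qed.

Lemma cpow_neq0 (z : C) a : cpow z a != 0.
Proof. exact: cexp_neq0. Qed.

Lemma cpow0 (z : C) : cpow z 0 = 1.
Proof. by rewrite /cpow mul0r cexp0. Qed.

End ComplexExponential.

(** * Integrals over the half-line from 1 to infinity *)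

Section HalfLine.
Variable R : realType.
Local Notation C := (R[i]).
Local Notation Re := (@complex.Re R).
Local Notation Im := (@complex.Im R).
Local Notation mu := (@lebesgue_measure R).

Definition halfline : set R := `[1, +oo[%classic.

Lemma halflineE (u : R) : halfline u <-> 1 <= u.
Proof. by rewrite /halfline /= in_itv /= andbT. Qed.

Lemma measurable_halfline : measurable (halfline : set (measurableTypeR R)).
Proof. exact: measurable_itv. Qed.

Lemma cvg_powRN (q : R) : 0 < q -> u `^ (- q) @[u --> +oo] --> (0 : R).
Proof.
move=> q0; apply/(@cvgrPdist_le _ R^o) => e e0.
have M0 : 0 < e `^ (- q^-1) by exact: powR_gt0.
near=> u.
have uM : e `^ (- q^-1) <= u by near: u; apply: nbhs_pinfty_ge; exact: num_real.
have u0 : 0 < u by exact: lt_le_trans uM.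
rewrite sub0r normrN ger0_norm ?powR_ge0// powRN.
rewrite -[leRHS]invrK lef_pV2 ?posrE ?powR_gt0 ?invr_gt0//.
have := @ge0_ler_powR R q (ltW q0) _ _ _ _ uM; rewrite !nnegrE.
move=> /(_ (ltW M0) (ltW u0)); apply: le_trans.
by rewrite -powRrM mulNr mulVf ?gt_eqF// powRN powRr1// ltW.
Unshelve. all: by end_near. Qed.

Lemma integrable_powRN (c p : R) : 1 < p ->
  mu.-integrable halfline (EFin \o (fun u : R => c * u `^ (- p))).
Proof.
move=> p1; have p0 : 0 < p - 1 by rewrite subr_gt0.
have pos (u : R) : 1 <= u -> 0 < u by exact: lt_le_trans.
have cont : {within halfline, continuous (fun u : R => u `^ (- p))}.
  apply: continuous_in_subspaceT => u; rewrite inE => /halflineE /pos u0.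
  apply: differentiable_continuous; apply/derivable1_diffP.
  by have [] := is_derive1_powR (- p) u0.
have mf : measurable_fun halfline (fun u : R => u `^ (- p)).
  apply: measurable_realfun.subspace_continuous_measurable_fun => //.
  exact: measurable_halfline.
rewrite (_ : EFin \o _ = (fun u => c%:E * (u `^ (- p))%:E)%E); last by [].
apply: integrableZl => //; first exact: measurable_halfline.
apply/integrableP; split; first exact/measurable_realfun.measurable_EFinP.
pose F (u : R) := - (p - 1)^-1 * u `^ (- (p - 1)).
have dF (u : R) : 0 < u -> is_derive u 1 F (u `^ (- p)).
  move=> u0; have := is_deriveZ (- (p - 1)^-1) (is_derive1_powR (- (p - 1)) u0).
  move=> h; apply: is_derive_eq h _.
  rewrite /GRing.scale /= (_ : - (p - 1) - 1 = - p); last by ring.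
  by rewrite mulrA mulNr -mulrN opprK mulVf ?mul1r// gt_eqF.
under eq_integral => x _ do rewrite /= ger0_norm ?powR_ge0//.
rewrite (@ge0_continuous_FTC2y _ (fun u : R => u `^ (- p)) F 1 0) ?ltry//.
- by move=> x _; exact: powR_ge0.
- rewrite -[X in _ --> X](mulr0 (- (p - 1)^-1)).
  apply: cvgM; first exact: cvg_cst.
  exact: cvg_powRN.
- by move=> x x1; have [] := dF x (lt_trans ltr01 x1).
- apply: cvg_at_right_filter; apply: differentiable_continuous; apply/derivable1_diffP.
  by have [] := dF 1 ltr01.
- move=> x; rewrite in_itv /= andbT => x1; rewrite derive1E.
  by have [_ ->] := dF x (lt_trans ltr01 x1).
Qed.

(** The integrands below are all dominated by multiples of u^(-p) with p > 1. *)
Lemma Rint_dominated (g_ : nat -> R -> R) (g : R -> R) (c p : R) : 1 < p ->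
  (forall n, measurable_fun halfline (g_ n)) ->
  (forall u, 1 <= u -> g_ n u @[n --> \oo] --> g u) ->
  (forall n u, 1 <= u -> `|g_ n u| <= c * u `^ (- p)) ->
  mu.-integrable halfline (EFin \o g) /\
  \int[mu]_(u in halfline) g_ n u @[n --> \oo] --> \int[mu]_(u in halfline) g u.
Proof.
move=> p1 mg_ cg dg.
have mg : measurable_fun halfline g.
  apply: (measurable_realfun.measurable_fun_cvg mg_) => u /halflineE; exact: cg.
have h1 : {ae mu, forall u, halfline u ->
    (EFin \o g_ n) u @[n --> \oo] --> (EFin \o g) u}.
  by apply: aeW => u /halflineE u1; apply: cvg_EFin; [exact: nearW|exact: cg].
have h2 : {ae mu, forall u (n : nat), halfline u ->
    (`|(EFin \o g_ n) u| <= (EFin \o (fun u : R => (c * u `^ (- p))%R)) u)%E}.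
  by apply: aeW => u n /halflineE u1; rewrite /= lee_fin; exact: dg.
have [ig _ h] := dominated_convergence measurable_halfline
  (fun n => (measurable_realfun.measurable_EFinP _ _).2 (mg_ n))
  ((measurable_realfun.measurable_EFinP _ _).2 mg) h1 (integrable_powRN c p1) h2.
split => //.
have fin := integrable_fin_num measurable_halfline ig.
by apply: fine_cvg; rewrite fineK.
Qed.

Lemma cont_measurable_halfline (g : R -> R) :
  (forall u, 1 <= u -> {for u, continuous g}) -> measurable_fun halfline g.
Proof.
move=> cg; apply: measurable_realfun.subspace_continuous_measurable_fun.
  exact: measurable_halfline.
by apply: continuous_in_subspaceT => u; rewrite inE => /halflineE /cg.
Qed.

Lemma integrable_dominated (g : R -> R) (c p : R) : 1 < p ->
  measurable_fun halfline g ->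
  (forall u, 1 <= u -> `|g u| <= c * u `^ (- p)) ->
  mu.-integrable halfline (EFin \o g).
Proof.
move=> p1 mg dg; have [|||ig _] // := @Rint_dominated (fun=> g) g c p p1.
by move=> u u1; exact: cvg_cst.
Qed.

Lemma Rint_segment (g G : R -> R) (a b : R) : a < b ->
  (forall u : R, a <= u -> is_derive u 1 G (g u)) ->
  (forall u, a <= u -> {for u, continuous g}) ->
  \int[mu]_(u in `[a, b]) g u = G b - G a.
Proof.
move=> ab dG cg; have Gc (u : R) : a <= u -> {for u, continuous G}.
  by move=> /dG[dGu _]; apply: differentiable_continuous; apply/derivable1_diffP.
rewrite /Rintegral (@continuous_FTC2 _ g G a b ab)//=.
- apply: continuous_in_subspaceT => u; rewrite inE /= in_itv /= => /andP[u1 _].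
  exact: cg.
- split.
  + by move=> u; rewrite in_itv /= => /andP[/ltW /dG[]].
  + by apply: cvg_at_right_filter; exact: Gc.
  + by apply: cvg_at_left_filter; apply: Gc; exact: ltW.
- by move=> u; rewrite in_itv /= => /andP[/ltW /dG[_ e] _]; rewrite derive1E.
Qed.

Lemma Rint_truncate (g : R -> R) (b : R) :
  \int[mu]_(u in halfline) (if u <= b then g u else 0) = \int[mu]_(u in `[1, b]) g u.
Proof.
rewrite (_ : `[1, b]%classic = halfline `&` [set u | u <= b]); last first.
  by apply/seteqP; split=> u; rewrite /halfline /= !in_itv /= ?andbT;
    [move=> /andP[]|move=> [-> ->]].
rewrite Rintegral_mkcondr; apply: eq_Rintegral => u _.
rewrite patchE; case: ifPn => [|]; first by move=> ub; rewrite mem_set.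
by move=> /negP ub; rewrite memNset.
Qed.

(** The truncations of g to bounded segments converge to g under a common bound,
    so that the integral is the limit of the integrals over the segments. *)
Lemma Rint_FTC2y (g G : R -> R) (c p l : R) : 1 < p ->
  (forall u : R, 1 <= u -> is_derive u 1 G (g u)) ->
  (forall u, 1 <= u -> {for u, continuous g}) ->
  (forall u, 1 <= u -> `|g u| <= c * u `^ (- p)) ->
  G u @[u --> +oo] --> l ->
  \int[mu]_(u in halfline) g u = l - G 1.
Proof.
move=> p1 dG cg dg Gl.
have mg := cont_measurable_halfline cg.
pose g_ (n : nat) (u : R) := if u <= n%:R then g u else 0.
have [||| _ h] := @Rint_dominated g_ g c p p1.
- move=> n; apply: measurable_fun_if => //; [exact: measurable_halfline| |].
    exact: measurable_realfun.measurable_fun_ler.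
  by apply: measurable_funS mg => //; exact: measurable_halfline.
- move=> u u1; apply: (@cvg_near_cst _ R^o); near=> n; rewrite /g_ ifT//.
  near: n; exact: nbhs_infty_ger.
- move=> n u u1; rewrite /g_; case: ifP => _; first exact: dg.
  rewrite normr0; exact: le_trans (normr_ge0 _) (dg _ u1).
apply: (cvg_unique _ h) => //.
have hG : G n%:R - G 1 @[n --> \oo] --> l - G 1.
  apply: cvgB; last exact: cvg_cst.
  by apply: (cvg_comp _ _ _ Gl); exact: cvgr_idn.
apply: cvg_trans hG; apply: near_eq_cvg; near=> n.
rewrite /g_ Rint_truncate (Rint_segment _ dG cg)//.
by near: n; exists 2%N => // n /= n2; rewrite ltr1n.
Unshelve. all: by end_near. Qed.

End HalfLine.

Section ComplexIntegral.
Variable R : realType.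
Local Notation C := (R[i]).
Local Notation Re := (@complex.Re R).
Local Notation Im := (@complex.Im R).
Local Notation mu := (@lebesgue_measure R).

Definition CI (f : R -> C) : C :=
  (\int[mu]_(u in @halfline R) Re (f u)) +i* (\int[mu]_(u in @halfline R) Im (f u)).

Definition ccont (f : R -> C) : Prop := forall u : R, 1 <= u ->
  (Re (f x) @[x --> u] --> Re (f u)) /\ (Im (f x) @[x --> u] --> Im (f u)).

Definition decays (f : R -> C) : Prop := exists c p : R, 1 < p /\
  forall u : R, 1 <= u -> cabs (f u) <= c * u `^ (- p).

Definition nice (f : R -> C) : Prop := ccont f /\ decays f.

Lemma eq_CI (f g : R -> C) : (forall u, 1 <= u -> f u = g u) -> CI f = CI g.
Proof.
move=> fg; rewrite /CI; congr (_ +i* _); apply: eq_Rintegral => u;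
  by rewrite inE => /halflineE/fg ->.
Qed.

Definition cintegrable (f : R -> C) : Prop :=
  mu.-integrable (@halfline R) (EFin \o (fun u => Re (f u))) /\
  mu.-integrable (@halfline R) (EFin \o (fun u => Im (f u))).

Lemma nice_integrable f : nice f -> cintegrable f.
Proof.
move=> [cf [c [p [p1 df]]]]; split; apply: (integrable_dominated p1).
- by apply: cont_measurable_halfline => u /cf[].
- by move=> u /df; apply: le_trans; exact: normRe_le.
- by apply: cont_measurable_halfline => u /cf[].
- by move=> u /df; apply: le_trans; exact: normIm_le.
Qed.

Lemma cintegrableD f g : cintegrable f -> cintegrable g -> cintegrable (fun u => f u + g u).
Proof.
move=> [f1 f2] [g1 g2]; have mh := @measurable_halfline R; split.
  under eq_fun do rewrite ReD.
  rewrite (_ : EFin \o _ = (EFin \o (fun u => Re (f u))) \+ (EFin \o (fun u => Re (g u))))%E//.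
  exact: integrableD.
under eq_fun do rewrite ImD.
rewrite (_ : EFin \o _ = (EFin \o (fun u => Im (f u))) \+ (EFin \o (fun u => Im (g u))))%E//.
exact: integrableD.
Qed.

Lemma integrable_halflineZ (x : R) (h : R -> R) :
  mu.-integrable (@halfline R) (EFin \o h) ->
  mu.-integrable (@halfline R) (EFin \o (fun u => x * h u)).
Proof.
move=> ih; rewrite (_ : EFin \o _ = (fun u => x%:E * (EFin \o h) u)%E)//.
by apply: integrableZl => //; exact: measurable_halfline.
Qed.

Lemma cintegrableZ (a : C) f : cintegrable f -> cintegrable (fun u => a * f u).
Proof.
move=> [f1 f2]; have mh := @measurable_halfline R; split.
  under eq_fun do rewrite ReM.
  rewrite (_ : EFin \o _ = (EFin \o (fun u => (Re a * Re (f u))%R)) \- (EFin \o (fun u => (Im a * Im (f u))%R)))%E//.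
  by apply: integrableB => //; exact: integrable_halflineZ.
under eq_fun do rewrite ImM.
rewrite (_ : EFin \o _ = (EFin \o (fun u => (Re a * Im (f u))%R)) \+ (EFin \o (fun u => (Im a * Re (f u))%R)))%E//.
by apply: integrableD => //; exact: integrable_halflineZ.
Qed.

Lemma ccontD f g : ccont f -> ccont g -> ccont (fun u => f u + g u).
Proof.
move=> cf cg u u1; have [f1 f2] := cf u u1; have [g1 g2] := cg u u1.
split.
  by rewrite ReD; under eq_fun do rewrite ReD; exact: cvgD.
by rewrite ImD; under eq_fun do rewrite ImD; exact: cvgD.
Qed.

Lemma ccont_cst (a : C) : ccont (fun=> a).
Proof. by move=> u u1; split; exact: cvg_cst. Qed.

Lemma ccontM f g : ccont f -> ccont g -> ccont (fun u => f u * g u).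
Proof.
move=> cf cg u u1; have [f1 f2] := cf u u1; have [g1 g2] := cg u u1.
split.
  by rewrite ReM; under eq_fun do rewrite ReM; apply: cvgB; exact: cvgM.
by rewrite ImM; under eq_fun do rewrite ImM; apply: cvgD; exact: cvgM.
Qed.

Lemma ccont_sum I (r : seq I) (P : pred I) (f : I -> R -> C) :
  (forall i, P i -> ccont (f i)) -> ccont (fun u => \sum_(i <- r | P i) f i u).
Proof.
move=> h; elim: r => [|i r ih].
  by under eq_fun do rewrite big_nil; exact: ccont_cst.
under eq_fun do rewrite big_cons.
by case Pi: (P i) => //; apply: ccontD => //; exact: h.
Qed.

Lemma ccont_rder f (f' : R -> C) : (forall u, 1 <= u -> is_rder f u (f' u)) -> ccont f.
Proof. by move=> h u /h /rder_cont. Qed.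

Lemma decaysD f g : decays f -> decays g -> decays (fun u => f u + g u).
Proof.
move=> [c [p [p1 hf]]] [d [q [q1 hg]]].
exists (`|c| + `|d|), (Num.min p q); split; first by rewrite lt_min p1.
move=> u u1; apply: le_trans (cabsD _ _) _; rewrite mulrDl lerD//.
  apply: le_trans (hf u u1) _; apply: le_trans (_ : `|c| * u `^ (- p) <= _).
    by rewrite ler_wpM2r ?powR_ge0// ler_norm.
  by rewrite ler_wpM2l// ler_powR// lerN2 ge_min lexx.
apply: le_trans (hg u u1) _; apply: le_trans (_ : `|d| * u `^ (- q) <= _).
  by rewrite ler_wpM2r ?powR_ge0// ler_norm.
by rewrite ler_wpM2l// ler_powR// lerN2 ge_min lexx orbT.
Qed.

Lemma decaysZ (a : C) f : decays f -> decays (fun u => a * f u).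
Proof.
move=> [c [p [p1 hf]]]; exists (cabs a * c), p; split => // u u1.
by rewrite cabsM -mulrA ler_wpM2l ?cabs_ge0// hf.
Qed.

Lemma decays0 : decays (fun=> 0).
Proof. by exists 0, 2; rewrite ltr1n; split => // u _; rewrite cabs0 mul0r. Qed.

Lemma niceD f g : nice f -> nice g -> nice (fun u => f u + g u).
Proof. by move=> [? ?] [? ?]; split; [exact: ccontD|exact: decaysD]. Qed.

Lemma niceZ (a : C) f : nice f -> nice (fun u => a * f u).
Proof.
by move=> [? ?]; split; [apply: ccontM => //; exact: ccont_cst|exact: decaysZ].
Qed.

Lemma nice0 : nice (fun=> 0).
Proof. by split; [exact: ccont_cst|exact: decays0]. Qed.

Lemma CI_D f g : cintegrable f -> cintegrable g ->
  CI (fun u => f u + g u) = CI f + CI g.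
Proof.
move=> [f1 f2] [g1 g2].
rewrite /CI; under eq_Rintegral do rewrite ReD.
under [X in _ +i* X]eq_Rintegral do rewrite ImD.
by rewrite !RintegralD//; exact: measurable_halfline.
Qed.

Lemma CI_Z (a : C) f : cintegrable f -> CI (fun u => a * f u) = a * CI f.
Proof.
move=> [f1 f2]; have mh := @measurable_halfline R.
rewrite /CI; under eq_Rintegral do rewrite ReM.
under [X in _ +i* X]eq_Rintegral do rewrite ImM.
rewrite RintegralB ?RintegralD ?RintegralZl//; try exact: integrable_halflineZ.
by case: a.
Qed.

Lemma cintegrable0 : cintegrable (fun=> 0).
Proof. exact: nice_integrable nice0. Qed.

Lemma CI_0 : CI (fun=> 0) = 0.
Proof.
transitivity (CI (fun u => 0 * 0)); first by apply: eq_CI => u _; rewrite mul0r.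
by rewrite (CI_Z 0 cintegrable0) mul0r.
Qed.

Lemma cintegrable_sum I (r : seq I) (P : pred I) (f : I -> R -> C) :
  (forall i, P i -> cintegrable (f i)) ->
  cintegrable (fun u => \sum_(i <- r | P i) f i u).
Proof.
move=> h; elim: r => [|i r ih].
  by under eq_fun do rewrite big_nil; exact: cintegrable0.
under eq_fun do rewrite big_cons.
by case Pi: (P i) => //; apply: cintegrableD => //; exact: h.
Qed.

Lemma CI_sum I (r : seq I) (P : pred I) (f : I -> R -> C) :
  (forall i, P i -> cintegrable (f i)) ->
  CI (fun u => \sum_(i <- r | P i) f i u) = \sum_(i <- r | P i) CI (f i).
Proof.
move=> h; elim: r => [|i r ih].
  by under eq_fun do rewrite big_nil; rewrite big_nil CI_0.
under eq_fun do rewrite big_cons; rewrite big_cons.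
case Pi: (P i) => //; rewrite CI_D ?ih//; first exact: h.
exact: cintegrable_sum.
Qed.

Lemma CI_dominated (f_ : nat -> R -> C) (f : R -> C) (c p : R) : 1 < p ->
  (forall n, measurable_fun (@halfline R) (fun u => Re (f_ n u)) /\
             measurable_fun (@halfline R) (fun u => Im (f_ n u))) ->
  (forall u, 1 <= u -> f_ n u @[n --> \oo] --> (f u : C^o)) ->
  (forall n u, 1 <= u -> cabs (f_ n u) <= c * u `^ (- p)) ->
  CI (f_ n) @[n --> \oo] --> (CI f : C^o).
Proof.
move=> p1 mf cf df; apply/cvgC_ReIm; split => /=.
  have [|||_ h] // := @Rint_dominated _ (fun n u => Re (f_ n u)) (fun u => Re (f u)) c p p1.
  - by move=> n; have [] := mf n.
  - by move=> u /cf /cvgC_ReIm[].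
  - by move=> n u u1; apply: le_trans (df n u u1); exact: normRe_le.
have [|||_ h] // := @Rint_dominated _ (fun n u => Im (f_ n u)) (fun u => Im (f u)) c p p1.
- by move=> n; have [] := mf n.
- by move=> u /cf /cvgC_ReIm[].
- by move=> n u u1; apply: le_trans (df n u u1); exact: normIm_le.
Qed.

Lemma CI_FTC (f F : R -> C) (l : C) : nice f ->
  (forall u, 1 <= u -> is_rder F u (f u)) ->
  F u @[u --> +oo] --> (l : C^o) -> CI f = l - F 1.
Proof.
move=> [cf [c [p [p1 df]]]] dF /cvgC_ReIm[h1 h2].
apply: eqC; rewrite /CI /= ?ReB ?ImB.
  apply: (@Rint_FTC2y _ _ (fun u => Re (F u)) c p) => //.
  - by move=> u /dF[].
  - by move=> u /cf[].
  - by move=> u u1; apply: le_trans (df u u1); exact: normRe_le.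
apply: (@Rint_FTC2y _ _ (fun u => Im (F u)) c p) => //.
- by move=> u /dF[].
- by move=> u /cf[].
- by move=> u u1; apply: le_trans (df u u1); exact: normIm_le.
Qed.

Definition upow (u : R) (w : C) : C := cexp (w * (ln u)%:C).

Lemma upowD u w z : upow u (w + z) = upow u w * upow u z.
Proof. by rewrite /upow mulrDl cexpD. Qed.

Lemma cabs_upow u w : 0 < u -> cabs (upow u w) = u `^ (Re w).
Proof.
by move=> u0; rewrite cabs_cexp ReM /= mulr0 subr0 /powR gt_eqF.
Qed.

Lemma upow1 w : upow 1 w = 1.
Proof. by rewrite /upow ln1 mulr0 cexp0. Qed.

Lemma upow_nat (u : R) n : 0 < u -> upow u n%:R = u%:C ^+ n.
Proof.
by move=> u0; rewrite /upow cexp_natM cexp_real lnK.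
Qed.

Lemma upowN1 (u : R) : 0 < u -> upow u (-1) = (u%:C)^-1.
Proof. by move=> u0; rewrite /upow mulN1r cexpN cexp_real lnK. Qed.

Lemma is_rder_upow (u : R) w : 0 < u ->
  is_rder (fun x => upow x w) u (w * upow u (w - 1)).
Proof.
move=> u0; have h := is_rder_real (is_derive1_ln u0).
have h2 := is_rderZ w h.
apply: is_rder_eq (is_rder_comp (g := fun x => w * (ln x)%:C) h2 (is_cder_cexp _)) _.
rewrite upowD upowN1// fmorphV /= /upow; ring.
Qed.

Lemma is_rder_wave (c : C) (u : R) :
  is_rder (fun x => cexp (c * x%:C)) u (c * cexp (c * u%:C)).
Proof.
rewrite (_ : (fun x => _) = (fun x => cexp (x%:C * c))); last first.
  by apply/funext => x; rewrite mulrC.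
by rewrite [c * u%:C]mulrC; exact: is_rder_cexpZ.
Qed.

Lemma cabs_wave (c : C) (u : R) : Re c = 0 -> cabs (cexp (c * u%:C)) = 1.
Proof. by move=> c0; rewrite cabs_cexp ReM c0 /= mul0r mulr0 subrr expR0. Qed.

Lemma nice_wave (c w : C) : Re c = 0 -> Re w < -1 ->
  nice (fun u => cexp (c * u%:C) * upow u w).
Proof.
move=> c0 w1; split.
  apply: (ccont_rder (f' := fun u => c * cexp (c * u%:C) * upow u w +
     cexp (c * u%:C) * (w * upow u (w - 1)))) => u u1.
  apply: is_rderM; first exact: is_rder_wave.
  by apply: is_rder_upow; exact: lt_le_trans u1.
exists 1, (- Re w); split; first by rewrite ltrNr.
move=> u u1; rewrite cabsM cabs_wave// cabs_upow ?opprK//.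
exact: lt_le_trans u1.
Qed.

Lemma upow_cvg0 (c w : C) : Re c = 0 -> Re w < 0 ->
  cexp (c * u%:C) * upow u w @[u --> +oo] --> (0 : C^o).
Proof.
move=> c0 w0; apply/cvgCP => e e0.
have := @cvg_powRN R (- Re w); rewrite oppr_gt0 => /(_ w0).
move/(@cvgrPdist_lt _ R^o)/(_ e e0); rewrite opprK => h.
near=> u; rewrite sub0r cabsN cabsM cabs_wave// mul1r.
have u0 : 0 < u by near: u; apply: nbhs_pinfty_gt; exact: num_real.
rewrite cabs_upow//.
have : `|0 - u `^ Re w| < e by near: u.
by rewrite sub0r normrN ger0_norm// powR_ge0.
Unshelve. all: by end_near. Qed.

Lemma cvgCZ T (F : set_system T) {FF : Filter F} (a : C) (f : T -> C) (l : C) :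
  f x @[x --> F] --> (l : C^o) -> a * f x @[x --> F] --> (a * l : C^o).
Proof.
move=> /cvgCP h; apply/cvgCP => e e0; have A0 : 0 < cabs a + 1 by rewrite ltr_wpDl ?cabs_ge0.
have := h (e / (cabs a + 1)); rewrite divr_gt0// => /(_ isT); apply: filterS => x hx.
rewrite -mulrBr cabsM; apply: le_lt_trans (_ : (cabs a + 1) * cabs (l - f x) < _).
  by rewrite ler_wpM2r ?cabs_ge0// lerDl.
by rewrite mulrC -ltr_pdivlMr.
Qed.

(** A primitive of u^w is u^(w + 1) / (w + 1), which tends to 0 at infinity. *)
Lemma CI_upow (w : C) : Re w < -1 -> CI (fun u => upow u w) = - (w + 1)^-1.
Proof.
move=> w1; have w10 : w + 1 != 0.
  apply/eqP => /(congr1 Re); rewrite ReD /= => h.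
  have {}h : Re w + 1 = 0 by exact: h.
  by lra.
transitivity (CI (fun u => cexp (0 * u%:C) * upow u w)).
  by apply: eq_CI => u _; rewrite mul0r cexp0 mul1r.
rewrite (@CI_FTC _ (fun u => (w + 1)^-1 * upow u (w + 1)) 0).
- by rewrite upow1 mulr1 sub0r.
- exact: nice_wave.
- move=> u u1; have u0 : 0 < u by exact: lt_le_trans u1.
  apply: is_rder_eq (is_rderZ (w + 1)^-1 (is_rder_upow (w + 1) u0)) _.
  by rewrite mulrA mulVf// addrK mul0r cexp0.
- rewrite -[X in _ --> X](mulr0 ((w + 1)^-1 : C^o)).
  apply: cvgCZ.
  have := @upow_cvg0 0 (w + 1) erefl; rewrite ReD /=.
  under eq_fun do rewrite mul0r cexp0 mul1r.
  by apply; rewrite -[ltRHS](addNr 1) ltrD2r.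
Qed.
End ComplexIntegral.

(** * Entire continuation of oscillating integrals *)

Section Oscillating.
Variable R : realType.
Local Notation C := (R[i]).
Local Notation Re := (@complex.Re R).
Local Notation Im := (@complex.Im R).

Lemma expR_partial (x : R) n : 0 <= x -> \sum_(0 <= k < n) x ^+ k / k`!%:R <= expR x.
Proof.
move=> x0; have pos k : 0 <= exp_coeff x k by exact: exp_coeff_ge0.
have := @nondecreasing_cvgn_le _ (series (exp_coeff x)) _ (is_cvg_series_exp_coeff x) n.
apply=> i j ij; rewrite /series /= (big_cat_nat _ ij)//= lerDl.
exact: sumr_ge0.
Qed.

Lemma expR_term (x : R) n : 0 <= x -> x ^+ n / n`!%:R <= expR x.
Proof.
move=> x0; apply: le_trans (expR_partial n.+1 x0); rewrite big_nat_recr//= lerDr.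
by apply: sumr_ge0 => i _; rewrite divr_ge0// exprn_ge0.
Qed.

Lemma ccont_ln n : ccont (fun u : R => (((ln u) ^+ n)%:C : C)).
Proof.
move=> u u1; have u0 : 0 < u by exact: lt_le_trans u1.
split; last exact: cvg_cst.
exact: (cvg_comp _ _ (continuous_ln u0) (@exprn_continuous _ n _)).
Qed.

Lemma ccont_wave (c : C) : ccont (fun u : R => cexp (c * u%:C)).
Proof.
by apply: (ccont_rder (f' := fun u => c * cexp (c * u%:C))) => u _; exact: is_rder_wave.
Qed.

Lemma ccont_upow (w : C) : ccont (fun u : R => upow u w).
Proof.
apply: (ccont_rder (f' := fun u => w * upow u (w - 1))) => u u1.
by apply: is_rder_upow; exact: lt_le_trans u1.
Qed.

Lemma ccont_meas (f : R -> C) : ccont f ->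
  measurable_fun (@halfline R) (fun u => Re (f u)) /\
  measurable_fun (@halfline R) (fun u => Im (f u)).
Proof.
by move=> cf; split; apply: cont_measurable_halfline => u /cf[].
Qed.

Variables (c : C) (c_im : Re c = 0) (c_neq0 : c != 0).

(** Since e^(cu) oscillates with modulus 1, integration by parts continues this
    integral, convergent for Re w < -1, to all complex w. *)
Definition osc (w : C) : C := CI (fun u => cexp (c * u%:C) * upow u w).

(** Integration by parts with the primitive e^(cu) / c of the oscillating factor;
    the boundary term at infinity vanishes. *)
Lemma osc_parts (w : C) : Re w < -1 -> osc w = - (cexp c / c) - w / c * osc (w - 1).
Proof.
move=> w1.
have w11 : Re (w - 1) < -1 by rewrite ReB /=; apply: lt_trans w1; rewrite gtrDl ltrN10.
have n1 := nice_wave c_im w1; have n2 := niceZ (w / c) (nice_wave c_im w11).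
apply/eqP; rewrite eq_sym subr_eq eq_sym; apply/eqP.
rewrite /osc -(CI_Z _ (nice_integrable (nice_wave c_im w11))) -CI_D; try exact: nice_integrable.
rewrite (@CI_FTC _ _ (fun u => c^-1 * (cexp (c * u%:C) * upow u w)) 0).
- by rewrite mulr1 upow1 mulr1 sub0r mulrC.
- exact: niceD.
- move=> u u1; have u0 : 0 < u by exact: lt_le_trans u1.
  apply: is_rder_eq (is_rderZ c^-1 (is_rderM (is_rder_wave c u) (is_rder_upow w u0))) _.
  by field.
- rewrite -[X in _ --> X](mulr0 (c^-1 : C^o)); apply: cvgCZ; apply: upow_cvg0 => //.
  by apply: lt_trans w1 _; rewrite oppr_lt0.
Qed.

(** The expansion of u^w = e^(w ln u) in powers of w is integrated term by term
    against e^(cu) u^(-i). The partial sums are bounded by u^(|w| - i), whence the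
    radius i - 1. *)
Lemma osc_ps (i : nat) : exists a, has_ps a (i%:R - 1) (fun w => osc (w - i%:R)).
Proof.
pose g n (u : R) : C := cexp (c * u%:C) * upow u (- i%:R) * ((ln u) ^+ n)%:C.
have cg n : ccont (g n).
  by apply: ccontM (ccont_ln n); apply: ccontM; [exact: ccont_wave|exact: ccont_upow].
have Rei : Re (- i%:R) = - i%:R by rewrite ReN Re_nat.
have ng n : 1 < (i%:R : R) -> nice (g n).
  move=> i1; split => //; pose r : R := (i%:R - 1) / 2.
  have r0 : 0 < r by rewrite divr_gt0// subr_gt0.
  exists (n`!%:R / r ^+ n), (i%:R - r); split; first by rewrite /r; lra.
  move=> u u1; have u0 : 0 < u by exact: lt_le_trans u1.
  have l0 : 0 <= ln u by exact: ln_ge0.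
  rewrite /g cabsM cabsM cabs_wave// mul1r cabs_upow// Rei cabs_real ger0_norm ?exprn_ge0//.
  rewrite opprB addrC powRD; last by rewrite (gt_eqF u0) implybT.
  rewrite mulrCA ler_wpM2l ?powR_ge0// mulrAC ler_pdivlMr ?exprn_gt0//.
  rewrite [_ * r ^+ n]mulrC -exprMn.
  have := @expR_term (r * ln u) n (mulr_ge0 (ltW r0) l0).
  rewrite ler_pdivrMr ?ltr0n ?fact_gt0// => /le_trans; apply.
  by rewrite mulrC /powR (gt_eqF u0).
exists (fun n => CI (g n) / n`!%:R) => w wi.
have i1 : 1 < (i%:R : R).
  by have := cabs_ge0 w; lra.
have W0 := cabs_ge0 w.
pose f_ (N : nat) (u : R) : C := \sum_(0 <= n < N) w ^+ n / n`!%:R * g n u.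
have -> : (fun n => CI (g n) / n`!%:R * w ^+ n) = (fun n => w ^+ n / n`!%:R * CI (g n)).
  by apply/funext => n; ring.
have fE N u : f_ N u = cexp (c * u%:C) * upow u (- i%:R) *
    \sum_(0 <= n < N) (w * (ln u)%:C) ^+ n / n`!%:R.
  rewrite mulr_sumr; apply: eq_bigr => n _; rewrite /g exprMn rmorphXn /=; ring.
have e1 N : CI (f_ N) = \sum_(0 <= n < N) w ^+ n / n`!%:R * CI (g n).
  rewrite CI_sum; last by move=> n _; apply: cintegrableZ; exact/nice_integrable/ng.
  by apply: eq_bigr => n _; rewrite CI_Z//; exact/nice_integrable/ng.
rewrite /csum (_ : series _ = fun N => CI (f_ N)); last first.
  by apply/funext => N; rewrite e1.
apply: (@CI_dominated _ _ _ 1 (i%:R - cabs w)).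
- by lra.
- move=> N; apply: ccont_meas; apply: ccont_sum => n _.
  by apply: ccontM => //; exact: ccont_cst.
- move=> u u1; rewrite [w - _]addrC upowD mulrA.
  under eq_fun do rewrite fE.
  by apply: cvgCZ; exact: cexp_csum.
- move=> N u u1; have u0 : 0 < u by exact: lt_le_trans u1.
  have l0 : 0 <= ln u by exact: ln_ge0.
  rewrite fE cabsM cabsM cabs_wave// cabs_upow// Rei !mul1r opprB addrC.
  rewrite powRD; last by rewrite (gt_eqF u0) implybT.
  rewrite ler_wpM2l ?powR_ge0//; apply: le_trans (cabs_sum _ _ _) _.
  have := @expR_partial (cabs w * ln u) N (mulr_ge0 W0 l0).
  rewrite /powR gt_eqF//; apply: le_trans; apply: ler_sum => n _.
  by rewrite cabsM cabsV cabs_nat cabsX cabsM cabs_real (ger0_norm l0).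
Qed.

(** The right-hand side of [osc_parts], iterated m times: it only involves the
    integral at w - m, which converges for Re w < m - 1. *)
Fixpoint osc_ext (m : nat) (w : C) : C :=
  if m is m'.+1 then - (cexp c / c) - w / c * osc_ext m' (w - 1) else osc w.

Lemma osc_ext_ps m i :
  exists a, has_ps a (m%:R + i%:R - 1) (fun w => osc_ext m (w - i%:R)).
Proof.
elim: m i => [|m ih] i; first by rewrite add0r; exact: osc_ps.
have [a ha] := ih i.+1.
have hr : m%:R + i.+1%:R - 1 = m.+1%:R + i%:R - 1 :> R.
  by rewrite -!natr1; ring.
rewrite hr in ha; set r := _ - 1 in ha *.
have h1 := @ps_cst _ (- (cexp c / c)) r.
have h2 := @psZ _ (- c^-1) _ _ _ (ps_mulX ha).
have h3 := @psZ _ (i%:R / c) _ _ _ ha.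
have h := psD h1 (psD h2 h3); eexists.
move=> w wr; have := h w wr; congr (csum _ _).
rewrite /= (_ : w - i%:R - 1 = w - i.+1%:R); last by rewrite -natr1; ring.
ring.
Qed.

Lemma osc_ext_base m w : Re w < -1 -> osc_ext m w = osc w.
Proof.
elim: m w => [//|m ih] w w1 /=; rewrite ih -?osc_parts//.
by rewrite ReB /=; apply: lt_trans w1; rewrite gtrDl ltrN10.
Qed.

Lemma osc_ext_step m w : Re w < m%:R - 1 -> osc_ext m.+1 w = osc_ext m w.
Proof.
elim: m w => [|m ih] w w1; first by apply: osc_ext_base; rewrite -[-1]add0r.
transitivity (- (cexp c / c) - w / c * osc_ext m.+1 (w - 1)); first by [].
by rewrite ih//; move: w1; rewrite -natr1 addrK ReB /= ltrD2r.
Qed.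

(** The m-th continuation has a power series at 0 of radius m - 1, and all
    continuations agree near 0 from m = 2 on. By uniqueness of the coefficients
    there is a single power series, which converges everywhere. *)
Lemma osc_entire : exists (E : C -> C) (a : nat -> C),
  (forall r, has_ps a r E) /\ (forall w, Re w < -1 -> E w = osc w).
Proof.
have ext_le m k w : Re w < m%:R - 1 -> osc_ext (m + k) w = osc_ext m w.
  move=> h; elim: k => [|k ih]; first by rewrite addn0.
  rewrite addnS osc_ext_step// natrD; apply: lt_le_trans h _.
  by rewrite lerD2r lerDl.
have ps0 m : exists a, has_ps a (m%:R - 1) (osc_ext m).
  have [a ha] := osc_ext_ps m 0; exists a; rewrite addr0 in ha.
  by move=> w /ha; rewrite subr0.
have [a ha] := ps0 2%N.
have r1 : (2%:R - 1 : R) = 1 by ring.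
rewrite r1 in ha.
have ext_ps k : has_ps a (1 + k%:R) (osc_ext (2 + k)).
  have [b hb] := ps0 (2 + k)%N.
  have rk : ((2 + k)%:R - 1 : R) = 1 + k%:R by rewrite natrD -r1; ring.
  rewrite rk in hb; suff -> : a = b by [].
  apply: (@ps_unique _ _ _ 1 (osc_ext 2)) => // w w1.
  rewrite -(ext_le 2%N k); first by apply: hb; apply: lt_le_trans w1 _; rewrite lerDl.
  by rewrite r1; apply: le_lt_trans (ler_norm _) (le_lt_trans (normRe_le _) w1).
have ex (w : C) : exists l : C, csum (fun n => a n * w ^+ n) l.
  exists (osc_ext (2 + Num.bound (cabs w)) w); apply: ext_ps.
  apply: lt_le_trans (archi_boundP (cabs_ge0 w)) _; by rewrite lerDr.
pose E (w : C) : C := projT1 (cid (ex w)).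
have hE (w : C) : csum (fun n => a n * w ^+ n) (E w) by exact: (projT2 (cid (ex w))).
exists E, a; split => [r w _|w w1]; first exact: hE.
rewrite -(osc_ext_base (2 + Num.bound (cabs w)) w1).
apply: (csum_unique (hE w)); apply: ext_ps.
apply: lt_le_trans (archi_boundP (cabs_ge0 w)) _; by rewrite lerDr.
Qed.

(** Termwise integration: dividing the k-th coefficient by k + 1 does not affect
    absolute convergence. *)
Lemma ps_primitive (E : C -> C) (a : nat -> C) : (forall r, has_ps a r E) ->
  exists H : C -> C, forall w, is_cder H w (E w).
Proof.
move=> hE; pose b n : C := if n is k.+1 then a k / k.+1%:R else 0.
have ex (w : C) : exists l : C, csum (fun n => b n * w ^+ n) l.
  apply: abs_csum.
  have [|S hS] := ps_abs (s := cabs w) (hE (cabs w + 1)).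
    by rewrite cabs_ge0 ltrDl ltr01.
  have S0 : 0 <= S by have := hS 0%N; rewrite big_nil.
  exists (cabs w * S) => -[|n].
    by rewrite big_nil mulr_ge0// cabs_ge0.
  rewrite big_nat_recl// /= mul0r cabs0 add0r.
  apply: le_trans (ler_wpM2l (cabs_ge0 w) (hS n)); rewrite mulr_sumr.
  apply: ler_sum => k _.
  rewrite !cabsM cabsV cabs_nat cabsX exprS mulrCA ler_wpM2l ?cabs_ge0//.
  rewrite ler_wpM2r ?exprn_ge0 ?cabs_ge0// ler_pdivrMr ?ltr0n//.
  by rewrite ler_peMr ?cabs_ge0// ler1n.
pose H (w : C) : C := projT1 (cid (ex w)).
have hH (w : C) : csum (fun n => b n * w ^+ n) (H w) by exact: (projT2 (cid (ex w))).
exists H => w; apply: (@ps_cder _ b (cabs w + 1)) => // [z zr|]; last first.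
  by rewrite ltrDl.
have := hE _ _ zr; apply: csum_ext => n /=.
by rewrite mulrCA mulfV ?mulr1// pnatr_eq0.
Qed.

Lemma osc_primitive : exists H E : C -> C,
  (forall w, is_cder H w (E w)) /\ (forall w, Re w < -1 -> E w = osc w).
Proof.
have [E [a [ha hE]]] := osc_entire.
by have [H hH] := ps_primitive ha; exists H, E.
Qed.
End Oscillating.

(** * Riemann sums along geometric progressions *)

Section RiemannSums.
Variable R : realType.
Local Notation C := (R[i]).
Local Notation Re := (@complex.Re R).
Local Notation Im := (@complex.Im R).
Local Notation mu := (@lebesgue_measure R).

Definition slab (a b u : R) : R := if (a <= u) && (u < b) then u^-1 else 0.

Lemma measurable_slab (a b : R) : measurable_fun (@halfline R) (slab a b).
Proof.
have mi : measurable_fun (@halfline R) (fun u : R => u^-1).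
  apply: cont_measurable_halfline => u u1.
  by apply: cvgV; [rewrite gt_eqF// (lt_le_trans _ u1)|exact: cvg_id].
apply: measurable_fun_if => //; first exact: measurable_halfline.
  apply: measurable_and; first exact: measurable_realfun.measurable_fun_ler.
  exact: measurable_realfun.measurable_fun_ltr.
apply: measurable_funS mi; first exact: measurable_halfline.
by move=> u [].
Qed.

Lemma integrable_slab (a b : R) : mu.-integrable (@halfline R) (EFin \o slab a b).
Proof.
apply: (@integrable_dominated _ (slab a b) `|b| 2).
- by rewrite ltr1n.
- exact: measurable_slab.
- move=> u u1; have u0 : 0 < u by exact: lt_le_trans u1.
  rewrite /slab; case: ifP => [/andP[_ ub]|_].
    rewrite gtr0_norm ?invr_gt0// powRN powR_mulrn ?(ltW u0)//.
    rewrite ler_pdivlMr ?exprn_gt0// expr2 mulKf ?gt_eqF//.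
    by apply: le_trans (ler_norm _); exact: ltW.
  by rewrite normr0 mulr_ge0// powR_ge0.
Qed.

Lemma Rint_slab (a b : R) : 1 <= a < b ->
  \int[mu]_(u in @halfline R) slab a b u = ln b - ln a.
Proof.
move=> /andP[a1 ab].
transitivity (\int[mu]_(u in `[a, b[) u^-1).
  rewrite (_ : `[a, b[%classic = @halfline R `&` [set u | (a <= u) && (u < b)]); last first.
    apply/seteqP; split=> u; rewrite /halfline /= !in_itv /= ?andbT.
      by move=> /andP[au ub]; rewrite au ub (le_trans a1 au).
    by move=> [_].
  rewrite Rintegral_mkcondr; apply: eq_Rintegral => u _.
  rewrite patchE /slab; case: ifPn => [h|h]; first by rewrite mem_set.
  by rewrite memNset//; exact/negP.
have sub : `[a, b[%classic `<=` @halfline R.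
  move=> u; rewrite /= in_itv /= => /andP[au _]; apply/halflineE.
  exact: le_trans a1 au.
rewrite Rintegral_itv_bndo_bndc.
  apply: Rint_segment => // u au; have u0 : 0 < u by rewrite (lt_le_trans _ au)// (lt_le_trans _ a1).
    exact: is_derive1_ln.
  by apply: cvgV; [rewrite gt_eqF|exact: cvg_id].
have h : mu.-integrable `[a, b[ (EFin \o slab a b).
  apply: (@integrableS _ _ R mu (@halfline R)) => //.
  - exact: measurable_halfline.
  - exact: integrable_slab.
apply: eq_integrable h; first exact: measurable_itv.
by move=> u; rewrite inE /= in_itv /= /slab => ->.
Qed.

Section Step.
Variables (f : R -> C) (c p : R) (p1 : 1 < p) (q : R) (q1 : 1 < q).
Hypothesis df : forall u : R, 1 <= u -> cabs (f u) <= c * u `^ (1 - p).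

Definition qfloor (u : R) : nat := Num.truncn (ln u / ln q).
(** A step function times 1/u: on the interval from q^n to q^(n + 1) the function
    f is replaced by its value at the right end. The integral of this function is
    the Riemann sum of f(u) du/u for the subdivision by the powers of q, and such
    sums are thereby within reach of dominated convergence. *)
Definition qstep (u : R) : C := f (q ^+ (qfloor u).+1) * (u^-1)%:C.

Let lnq : 0 < ln q. Proof. exact: ln_gt0. Qed.
Let q0 : 0 < q. Proof. exact: lt_trans q1. Qed.

Lemma qfloorP u : 1 <= u -> q ^+ qfloor u <= u < q ^+ (qfloor u).+1.
Proof.
move=> u1; have u0 : 0 < u by exact: lt_le_trans u1.
have h : 0 <= ln u / ln q by rewrite divr_ge0 ?ln_ge0// ltW.
have /andP[h1 h2] := truncn_itv h.
rewrite ler_pdivlMr// in h1; rewrite ltr_pdivrMr// in h2.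
apply/andP; split.
  by rewrite -ler_ln ?posrE ?exprn_gt0// lnXn// -mulr_natl.
by rewrite -ltr_ln ?posrE ?exprn_gt0// lnXn// -mulr_natl.
Qed.

Lemma qfloor_uniq u n : 1 <= u -> (q ^+ n <= u) && (u < q ^+ n.+1) = (n == qfloor u).
Proof.
move=> u1; have /andP[h1 h2] := qfloorP u1.
apply/idP/eqP => [/andP[k1 k2]|->]; last by rewrite h1.
apply/eqP; rewrite eqn_leq; apply/andP; split; rewrite -ltnS.
  by rewrite -(ltr_eXn2l q1); exact: le_lt_trans k1 h2.
by rewrite -(ltr_eXn2l q1); exact: le_lt_trans h1 k2.
Qed.

Lemma qstep_bound u : 1 <= u -> cabs (qstep u) <= `|c| * u `^ (- p).
Proof.
move=> u1; have u0 : 0 < u by exact: lt_le_trans u1.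
have /andP[h1 h2] := qfloorP u1; set m := q ^+ _.+1 in h2 *.
have m1 : 1 <= m by rewrite exprn_ege1// ltW.
have m0 : 0 < m by exact: lt_le_trans m1.
rewrite /qstep -/m cabsM cabs_real ger0_norm ?invr_ge0 ?(ltW u0)//.
have -> : - p = (1 - p) + (-1) by ring.
rewrite powRD; last by rewrite (gt_eqF u0) implybT.
rewrite powR_inv1 ?(ltW u0)// mulrA ler_wpM2r ?invr_ge0 ?(ltW u0)//.
apply: le_trans (df m1) _; apply: (@le_trans _ _ (`|c| * m `^ (1 - p))).
  by rewrite ler_wpM2r ?powR_ge0// ler_norm.
rewrite ler_wpM2l// -opprB !powRN lef_pV2 ?posrE ?powR_gt0//.
by apply: ge0_ler_powR; rewrite ?nnegrE ?subr_ge0 ?ltW.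
Qed.

Definition qsum (K : nat) (u : R) : C :=
  \sum_(0 <= n < K) f (q ^+ n.+1) * (slab (q ^+ n) (q ^+ n.+1) u)%:C.

Lemma qsumE K u : 1 <= u -> qsum K u = if (qfloor u < K)%N then qstep u else 0.
Proof.
move=> u1; rewrite /qsum big_mkord.
have slE n : slab (q ^+ n) (q ^+ n.+1) u = if n == qfloor u then u^-1 else 0.
  by rewrite /slab qfloor_uniq.
case: ifPn => [h|h].
  rewrite (bigD1 (Ordinal h))//= big1 ?addr0 => [|i ih]; first by rewrite slE eqxx.
  rewrite slE ifN ?mulr0//; apply: contra ih.
rewrite big1// => i _; rewrite slE ifN ?mulr0//.
by apply: contra h => /eqP <-.
Qed.

Lemma cintegrable_slab (z : C) a b : cintegrable (fun u => z * (slab a b u)%:C).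
Proof.
apply: cintegrableZ; split; first exact: integrable_slab.
by have [] := cintegrable0 R.
Qed.

Lemma CI_qsum K : CI (qsum K) = \sum_(0 <= n < K) f (q ^+ n.+1) * (ln q)%:C.
Proof.
rewrite /qsum CI_sum; last by move=> n _; exact: cintegrable_slab.
apply: eq_bigr => n _; rewrite CI_Z; last first.
  by split; [exact: integrable_slab|have [] := cintegrable0 R].
congr (_ * _); apply: eqC => /=.
  rewrite Rint_slab ?lnXn//; first by rewrite mulrS addrK.
  by rewrite exprn_ege1 ?ltW//= ltr_eXn2l.
by have := congr1 Im (CI_0 R).
Qed.

Lemma measurable_qsum K :
  measurable_fun (@halfline R) (fun u => Re (qsum K u)) /\
  measurable_fun (@halfline R) (fun u => Im (qsum K u)).
Proof.
have [h1 h2] : cintegrable (qsum K).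
  by apply: cintegrable_sum => n _; exact: cintegrable_slab.
by split; apply/measurable_realfun.measurable_EFinP;
  [exact: (measurable_int mu h1)|exact: (measurable_int mu h2)].
Qed.

Lemma qsum_cvg u : 1 <= u -> qsum K u @[K --> \oo] --> (qstep u : C^o).
Proof.
move=> u1; apply: (@cvg_near_cst _ C^o); near=> K; rewrite qsumE// ifT//.
by near: K; exists (qfloor u).+1.
Unshelve. all: by end_near. Qed.

Lemma measurable_qstep :
  measurable_fun (@halfline R) (fun u => Re (qstep u)) /\
  measurable_fun (@halfline R) (fun u => Im (qstep u)).
Proof.
split.
  apply: (@measurable_realfun.measurable_fun_cvg _ _ _ _ (fun K u => Re (qsum K u))).
    by move=> K; have [] := measurable_qsum K.
  by move=> u /halflineE /qsum_cvg /cvgC_ReIm[].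
apply: (@measurable_realfun.measurable_fun_cvg _ _ _ _ (fun K u => Im (qsum K u))).
  by move=> K; have [] := measurable_qsum K.
by move=> u /halflineE /qsum_cvg /cvgC_ReIm[].
Qed.

Lemma CI_qstep : csum (fun n => f (q ^+ n.+1) * (ln q)%:C) (CI qstep).
Proof.
rewrite /csum (_ : series _ = fun K => CI (qsum K)); last first.
  by apply/funext => K; rewrite CI_qsum.
apply: (@CI_dominated _ _ _ `|c| p) => //.
- exact: measurable_qsum.
- exact: qsum_cvg.
- move=> K u u1; rewrite qsumE//; case: ifP => _; first exact: qstep_bound.
  by rewrite cabs0 mulr_ge0// powR_ge0.
Qed.
End Step.

(** The first power of q above u is at most q u, so it tends to u when q tends to
    1. Hence the step functions converge pointwise, and the bound u^(-p) is uniform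
    in q. *)
Lemma qstep_limit (f : R -> C) (c p : R) : 1 < p -> ccont f ->
  (forall u : R, 1 <= u -> cabs (f u) <= c * u `^ (1 - p)) ->
  forall q_ : nat -> R, (forall n, 1 < q_ n) -> q_ n @[n --> \oo] --> (1 : R) ->
  CI (qstep f (q_ n)) @[n --> \oo] --> (CI (fun u => f u * (u^-1)%:C) : C^o).
Proof.
move=> p1 cf df q_ q1 qc.
apply: (@CI_dominated _ _ _ `|c| p) => //.
- by move=> n; apply: measurable_qstep.
- move=> u u1; have u0 : 0 < u by exact: lt_le_trans u1.
  pose m n := q_ n ^+ (qfloor (q_ n) u).+1.
  have hm : m n @[n --> \oo] --> u.
    apply: (@squeeze_cvgr _ _ _ _ (fun=> u) (fun n => q_ n * u)).
    + near=> n; have /andP[h1 h2] := qfloorP (q1 n) u1.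
      rewrite (ltW h2) /= /m exprS ler_wpM2l// ltW// (lt_trans ltr01)//.
    + exact: cvg_cst.
    + rewrite -[X in _ --> X]mul1r; apply: cvgM => //; exact: cvg_cst.
  have [f1 f2] := cf u u1.
  rewrite /qstep mulrC; under eq_fun do rewrite mulrC.
  apply: cvgCZ; apply/cvgC_ReIm; split.
    exact: (cvg_comp _ _ hm f1).
  exact: (cvg_comp _ _ hm f2).
- by move=> n u u1; apply: (qstep_bound p1).
Unshelve. all: by end_near. Qed.
End RiemannSums.

(** * The limit defining the zeta function *)

Section ZetaLimit.
Variable R : realType.
Local Notation C := (R[i]).
Local Notation Re := (@complex.Re R).
Local Notation Im := (@complex.Im R).

(** The integrand of the zeta integral with respect to du/u. *)
Definition mellin (N : R -> R) (s : C) (u : R) : C := (N u)%:C * upow u (- s).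

Lemma zeta_integralE (N : R -> R) (s : C) :
  zeta_integral N s = CI (fun u => mellin N s u * (u^-1)%:C).
Proof.
rewrite -[LHS]/(CI (fun u => (N u)%:C * rpowN u s / u%:C)).
by apply: eq_CI => u _; rewrite /mellin /rpowN /upow mulNr fmorphV.
Qed.

Lemma mellin_bound (N : R -> R) (c k : R) (s : C) :
  (forall u, 1 <= u -> `|N u| <= c * u `^ k) ->
  forall u : R, 1 <= u -> cabs (mellin N s u) <= c * u `^ (1 - (1 + (Re s - k))).
Proof.
move=> gN u u1; have u0 : 0 < u by exact: lt_le_trans u1.
rewrite /mellin cabsM cabs_real cabs_upow// ReN.
rewrite (_ : 1 - _ = k + - Re s); last by ring.
rewrite powRD; last by rewrite (gt_eqF u0) implybT.
by rewrite mulrA ler_wpM2r ?powR_ge0// gN.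
Qed.

(** The series that defines F is the power series with coefficients N(q^r) / r,
    evaluated at q^(-s). Differentiation in s cancels the denominators r and
    produces a factor ln q, which leaves a Riemann sum. *)
Lemma zetaF_qstep (N : R -> R) (c k q : R) (s : C) :
  (forall u, 1 <= u -> `|N u| <= c * u `^ k) -> 1 < q -> k < Re s ->
  zetaF N q s = CI (qstep (mellin N s) q).
Proof.
move=> gN q1 ks; have q0 : 0 < q by exact: lt_trans q1.
have lnq : 0 < ln q by exact: ln_gt0.
pose rho := q `^ (- k).
have rho0 : 0 < rho by exact: powR_gt0.
pose a (n : nat) : C := if n is m.+1 then (N (q ^+ m.+1))%:C / m.+1%:R else 0.
pose D (z : C) : nat -> C := fun n => (N (q ^+ n.+1))%:C * z ^+ n.
have NB n : `|N (q ^+ n)| <= `|c| * (q `^ k) ^+ n.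
  have qn1 : 1 <= q ^+ n by rewrite exprn_ege1// ltW.
  apply: le_trans (gN _ qn1) _.
  rewrite -powR_mulrn ?(ltW q0)// powRAC powR_mulrn ?powR_ge0//.
  by rewrite ler_wpM2r ?exprn_ge0 ?powR_ge0// ler_norm.
have geo (z : C) : cabs z < rho -> bounded_sums (fun n => `|c| * (q `^ k * cabs z) ^+ n).
  move=> zr; apply: bounded_sumsZ => //; apply: bounded_sums_geometric.
  rewrite mulr_ge0 ?powR_ge0 ?cabs_ge0//= mulrC -ltr_pdivlMr ?powR_gt0//.
  by rewrite -powRN mul1r.
have exP (z : C) : cabs z < rho -> exists l : C, csum (fun n => a n * z ^+ n) l.
  move=> zr; apply: abs_csum; apply: bounded_sums_le (geo z zr) => -[|n].
    by rewrite mul0r cabs0 mulr1.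
  rewrite !cabsM cabsV cabs_nat cabs_real cabsX exprMn mulrA ler_wpM2r ?exprn_ge0 ?cabs_ge0//.
  apply: le_trans (NB n.+1); rewrite ler_pdivrMr ?ltr0n// ler_peMr// ler1n//.
have exD (z : C) : cabs z < rho -> exists l : C, csum (D z) l.
  move=> zr; apply: abs_csum; have h := bounded_sumsZ (c := q `^ k) _ (geo z zr).
  apply: bounded_sums_le (h _) => [n|]; last exact: powR_ge0.
  rewrite cabsM cabs_real cabsX.
  apply: le_trans (ler_wpM2r _ (NB n.+1)) _; first by rewrite exprn_ge0// cabs_ge0.
  rewrite exprS exprMn le_eqVlt; apply/orP; left; apply/eqP; ring.
pose P (z : C) : C := limn (series (fun n => a n * z ^+ n : C^o)).
pose P' (z : C) : C := limn (series (D z : nat -> C^o)).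
have hP : has_ps a rho P.
  by move=> z /exP[l hl]; rewrite /P (csum_lim hl).
have hD (z : C) : cabs z < rho -> csum (D z) (P' z).
  by move=> /exD[l hl]; rewrite /P' (csum_lim hl).
have dP (z : C) : cabs z < rho -> is_cder P z (P' z).
  apply: (ps_cder hP) => w wr; apply: csum_ext (hD w wr) => n.
  by rewrite /D /a mulrCA mulfV ?mulr1// pnatr_eq0.
pose x : C := (ln q)%:C.
have lnqn n : (ln q *+ n)%:C = n%:R * x :> C by rewrite rmorphMn /= mulr_natl.
pose Z (w : C) : C := cexp (- x * w).
have Zrho (w : C) : k < Re w -> cabs (Z w) < rho.
  move=> kw; rewrite /Z cabs_cexp ReM !ReN !ImN /= oppr0 mul0r subr0.
  by rewrite /rho /powR gt_eqF// ltr_expR !mulNr ltrN2 [ltRHS]mulrC ltr_pM2r.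
have Zpow (w : C) n : upow (q ^+ n) (- w) = Z w ^+ n.
  rewrite /Z /upow -cexp_natM lnXn// lnqn; congr cexp; ring.
have Lw (w : C) : k < Re w ->
    limn (series (fun r : nat =>
        (N (q ^+ r.+1))%:C * rpowN q (r.+1%:R * w) / r.+1%:R : C^o)) = P (Z w).
  move=> kw; apply: csum_lim; have := csum_shift (hP _ (Zrho _ kw)).
  rewrite mul0r subr0; apply: csum_ext => n.
  rewrite -Zpow /rpowN /upow lnXn// lnqn.
  rewrite mulrAC; congr (_ * cexp _ / _); ring.
have dL : is_cder (fun w => P (Z w)) s (P' (Z s) * (Z s * - x)).
  apply: (is_cder_comp (f := Z)); last exact: dP (Zrho _ ks).
  apply: (is_cder_comp (f := fun w => - x * w)); last exact: is_cder_cexp.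
  by apply: is_cder_eq (is_cderZ (- x) (is_cder_id s)) _; rewrite mulr1.
have -> : zetaF N q s = P' (Z s) * (Z s * x).
  rewrite /zetaF; set L := (fun s' : C => _).
  have hL : is_cder L s (P' (Z s) * (Z s * - x)).
    apply: (@is_cder_ext _ _ _ _ _ (Re s - k)) dL; first by rewrite subr_gt0.
    move=> w ws; rewrite -Lw//.
    have := normRe_le (w - s); rewrite ReB ler_norml => /andP[h _].
    by move: (le_lt_trans (lexx _) ws); lra.
  by rewrite (is_cder_derivable hL).2 mulrN mulrN opprK.
have p1 : 1 < 1 + (Re s - k) by rewrite ltrDl subr_gt0.
have h := CI_qstep p1 q1 (mellin_bound s gN).
have h2 : csum (fun n => mellin N s (q ^+ n.+1) * x) (Z s * x * P' (Z s)).
  apply: csum_ext (csumZ (c := Z s * x) (hD _ (Zrho _ ks))) => n.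
  by rewrite /D /mellin Zpow [Z s ^+ _.+1]exprS; ring.
by rewrite mulrC; exact: (csum_unique h2 h).
Qed.

Lemma zetaF_limit (N : R -> R) (c k : R) (s : C) :
  (forall u, 1 <= u -> {for u, continuous N}) ->
  (forall u, 1 <= u -> `|N u| <= c * u `^ k) -> k < Re s ->
  zetaF N q s @[q --> 1^'+] --> (zeta_integral N s : C^o).
Proof.
move=> cN gN ks; rewrite zeta_integralE.
have p1 : 1 < 1 + (Re s - k) by rewrite ltrDl subr_gt0.
have cM : ccont (mellin N s).
  by apply: ccontM; [move=> u u1; split; [exact: cN|exact: cvg_cst]|exact: ccont_upow].
apply/cvgC_ReIm; split; apply/cvg_at_rightP => q_ [q1 qc];
  have /cvgC_ReIm[h1 h2] := qstep_limit p1 cM (mellin_bound s gN) q1 qc.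
  by under eq_fun do rewrite (zetaF_qstep gN (q1 _) ks).
by under eq_fun do rewrite (zetaF_qstep gN (q1 _) ks).
Qed.

Lemma zetaF_eq (N N' : R -> R) (q : R) (s : C) : 1 < q ->
  (forall u, 1 <= u -> N u = N' u) -> zetaF N q s = zetaF N' q s.
Proof.
move=> q1 NN; pose zF (A : nat -> R) : C := - cderive (fun s' : C =>
  limn (series (fun r : nat => (A r)%:C * rpowN q (r.+1%:R * s') / r.+1%:R : C^o))) s.
have e : (fun r => N (q ^+ r.+1)) = (fun r => N' (q ^+ r.+1)).
  by apply/funext => r; rewrite NN// exprn_ege1// ltW.
by rewrite -[LHS]/(zF (fun r => N (q ^+ r.+1))) e.
Qed.

Lemma zeta_integral_eq (N N' : R -> R) (s : C) :
  (forall u, 1 <= u -> N u = N' u) -> zeta_integral N s = zeta_integral N' s.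
Proof.
by move=> NN; rewrite !zeta_integralE; apply: eq_CI => u u1; rewrite /mellin NN.
Qed.

(** Continuity at the end point 1 is two-sided, whereas a counting function is
    prescribed for u >= 1 only: continuity is asked of a function N' that extends
    the restriction of N to u >= 1. *)
Lemma zetaF_limit_eq (N N' : R -> R) (c k : R) (s : C) :
  (forall u, 1 <= u -> N u = N' u) ->
  (forall u, 1 <= u -> {for u, continuous N'}) ->
  (forall u, 1 <= u -> `|N u| <= c * u `^ k) -> k < Re s ->
  zetaF N q s @[q --> 1^'+] --> (zeta_integral N s : C^o).
Proof.
move=> NN cN gN ks; rewrite (zeta_integral_eq _ NN).
have gN' u : 1 <= u -> `|N' u| <= c * u `^ k by move=> u1; rewrite -NN// gN.
apply: cvg_trans (zetaF_limit cN gN' ks); apply: near_eq_cvg; near=> q.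
by apply: esym; apply: zetaF_eq => //; near: q; exact: nbhs_right_gt.
Unshelve. all: by end_near. Qed.

End ZetaLimit.

(** * Zeta functions of polynomials with oscillating terms *)

Section ZetaFormula.
Variable R : realType.
Local Notation C := (R[i]).
Local Notation Re := (@complex.Re R).
Local Notation Im := (@complex.Im R).

Lemma nice_upow (w : C) : Re w < -1 -> nice (fun u : R => upow u w).
Proof.
move=> w1; rewrite (_ : (fun u : R => upow u w) =
  (fun u : R => cexp (0 * u%:C) * upow u w)); first exact: nice_wave.
by apply/funext => u; rewrite mul0r cexp0 mul1r.
Qed.

(** The function N is the sum of a polynomial with coefficients t0 and of
    oscillating terms a e^(cu) u^j, listed as triples (a, c, j) in L. *)
Variables (N : R -> R) (n : nat) (t0 : nat -> R) (L : seq (C * C * nat)).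
Hypothesis Lfreq : forall x, x \in L -> Re x.1.2 = 0 /\ x.1.2 != 0.
Hypothesis NE : forall u : R, 1 <= u -> (N u)%:C =
  \sum_(j < n.+1) (t0 j)%:C * upow u j%:R +
  \sum_(x <- L) x.1.1 * (cexp (x.1.2 * u%:C) * upow u x.2%:R).

Definition degree_le (k : R) : Prop :=
  (forall j, (j < n.+1)%N -> t0 j != 0 -> j%:R <= k) /\
  (forall x, x \in L -> x.2%:R <= k).

Lemma upow_term (s : C) (u : R) (j : nat) : 0 < u ->
  upow u j%:R * upow u (- s) * (u^-1)%:C = upow u (j%:R - s - 1).
Proof. by move=> u0; rewrite !upowD upowN1// fmorphV. Qed.

Lemma Re_exponent (s : C) (j : nat) : Re (j%:R - s - 1) = j%:R - Re s - 1.
Proof. by rewrite !ReB Re_nat. Qed.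

(** Integration term by term: a monomial u^j contributes 1 / (s - j) by
    [CI_upow]. *)
Lemma zeta_integral_formula (k : R) (s : C) : degree_le k -> k < Re s ->
  zeta_integral N s = \sum_(j < n.+1) (t0 j)%:C / (s - j%:R) +
    \sum_(x <- L) x.1.1 * osc x.1.2 (x.2%:R - s - 1).
Proof.
move=> [d1 d2] ks; rewrite zeta_integralE.
pose T (j : nat) (u : R) : C := (t0 j)%:C * upow u (j%:R - s - 1).
pose O (x : C * C * nat) (u : R) : C :=
  x.1.1 * (cexp (x.1.2 * u%:C) * upow u (x.2%:R - s - 1)).
have iT (j : nat) : (j < n.+1)%N -> cintegrable (T j).
  move=> jn; have [t00|t00] := eqVneq (t0 j) 0.
    rewrite (_ : T j = fun=> 0); first exact: cintegrable0.
    by apply/funext => u; rewrite /T t00 mul0r.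
  apply: cintegrableZ; apply: nice_integrable.
  apply: nice_upow; rewrite Re_exponent; have := d1 j jn t00; lra.
have iO x : x \in L -> cintegrable (O x).
  move=> xL; apply: cintegrableZ; apply: nice_integrable; have [c0 _] := Lfreq xL.
  by apply: nice_wave => //; rewrite Re_exponent; have := d2 x xL; lra.
transitivity (CI (fun u => \sum_(j < n.+1) T j u + \sum_(x <- L | x \in L) O x u)).
  apply: eq_CI => u u1; have u0 : 0 < u by exact: lt_le_trans u1.
  rewrite /mellin NE// !mulrDl !mulr_suml -big_seq; congr (_ + _).
    by apply: eq_bigr => j _; rewrite /T -upow_term// !mulrA.
  by apply: eq_bigr => x _; rewrite /O -upow_term// !mulrA.
rewrite CI_D; last 2 first.
- by apply: cintegrable_sum => j _; exact: iT.
- exact: cintegrable_sum.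
have CT : CI (fun u => \sum_(j < n.+1) T j u) = \sum_(j < n.+1) CI (T j).
  by apply: CI_sum => j _; exact: (iT _ (ltn_ord j)).
rewrite CT.
rewrite CI_sum// -big_seq; congr (_ + _).
  apply: eq_bigr => j _; have [t00|t00] := eqVneq (t0 j) 0.
    rewrite t00 mul0r -[RHS](CI_0 R); apply: eq_CI => u _.
    by rewrite /T t00 mul0r.
  have w1 : Re (j%:R - s - 1) < -1.
    by rewrite Re_exponent; have := d1 j (ltn_ord j) t00; lra.
  rewrite /T CI_Z; last first.
    exact/nice_integrable/nice_upow.
  by rewrite CI_upow// subrK -invrN opprB.
rewrite big_seq [RHS]big_seq; apply: eq_bigr => x xL; have [c0 _] := Lfreq xL.
rewrite /O CI_Z//; apply: nice_integrable; apply: nice_wave => //.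
by rewrite Re_exponent; have := d2 x xL; lra.
Qed.

Lemma is_cder_prod_log I (r : seq I) (f : I -> C -> C) (l : I -> C) (s : C) :
  (forall i, is_cder (f i) s (l i * f i s)) ->
  is_cder (fun w => \prod_(i <- r) f i w) s
    ((\sum_(i <- r) l i) * \prod_(i <- r) f i s).
Proof.
move=> h; elim: r => [|i r ih].
  by under eq_fun do rewrite big_nil; rewrite !big_nil mul0r; exact: is_cder_cst.
under eq_fun do rewrite big_cons; rewrite !big_cons.
by apply: is_cder_eq (is_cderM (h i) ih) _; ring.
Qed.

Definition zeta_formula (h : C -> C) (b : nat -> R) (s : C) : C :=
  cexp (h s) * \prod_(j < n.+1) cpow (s - j%:R) (b j).

Lemma zeta_formula_neq0 h b s : zeta_formula h b s != 0.
Proof.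
rewrite /zeta_formula mulf_neq0 ?cexp_neq0//; apply/prodf_neq0 => j _.
exact: cpow_neq0.
Qed.

(** A factor with exponent 0 is the constant 1; only for the other ones must
    s - j lie in the right half-plane, where the logarithm is holomorphic. *)
Lemma is_cder_zeta_formula h b (s h' : C) : is_cder h s h' ->
  (forall j, (j < n.+1)%N -> b j != 0 -> j%:R < Re s) ->
  is_cder (zeta_formula h b) s
    ((h' + \sum_(j < n.+1) (b j)%:C / (s - j%:R)) * zeta_formula h b s).
Proof.
move=> dh bs.
have d1 := is_cder_comp dh (is_cder_cexp (h s)).
have d2 (j : 'I_n.+1) : is_cder (fun w => cpow (w - j%:R) (b j)) s
    ((b j)%:C / (s - j%:R) * cpow (s - j%:R) (b j)).
  have [bj0|bj0] := eqVneq (b j) 0.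
    rewrite bj0 !mul0r (_ : (fun _ => _) = fun=> 1); first exact: is_cder_cst.
    by apply/funext => w; rewrite cpow0.
  have sj : 0 < Re (s - j%:R).
    by rewrite ReB Re_nat subr_gt0; apply: bs.
  have d3 := is_cderB (is_cder_id s) (is_cder_cst (j%:R) s).
  apply: is_cder_eq (is_cder_comp d3 (is_cder_cpow (b j) sj)) _.
  by rewrite subr0 mulr1.
apply: is_cder_eq (is_cderM d1 (is_cder_prod_log _ d2)) _.
by rewrite /zeta_formula; ring.
Qed.

(** The function h is the sum of the primitives of the entire continuations of
    the oscillating integrals, at the points j - s - 1. *)
Lemma exists_entire_part : exists h : C -> C, entire_fun h /\
  forall k s, degree_le k -> k < Re s ->
    is_cder h s (- \sum_(x <- L) x.1.1 * osc x.1.2 (x.2%:R - s - 1)).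
Proof.
have ex (x : C * C * nat) : exists HE : (C -> C) * (C -> C), x \in L ->
    (forall w, is_cder HE.1 w (HE.2 w)) /\
    (forall w, Re w < -1 -> HE.2 w = osc x.1.2 w).
  have [/Lfreq[c0 c1]|_] := boolP (x \in L); last by exists (id, id).
  by have [H [E HE]] := osc_primitive c0 c1; exists (H, E).
pose HE x := projT1 (cid (ex x)).
have hHE x : x \in L -> (forall w, is_cder (HE x).1 w ((HE x).2 w)) /\
    (forall w, Re w < -1 -> (HE x).2 w = osc x.1.2 w).
  exact: (projT2 (cid (ex x))).
pose h (s : C) := \sum_(x <- L | x \in L) x.1.1 * (HE x).1 (x.2%:R - s - 1).
have dh s : is_cder h s (\sum_(x <- L | x \in L) x.1.1 * ((HE x).2 (x.2%:R - s - 1) * - 1)).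
  apply: is_cder_sum => x xL; apply: is_cderZ.
  apply: (is_cder_comp (f := fun s => x.2%:R - s - 1)); last exact: (hHE x xL).1.
  apply: is_cder_eq (is_cderB (is_cderB (is_cder_cst x.2%:R s) (is_cder_id s))
    (is_cder_cst 1 s)) _.
  by rewrite sub0r subr0.
exists h; split.
  by move=> s; have [] := dh s.
move=> k s [_ d2] ks; apply: is_cder_eq (dh s) _.
rewrite [in RHS]big_seq -sumrN; apply: eq_bigr => x xL.
rewrite (hHE x xL).2 ?mulrN1 ?mulrN//.
by rewrite Re_exponent; have := d2 x xL; lra.
Qed.

(** The explicit formula satisfies the differential equation of zeta. The
    quotient of two solutions has derivative zero, hence is constant on the
    half-plane, which is convex. *)
Lemma zeta_of_oscillating : exists h : C -> C, entire_fun h /\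
  forall k, growth_bound N k -> degree_le k -> forall zeta : C -> C,
    is_zeta N k zeta <->
    exists2 c : C, c != 0 & forall s : C, k < Re s ->
      zeta s = c * zeta_formula h (fun j => - t0 j) s.
Proof.
have [h [he dh]] := exists_entire_part.
exists h; split => // k [c gN] dk zeta.
have Ns (j : nat) (s : C) : k < Re s -> (j < n.+1)%N -> t0 j != 0 -> j%:R < Re s.
  by move=> ks jn t00; exact: le_lt_trans (dk.1 j jn t00) ks.
pose G := zeta_formula h (fun j => - t0 j).
have dG s : k < Re s -> is_cder G s (- zeta_integral N s * G s).
  move=> ks; apply: is_cder_eq (is_cder_zeta_formula (dh k s dk ks) _) _.
    by move=> j jn; rewrite oppr_eq0; exact: Ns.
  rewrite (zeta_integral_formula dk ks); congr (_ * _).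
  rewrite opprD addrC; congr (_ + _); rewrite -sumrN; apply: eq_bigr => j _.
  by rewrite rmorphN mulNr.
(* The inverse of G has the same shape, with opposite exponents. *)
pose G' := zeta_formula (fun s => - h s) t0.
have dG' s : k < Re s -> is_cder G' s (zeta_integral N s * G' s).
  move=> ks; apply: is_cder_eq (is_cder_zeta_formula (is_cderN (dh k s dk ks)) _) _.
    by move=> j jn; exact: Ns.
  by rewrite (zeta_integral_formula dk ks) opprK addrC.
have GG' s : G s * G' s = 1.
  rewrite /G /G' /zeta_formula mulrACA cexpNK mul1r -big_split /= big1// => j _.
  by rewrite /cpow rmorphN mulNr mulrC cexpNK.
have near_s (s : C) : k < Re s -> forall w, cabs (w - s) < Re s - k -> k < Re w.
  move=> ks w ws; have := normRe_le (w - s); rewrite ReB ler_norml => /andP[hh _].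
  by move: (le_lt_trans (lexx _) ws); lra.
split=> [hz|[a a0 hz] s ks].
  pose phi s := zeta s * G' s.
  have dphi s : k < Re s -> is_cder phi s 0.
    move=> ks; have [dz z0 _ lz] := hz s ks.
    apply: is_cder_eq (is_cderM (derivable_cder dz) (dG' s ks)) _.
    have -> : cderive zeta s = - zeta_integral N s * zeta s.
      by rewrite -lz mulfVK.
    by ring.
  pose s0 : C := (k + 1)%:C.
  have ks0 : k < Re s0 by rewrite /s0 /= ltrDl.
  exists (phi s0).
    by have [_ z0 _ _] := hz s0 ks0; rewrite mulf_neq0// zeta_formula_neq0.
  move=> s ks; have -> : phi s0 = phi s.
    pose g (t : R) := phi (s0 + t%:C * (s - s0)).
    have : g 0 = g 1.
      apply: rder0_cst => // t /andP[t0' t1].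
      have kt : k < Re (s0 + t%:C * (s - s0)).
        rewrite ReD ReM ReB ReR ImR mul0r subr0.
        have -> : Re s0 + t * (Re s - Re s0) = k + ((1 - t) * (Re s0 - k) + t * (Re s - k)).
          by ring.
        rewrite ltrDl; have [->|tn0] := eqVneq t 0.
          by rewrite mul0r addr0 subr0 mul1r subr_gt0.
        rewrite ltr_wpDl// ?mulr_ge0 ?subr_ge0 ?(ltW ks0)//.
        by rewrite mulr_gt0 ?subr_gt0// lt_def tn0.
      apply: is_rder_eq (is_rder_comp (g := fun t : R => s0 + t%:C * (s - s0))
        (is_rderD (is_rder_cst s0 t) (is_rderM (is_rder_id t) (is_rder_cst (s - s0) t)))
        (dphi _ kt)) _.
      by rewrite mul0r.
    by rewrite /g mul0r addr0 mul1r [s0 + _]addrC subrK.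
  by rewrite /phi -/G -mulrA [G' s * _]mulrC GG' mulr1.
have d0 : 0 < Re s - k by rewrite subr_gt0.
have dz : is_cder zeta s (a * (- zeta_integral N s * G s)).
  apply: is_cder_ext d0 _ (is_cderZ a (dG s ks)) => w ws.
  by rewrite hz//; exact: near_s ws.
have zs0 : zeta s != 0 by rewrite hz// mulf_neq0// zeta_formula_neq0.
have [dz1 dz2] := is_cder_derivable dz.
split => //.
  pose F u : C := \sum_(j < n.+1) (t0 j)%:C * upow u j%:R +
    \sum_(x <- L) x.1.1 * (cexp (x.1.2 * u%:C) * upow u x.2%:R).
  have cF : ccont F.
    apply: ccontD; apply: ccont_sum => i _; apply: ccontM; try exact: ccont_cst.
      exact: ccont_upow.
    by apply: ccontM; [exact: ccont_wave|exact: ccont_upow].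
  apply: (@zetaF_limit_eq _ N (fun u => Re (F u)) c k) => //.
    by move=> u u1; rewrite /F -NE.
  by move=> u u1; have [] := cF u u1.
by rewrite dz2 mulrCA -/G -hz// mulfK.
Qed.
End ZetaFormula.

(** * Characters and quasi-polynomials *)

Section Characters.
Variable R : realType.
Local Notation C := (R[i]).
Local Notation Re := (@complex.Re R).
Local Notation Im := (@complex.Im R).

Definition chr (a : rat) (z : C) : C := cexp ('i%C * (2 * pi * ratr a)%:C * z).

Lemma chrD a b z : chr (a + b) z = chr a z * chr b z.
Proof.
rewrite /chr -cexpD; congr cexp; rewrite rmorphD /= mulrDr rmorphD /=; ring.
Qed.

Lemma chr0 z : chr 0 z = 1.
Proof. by rewrite /chr rmorph0 mulr0 rmorph0 mulr0 mul0r cexp0. Qed.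

Lemma chr_nat a n : chr a n%:R = chr a 1 ^+ n.
Proof. by rewrite /chr -cexp_natM; congr cexp; ring. Qed.

Lemma cexp_i (x : R) : cexp ('i%C * x%:C) = cos x +i* sin x.
Proof.
have e1 : Re ('i%C * x%:C) = 0 by rewrite ReM /= mul0r mul1r subrr.
have e2 : Im ('i%C * x%:C) = x by rewrite ImM /= mul0r mul1r add0r.
by apply: eqC; rewrite ?Re_cexp ?Im_cexp e1 e2 expR0 mul1r.
Qed.

Lemma cexp_2pi (n : nat) : cexp ('i%C * (2 * pi * n%:R)%:C) = 1 :> C.
Proof.
have -> : 'i%C * (2 * pi * n%:R)%:C = n%:R * ('i%C * (2 * pi)%:C) :> C.
  by rewrite rmorphM /= rmorph_nat; ring.
rewrite cexp_natM (_ : cexp _ = 1) ?expr1n//.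
by rewrite cexp_i mulr_natl cos2pi sin2pi.
Qed.

Lemma chr_period a (M : nat) (z : int) : a * M%:R = z%:~R -> chr a M%:R = 1.
Proof.
move=> aM; rewrite /chr.
have -> : 'i%C * (2 * pi * ratr a)%:C * M%:R = 'i%C * (2 * pi * z%:~R)%:C :> C.
  have : ratr (a * M%:R) = z%:~R :> R by rewrite aM ratr_int.
  rewrite rmorphM /= ratr_nat => <-.
  rewrite -(rmorph_nat (real_complex R) M) -mulrA -rmorphM /=; congr (_ * _%:C).
  by rewrite -!mulrA.
case: z {aM} => m; first exact: cexp_2pi.
rewrite NegzE rmorphN /= mulrN rmorphN mulrN cexpN cexp_2pi invr1//.
Qed.

Lemma chr_neq1 (a : rat) : a != 0 -> `|a| < 1 -> chr a 1 != 1.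
Proof.
wlog a0 : a / 0 < a.
  move=> h an0 a1; have [ap|ap] := ltP 0 a; first exact: h.
  have Na : 0 < - a by rewrite oppr_gt0 lt_neqAle an0.
  have := h _ Na; rewrite oppr_eq0 normrN => /(_ an0 a1).
  have : chr a 1 * chr (- a) 1 = 1 by rewrite -chrD subrr chr0.
  by move=> e; apply: contra => /eqP e1; move: e; rewrite e1 mul1r => ->.
move=> _; rewrite gtr0_norm// => a1; apply/eqP => /(congr1 Re).
rewrite /chr mulr1 cexp_i /=.
set x : R := pi * ratr a; rewrite (_ : 2 * pi * ratr a = x + x); last first.
  by rewrite /x; ring.
rewrite cosD -!expr2 => h.
have := cos2Dsin2 x => h2.
have : sin x ^+ 2 = 0 by have : Re 1 = 1 by []; lra.
have p0 := pi_gt0 R.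
have : 0 < sin x.
  apply: sin_gt0_pi; apply/andP; split; first by rewrite mulr_gt0// ltr0q.
  by rewrite gtr_pMr// -(rmorph1 (@ratr R)) ltr_rat.
by move=> s0 /eqP; rewrite expf_eq0 /= gt_eqF.
Qed.

Lemma chr_half (n : nat) : chr (1 / 2) n%:R = (-1) ^+ n.
Proof.
rewrite chr_nat; congr (_ ^+ _); rewrite /chr mulr1 cexp_i.
have -> : 2 * pi * ratr (1 / 2) = pi :> R.
  by rewrite rmorphM /= fmorphV /= rmorph_nat rmorph1 mul1r mulrAC mulfV ?mul1r// pnatr_eq0.
by rewrite cospi sinpi; apply: eqC => /=; rewrite ?oppr0.
Qed.

Lemma ccos_nat (n : nat) : ccos (pi%:C * n%:R) = (-1) ^+ n :> C.
Proof.
have e : 'i%C * (pi%:C * n%:R) = n%:R * ('i%C * pi%:C) :> C by ring.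
rewrite /ccos e cexpN cexp_natM cexp_i cospi sinpi.
have -> : -1 +i* 0 = -1 :> C by apply: eqC => /=; rewrite ?oppr0.
by rewrite -exprVn invrN1 mulrDl -splitr.
Qed.

(** For a <> 0 this is a geometric series over a full period, with ratio different
    from 1. *)
Lemma sum_chr (a : rat) (M : nat) (z : int) : a * M%:R = z%:~R -> `|a| < 1 ->
  \sum_(m < M) chr a m.+2%:R = if a == 0 then M%:R else 0.
Proof.
move=> aM a1; case: eqVneq => [->|a0].
  under eq_bigr do rewrite chr0.
  by rewrite sumr_const card_ord.
have z1 : chr a 1 - 1 != 0 by rewrite subr_eq0 chr_neq1.
apply: (mulfI z1); rewrite mulr0.
under eq_bigr do rewrite chr_nat -addn2 exprD mulrC.
by rewrite -mulr_sumr mulrCA -subrX1 -(chr_nat a M) (chr_period aM) subrr mulr0.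
Qed.

(** Fourier inversion over a common period M: distinct frequencies in (-1/2, 1/2]
    differ by less than 1, so that their characters are distinct. The sums start at
    2, the first integer at which a counting function is prescribed. *)
Lemma chr_coef (I : seq rat) (t : rat -> C) (M : nat) (f : nat -> C) (b : rat) :
  uniq I -> (forall a, a \in I -> - (1 / 2) < a <= 1 / 2) ->
  (forall a, a \in I -> exists z : int, a * M%:R = z%:~R) ->
  (forall n, f n = \sum_(a <- I) t a * chr a n%:R) -> - (1 / 2) < b <= 1 / 2 ->
  (exists z : int, b * M%:R = z%:~R) ->
  \sum_(m < M) f m.+2 * chr (- b) m.+2%:R = if b \in I then M%:R * t b else 0.
Proof.
move=> uI hI hM fE hb [zb eb].
transitivity (\sum_(a <- I) t a * \sum_(m < M) chr (a - b) m.+2%:R).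
  under eq_bigr do rewrite fE mulr_suml.
  rewrite exchange_big /=; apply: eq_bigr => a _; rewrite mulr_sumr.
  by apply: eq_bigr => m _; rewrite chrD mulrA.
transitivity (\sum_(a <- I) (if a == b then M%:R * t b else 0)).
  rewrite big_seq [RHS]big_seq; apply: eq_bigr => a aI.
  have [za ea] := hM a aI.
  rewrite (@sum_chr _ _ (za - zb)); last 2 first.
  - by rewrite mulrBl ea eb rmorphB.
  - have /andP[h1 h2] := hI a aI; have /andP[h3 h4] := hb.
    by rewrite ltr_norml; apply/andP; split; lra.
  rewrite subr_eq0; case: eqP => [->|_]; last by rewrite mulr0.
  by rewrite mulrC.
rewrite -big_mkcond /=; have [bI|bI] := boolP (b \in I).
  by rewrite (big_rem b)//= eqxx big1_seq ?addr0// => a /andP[/eqP ->]; rewrite mem_rem_uniqF.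
rewrite big1_seq// => a /andP[/eqP -> ]; by rewrite (negbTE bI).
Qed.
End Characters.

Section QuasiPolynomials.
Variable R : realType.

(** On a residue class modulo M the coefficients are constant, and the sum is a
    polynomial with infinitely many roots. *)
Lemma quasi_poly_zero (K M : nat) (U : nat -> nat -> R) : (0 < M)%N ->
  (forall j m, U j (m + M)%N = U j m) ->
  (forall m, (0 < m)%N -> \sum_(j < K) U j m * m.+1%:R ^+ j = 0) ->
  forall j m, (j < K)%N -> U j m = 0.
Proof.
move=> M0 per h j m jK.
have perk k i : U i (m + k * M)%N = U i m.
  by elim: k => [|k ih]; rewrite ?addn0// mulSn addnCA addnC per.
pose p : {poly R} := \poly_(i < K) U i m.
pose x (k : nat) : R := (m + k.+1 * M).+1%:R.
have rt k : root p (x k).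
  rewrite /root horner_poly; apply/eqP.
  rewrite -[RHS](h (m + k.+1 * M)%N); last by rewrite addn_gt0 muln_gt0 M0 orbT.
  by apply: eq_bigr => i _; rewrite perk.
have p0 : p = 0.
  apply: (@roots_geq_poly_eq0 _ p (map x (iota 0 K))).
  - by apply/allP => _ /mapP[k _ ->].
  - rewrite map_inj_uniq ?iota_uniq// => k l /eqP.
    by rewrite /x eqr_nat eqSS eqn_add2l eqn_pmul2r// => /eqP[].
  - by rewrite size_map size_iota size_poly.
have : p`_j = 0 by rewrite p0 coef0.
by rewrite coef_poly jK.
Qed.
End QuasiPolynomials.

(** * Zeta functions of quasi-polynomial counting functions *)

Section Growth.
Variable R : realType.

(** If k < n, the two bounds together make u^(n - k) bounded. *)
Lemma growth_degree (N : R -> R) (n : nat) (k : R) : growth_bound N k ->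
  (forall m, (0 < m)%N -> m%:R ^+ n <= N m.+1%:R) -> n%:R <= k.
Proof.
move=> [c gN] h; rewrite leNgt; apply/negP => kn.
have q0 : 0 < n%:R - k by rewrite subr_gt0.
have := cvg_comp _ _ (@cvgr_idn R) (cvg_powRN q0).
move=> /(@cvgrPdist_lt _ R^o)/(_ (2 ^+ n * `|c| + 1)^-1).
rewrite invr_gt0 ltr_wpDl ?mulr_ge0 ?exprn_ge0// => /(_ isT)[m0 _ hm].
pose m := (m0 + 1)%N; have mp : (0 < m)%N by rewrite /m addn1.
have := hm m.+1; rewrite /= /m addn1 => /(_ (leqW (leqnSn _))).
rewrite -addn1 -/m; set u : R := m.+1%:R.
have u1 : 1 <= u by rewrite /u ler1n.
have u0 : 0 < u by exact: lt_le_trans u1.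
rewrite sub0r normrN ger0_norm ?powR_ge0// ltNge => /negP; apply.
have B0 : 0 < 2 ^+ n * `|c| + 1 by rewrite ltr_wpDl// mulr_ge0// exprn_ge0.
rewrite powRN lef_pV2 ?posrE ?powR_gt0//.
rewrite powRD; last by rewrite (gt_eqF u0) implybT.
rewrite powR_mulrn ?(ltW u0)// powRN ler_pdivrMr ?powR_gt0//.
have h1 : u ^+ n <= 2 ^+ n * m%:R ^+ n.
  rewrite -exprMn lerXn2r ?nnegrE ?mulr_ge0 ?(ltW u0)//.
  by rewrite /u -natrM ler_nat mul2n -addnn -addn1 leq_add2l.
apply: le_trans h1 _; rewrite mulrDl mul1r.
apply: le_trans (_ : 2 ^+ n * `|c| * u `^ k <= _); last by rewrite lerDl powR_ge0.
rewrite -mulrA ler_wpM2l ?exprn_ge0//; apply: le_trans (h m mp) _.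
apply: le_trans (ler_norm _) _; apply: le_trans (gN u u1) _.
by rewrite ler_wpM2r ?powR_ge0// ler_norm.
Qed.
End Growth.

Section CountingZeta.
Variable R : realType.
Local Notation C := (R[i]).
Local Notation Re := (@complex.Re R).
Local Notation Im := (@complex.Im R).

Variables (X : eqType) (xs : seq X) (r : X -> nat) (tau : X -> nat -> R).
Variables (n Mt : nat) (mean : X -> R).
Hypothesis r_le : forall x, x \in xs -> (r x <= n)%N.
Hypothesis r_max : forall x, x \in xs -> exists2 y, y \in xs & r y = n.
Hypothesis Mt_gt0 : (0 < Mt)%N.
Hypothesis tau_per : forall x m, tau x (m + Mt)%N = tau x m.
Hypothesis tau_ge1 : forall x m, (0 < m)%N -> 1 <= tau x m.
Hypothesis tau_mean : forall x M, (Mt %| M)%N ->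
  \sum_(m < M) tau x m.+1 = M%:R * mean x.

Variables (g : int -> R) (Ncan : C -> C) (N : R -> R).
Hypothesis gE : forall m : nat, (0 < m)%N ->
  g (m%:Z + 1) = \sum_(x <- xs) m%:R ^+ r x * tau x m.
Hypothesis can : canonical_extension g Ncan.
Hypothesis NE : forall u : R, 1 <= u -> (N u)%:C = Ncan u%:C.

(** The mean value over a period of the coefficient [quasi_coef j]. *)
Definition mean_coef (j : nat) : R :=
  \sum_(x <- xs) 'C(r x, j)%:R * (-1) ^+ (r x + j) * mean x.

(** The coefficient of (m + 1)^j in g(m + 1), obtained by expanding the powers of
    m = (m + 1) - 1. *)
Definition quasi_coef (j m : nat) : R :=
  \sum_(x <- xs) 'C(r x, j)%:R * (-1) ^+ (r x + j) * tau x m.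

Lemma pow_shift (m k : nat) : (k <= n)%N ->
  m%:R ^+ k = \sum_(j < n.+1) 'C(k, j)%:R * (-1) ^+ (k + j) * m.+1%:R ^+ j :> R.
Proof.
move=> kn; have -> : m%:R = - 1 + m.+1%:R :> R by rewrite -natr1; ring.
rewrite exprDn (big_ord_widen n.+1 (fun j => ((-1) ^+ (k - j) * m.+1%:R ^+ j) *+ 'C(k, j)))//.
rewrite big_mkcond; apply: eq_bigr => j _; case: ifPn => [jk|]; last first.
  by rewrite -leqNgt => jk; rewrite bin_small// !mul0r.
rewrite -[LHS]mulr_natl mulrA; congr (_ * _ * _).
rewrite -[in RHS](subnK (_ : j <= k)%N)// -addnA addnn exprD.
by rewrite -mul2n exprM sqrrN expr1n expr1n mulr1.
Qed.

Lemma quasi_coefE (m : nat) : (0 < m)%N ->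
  g (m%:Z + 1) = \sum_(j < n.+1) quasi_coef j m * m.+1%:R ^+ j.
Proof.
move=> m0; rewrite gE//.
under [RHS]eq_bigr do rewrite mulr_suml.
rewrite exchange_big /= big_seq [RHS]big_seq; apply: eq_bigr => x xX.
rewrite (pow_shift _ (r_le xX)) mulr_suml; apply: eq_bigr => j _.
by rewrite -!mulrA; congr (_ * (_ * _)); rewrite mulrC.
Qed.

Lemma quasi_coef_per j m k : quasi_coef j (m + k * Mt)%N = quasi_coef j m.
Proof.
apply: eq_bigr => x _; congr (_ * _).
by elim: k => [|k ih]; rewrite ?addn0// mulSn addnCA addnC tau_per.
Qed.

Lemma sum_quasi_coef j M : (Mt %| M)%N ->
  \sum_(m < M) quasi_coef j m.+1 = M%:R * mean_coef j.
Proof.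
move=> dM; rewrite exchange_big mulr_sumr; apply: eq_bigr => x _.
by rewrite -mulr_sumr tau_mean// mulrCA.
Qed.

Lemma quasi_coef_nil j m : xs = [::] -> quasi_coef j m = 0.
Proof. by rewrite /quasi_coef => ->; rewrite big_nil. Qed.

(** Any multiple of this common denominator is a period of the characters with
    frequencies in I. *)
Lemma seq_common_denom (I : seq rat) : exists2 D : nat, (0 < D)%N &
  forall a M, a \in I -> (D %| M)%N -> exists z : int, a * M%:R = z%:~R.
Proof.
exists (\prod_(a <- I) `|denq a|)%N.
  rewrite big_seq; elim/big_ind: _ => // [a b a0 b0|a _]; first by rewrite muln_gt0 a0.
  by rewrite absz_gt0 denq_neq0.
move=> a M aI; rewrite (big_rem a)//= => /dvdnP[q ->].
exists (numq a * (q * \prod_(y <- rem a I) `|denq y|)%N%:Z).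
rewrite mulnCA natrM mulrA intrM; congr (_ * _).
by rewrite natr_absz gtr0_norm ?denq_gt0// -[X in X * _]divq_num_den divfK// intr_eq0 denq_neq0.
Qed.

(** The values of g determine the coefficients T_j of its canonical extension,
    and these are the [quasi_coef j]. The Fourier coefficient of T_j at frequency 0
    is its mean value and yields the exponent of s - j; the other frequencies
    oscillate and only contribute to h. An exponent k that bounds the growth of N is
    at least n, because N(m + 1) >= m^n as soon as xs is nonempty: this places s - j
    in the right half-plane for Re s > k. *)
Lemma zeta_of_count : exists h : C -> C, entire_fun h /\
  forall k, growth_bound N k -> forall zeta : C -> C,
    is_zeta N k zeta <->
    exists2 c : C, c != 0 & forall s : C, k < Re s ->
      zeta s = c * (cexp (h s) *
        \prod_(j < n.+1) cpow (s - j%:R) (- mean_coef j)).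
Proof.
have [J [T [I [t [s [Tper gT [uI hI] TE NcanE]]]]]] := can.
(* The frequency 1/2 carries the terms s_j (-1)^n, so that T_j is a
   trigonometric sum over I'. The integer M is a common period of tau, of the
   T_j and of the characters. *)
pose I' := 1 / 2 :: I.
pose t' j a := if a == 1 / 2 then s j else t j a.
have halfI : 1 / 2 \notin I by apply/negP => /hI; rewrite ger0_norm// ltxx.
have uI' : uniq I' by rewrite /= halfI.
have hI' a : a \in I' -> - (1 / 2) < a <= 1 / 2.
  rewrite inE => /orP[/eqP ->|/hI]; first by [].
  by rewrite ltr_norml => /andP[-> /ltW].
have [D D0 hD] := seq_common_denom (0 :: I').
pose per j : nat := projT1 (cid2 (Tper j)).
have per0 j : (0 < per j)%N by rewrite /per; case: cid2.
have perE j m : T j (m + (per j)%:Z) = T j m by rewrite /per; case: cid2.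
pose P := (\prod_(j < J) per j)%N.
have P0 : (0 < P)%N by rewrite prodn_gt0.
pose M := (Mt * (P * D))%N.
have M0 : (0 < M)%N by rewrite !muln_gt0 Mt_gt0 P0.
have MtM : (Mt %| M)%N by rewrite dvdn_mulr.
have DM : (D %| M)%N by rewrite /M mulnA dvdn_mull.
have perM j m : (j < J)%N -> T j (m + M%:Z) = T j m.
  move=> jJ; have /dvdnP[q ->] : (per j %| M)%N.
    rewrite /M dvdn_mull// dvdn_mulr// /P (bigD1 (Ordinal jJ))//=.
    exact: dvdn_mulr.
  elim: q => [|q ih]; first by rewrite mul0n addr0.
  by rewrite mulSn addnC PoszD addrA perE.
have Mt_per j m : quasi_coef j (m + M)%N = quasi_coef j m.
  by rewrite /M mulnC quasi_coef_per.
(* The difference of the two expansions of g(m + 1) in powers of m + 1, padded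
   with zeros to the same degree. *)
pose U j m : R := (if (j < J)%N then T j (m.+1)%:Z else 0) -
  (if (j < n.+1)%N then quasi_coef j m else 0).
have U0 j m : (j < maxn J n.+1)%N -> U j m = 0.
  apply: (quasi_poly_zero M0).
    move=> i l; rewrite /U Mt_per; case: ifP => // iJ.
    by rewrite -addSn PoszD perM.
  move=> l l0; transitivity (g (l%:Z + 1) - g (l%:Z + 1)); last by rewrite subrr.
  rewrite [in X in _ = _ - X]quasi_coefE// gT.
  rewrite (big_ord_widen (maxn J n.+1) (fun j => T j (l%:Z + 1) * (l%:Z + 1)%:~R ^+ j)) ?leq_maxl//.
  rewrite (big_ord_widen (maxn J n.+1) (fun j => quasi_coef j l * l.+1%:R ^+ j)) ?leq_maxr//.
  rewrite [X in _ = X - _]big_mkcond [X in _ = _ - X]big_mkcond -sumrB; apply: eq_bigr => i _.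
  have -> : l%:Z + 1 = l.+1%:Z by rewrite -addn1 PoszD.
  rewrite /U mulrBl; congr (_ - _); by case: ifP; rewrite ?mul0r.
have TS j m : (j < J)%N -> T j m.+1%:Z = if (j < n.+1)%N then quasi_coef j m else 0.
  move=> jJ; have := U0 j m; rewrite leq_max jJ => /(_ isT)/eqP.
  by rewrite /U jJ subr_eq0 => /eqP.
have S0 j m : (J <= j < n.+1)%N -> quasi_coef j m = 0.
  move=> /andP[Jj jn]; have := U0 j m; rewrite leq_max jn orbT => /(_ isT)/eqP.
  by rewrite /U ltnNge Jj /= jn sub0r oppr_eq0 => /eqP.
have TE' j (m : nat) : (T j m%:Z)%:C = \sum_(a <- I') t' j a * chr a m%:R.
  rewrite TE /I' big_cons addrC; congr (_ + _).
    by rewrite /t' eqxx chr_half.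
  rewrite big_seq [RHS]big_seq; apply: eq_bigr => a aI; rewrite /t' ifN//.
  by apply: contraNneq halfI => <-.
have coefE j b : b \in 0 :: I' ->
    \sum_(m < M) (T j m.+2%:Z)%:C * chr (- b) m.+2%:R = if b \in I' then M%:R * t' j b else 0.
  move=> bI; apply: (chr_coef uI' hI') (TE' j) _ _ => [a aI'||].
  - by apply: hD => //; rewrite inE aI' orbT.
  - by move: bI; rewrite inE => /orP[/eqP ->|/hI'].
  - exact: hD.
have MC : (M%:R : C) != 0 by rewrite pnatr_eq0 -lt0n.
have MR : (M%:R : R) != 0 by rewrite pnatr_eq0 -lt0n.
have t'0 j b : b \in I' -> (forall m, T j m.+2%:Z = 0) -> t' j b = 0.
  move=> bI Tj; have := coefE j b; rewrite inE bI orbT => /(_ isT).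
  rewrite big1 => [/esym/eqP|m _]; last by rewrite Tj mul0r.
  by rewrite mulf_eq0 (negbTE MC) => /eqP.
have t'_deg j b : (j < J)%N -> b \in I' -> t' j b != 0 -> (j < n.+1)%N /\ xs != [::].
  move=> jJ bI tn0; split.
    apply: contraNT tn0 => jn; apply/eqP; apply: t'0 => // m.
    by rewrite TS// ifN.
  apply: contraNN tn0 => /eqP xs0; apply/eqP; apply: t'0 => // m.
  by rewrite TS// quasi_coef_nil// if_same.
pose z0 j : C := if 0 \in I then t j 0 else 0.
have z0E j : (j < J)%N -> z0 j = if (j < n.+1)%N then (mean_coef j)%:C else 0.
  move=> jJ; apply: (mulfI MC).
  have -> : M%:R * z0 j = \sum_(m < M) (T j m.+2%:Z)%:C.
    have := coefE j 0; rewrite inE eqxx => /(_ isT).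
    under eq_bigr do rewrite oppr0 chr0 mulr1.
    by move=> ->; rewrite /z0 inE /= /t' /=; case: ifP => _; rewrite ?mulr0.
  case: ifP => jn; last by rewrite mulr0 big1// => m _; rewrite TS// jn.
  rewrite -(rmorph_nat (real_complex R)) -rmorphM /= -sum_quasi_coef// rmorph_sum /=.
  by apply: eq_bigr => m _; rewrite TS// jn.
have mean0 j : (J <= j < n.+1)%N -> mean_coef j = 0.
  move=> hj; apply: (mulfI MR); rewrite mulr0 -sum_quasi_coef//.
  by apply: big1 => m _; rewrite S0.
(* The cosine is split into two exponentials. Terms with coefficient zero are
   discarded, since their degrees may exceed n. *)
pose L1 := [seq (t j a, 'i%C * (2 * pi * ratr a)%:C : C, j) |
  j <- index_iota 0 J, a <- [seq a <- I | a != 0]].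
pose L2 := [seq (s j / 2, 'i%C * pi%:C : C, j) | j <- index_iota 0 J].
pose L3 := [seq (s j / 2, - ('i%C * pi%:C) : C, j) | j <- index_iota 0 J].
pose L := [seq x <- L1 ++ L2 ++ L3 | x.1.1 != 0].
have pi0 : (pi : R) != 0 by rewrite gt_eqF// pi_gt0.
have i0 : 'i%C != 0 :> C by rewrite eq_complex /= oner_eq0 andbF.
have Rei (x : R) : Re ('i%C * x%:C) = 0 by rewrite ReM /= mul0r mul1r subrr.
have nzi (x : R) : x != 0 -> 'i%C * x%:C != 0 :> C.
  by move=> x0; rewrite mulf_neq0// eq_complex /= negb_and x0.
have Lfreq x : x \in L -> Re x.1.2 = 0 /\ x.1.2 != 0.
  rewrite mem_filter !mem_cat => /andP[_ /or3P[]].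
  - move=> /allpairsP[[j a] /= [_ ]]; rewrite mem_filter => /andP[a0 _] ->; split; first exact: (Rei (2 * pi * ratr a)).
    by apply: (nzi (2 * pi * ratr a)); rewrite mulf_neq0 ?fmorph_eq0// mulf_neq0 ?pnatr_eq0.
  - by move=> /mapP[j _ ->]; split; [exact: (Rei pi)|exact: (nzi pi)].
  - move=> /mapP[j _ ->]; split; last by rewrite oppr_eq0; exact: (nzi pi).
    by have /eqP := Rei pi; rewrite -oppr_eq0 -ReN => /eqP.
have Ldeg x : x \in L -> (x.2 < n.+1)%N /\ xs != [::].
  rewrite mem_filter !mem_cat => /andP[x0 /or3P[]].
  - move=> /allpairsP[[j a] /= [jJ ]]; rewrite mem_filter => /andP[_ aI] e.
    rewrite {}e /= in x0 *; rewrite mem_index_iota /= in jJ; apply: (t'_deg j a) => //.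
      by rewrite inE aI orbT.
    by rewrite /t' ifN//; apply: contraNneq halfI => <-.
  - move=> /mapP[j jJ e]; rewrite {}e /= in x0 *; rewrite mem_index_iota /= in jJ.
    apply: (t'_deg j (1 / 2)) => //.
    by rewrite /t' eqxx; apply: contraNneq x0 => ->; rewrite mul0r.
  - move=> /mapP[j jJ e]; rewrite {}e /= in x0 *; rewrite mem_index_iota /= in jJ.
    apply: (t'_deg j (1 / 2)) => //.
    by rewrite /t' eqxx; apply: contraNneq x0 => ->; rewrite mul0r.
have NL (u : R) : 1 <= u -> (N u)%:C =
    \sum_(j < n.+1) (mean_coef j)%:C * upow u j%:R +
    \sum_(x <- L) x.1.1 * (cexp (x.1.2 * u%:C) * upow u x.2%:R).
  move=> u1; have u0 : 0 < u by exact: lt_le_trans u1.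
  pose F (x : C * C * nat) := x.1.1 * (cexp (x.1.2 * u%:C) * upow u x.2%:R).
  have -> : \sum_(x <- L) F x = \sum_(x <- L1 ++ L2 ++ L3) F x.
    rewrite big_filter big_mkcond; apply: eq_bigr => x _; case: eqP => //= x0.
    by rewrite /F x0 mul0r.
  rewrite !big_cat /= big_allpairs_dep /= !big_map /=.
  have -> : \sum_(j < n.+1) (mean_coef j)%:C * upow u j%:R =
      \sum_(j <- index_iota 0 J) z0 j * upow u j%:R.
    rewrite big_mkord.
    rewrite (big_ord_widen (maxn J n.+1) (fun j => (mean_coef j)%:C * upow u j%:R)) ?leq_maxr//.
    rewrite (big_ord_widen (maxn J n.+1) (fun j => z0 j * upow u j%:R)) ?leq_maxl//.
    rewrite big_mkcond [RHS]big_mkcond; apply: eq_bigr => j _.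
    have [jJ|Jj] := ltnP j J; first by rewrite z0E//; case: ifP; rewrite ?mul0r.
    by case: ifP => // jn; rewrite mean0 ?Jj// mul0r.
  rewrite NE// NcanE -!big_split /= big_distrr /= big_mkord.
  rewrite -big_split /=; apply: eq_bigr => j _.
  rewrite /F /= upow_nat// big_filter /ccos.
  set w := u%:C ^+ j.
  have -> : pi%:C * u%:C = u%:C * pi%:C :> C by rewrite mulrC.
  have -> : 'i%C * (u%:C * pi%:C) = 'i%C * pi%:C * u%:C :> C by ring.
  rewrite mulNr; set e1 := cexp _; set e2 := cexp _.
  have -> : \sum_(a <- I) t j a * cexp ('i%C * (2 * pi * ratr a)%:C * u%:C) =
      z0 j + \sum_(a <- I | a != 0) t j a * cexp ('i%C * (2 * pi * ratr a)%:C * u%:C).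
    rewrite (bigID (fun a => a == 0)) /=; congr (_ + _); rewrite /z0.
    have [I0|I0] := boolP (0 \in I).
      rewrite -big_filter (_ : [seq a <- I | a == 0] = [:: 0]); last first.
        by rewrite (filter_pred1_uniq uI I0).
      by rewrite big_seq1 rmorph0 mulr0 rmorph0 mulr0 mul0r cexp0 mulr1.
    rewrite big1_seq// => a /andP[/eqP -> ]; by rewrite (negbTE I0).
  rewrite mulrDl mulr_suml -!addrA; congr (_ + _); congr (_ + _).
    by apply: eq_bigr => a _; rewrite mulrA.
  by field.
have [h [he hz]] := zeta_of_oscillating Lfreq NL.
exists h; split => // k gk zeta; apply: hz => //.
have nk : xs != [::] -> n%:R <= k.
  move=> xs0; apply: (growth_degree gk) => m m0.
  have gN : N m.+1%:R = g (m%:Z + 1).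
    have e : m%:Z + 1 = m.+1%:Z by rewrite -addn1 PoszD.
    apply: (@complexI R); rewrite NE ?ler1n// e gT rmorph_nat NcanE ccos_nat.
    rewrite rmorph_sum /= big_distrr -big_split /=; apply: eq_bigr => j _.
    by rewrite rmorphM rmorphXn /= -!pmulrn rmorph_nat TE [RHS]mulrDl mulrCA mulrA.
  rewrite gN gE//.
  have [x xX] : exists x, x \in xs by case: (xs) xs0 => // x l _; exists x; exact: mem_head.
  have [y yX yn] := r_max xX.
  have pos z : 0 <= m%:R ^+ r z * tau z m.
    by rewrite mulr_ge0 ?exprn_ge0// (le_trans ler01)// tau_ge1.
  rewrite (big_rem y)//= yn; apply: le_trans (_ : m%:R ^+ n * tau y m <= _).
    by rewrite ler_peMr ?exprn_ge0// tau_ge1.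
  by rewrite lerDl sumr_ge0.
split=> [j jn tj|x /Ldeg[xn xs0]].
  apply: le_trans (nk _); first by rewrite ler_nat.
  by apply: contraNN tj => /eqP xs0; rewrite /mean_coef xs0 big_nil.
by apply: le_trans (nk xs0); rewrite ler_nat.
Qed.
End CountingZeta.

(** * Cardinals *)

Section Ncard.

Lemma ncard_eq (T : Type) (A : set T) n : (A #= `I_n)%card -> ncard A = n.
Proof.
move=> An; rewrite /ncard; case: xgetP => [m -> /= Am|/(_ n) []//].
by apply/card_eq_II; apply: card_eq_trans An; exact: card_esym.
Qed.

Lemma ncard_bij (T U : Type) (A : set T) (B : set U) : (A #= B)%card -> ncard A = ncard B.
Proof.
move=> AB; rewrite /ncard; congr (xget _ _); apply/seteqP; split=> n /= h.
  by apply: card_eq_trans h; exact: card_esym.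
exact: card_eq_trans AB h.
Qed.

Lemma card_eq_finType (F : finType) : ([set: F] #= `I_#|F|)%card.
Proof.
apply: (card_eq_trans (B := [set: 'I_#|F|])); last exact/card_esym/card_II.
rewrite -(_ : [set enum_rank x | x in [set: F]] = [set: 'I_#|F|]).
  by apply/card_esym/inj_card_eq => x y _ _; exact: enum_rank_inj.
by apply/seteqP; split=> // i _; exists (enum_val i); rewrite ?enum_valK.
Qed.

Lemma ncard_finType (T : Type) (A : set T) (F : finType) (f : F -> T) :
  injective f -> range f = A -> ncard A = #|F|.
Proof.
move=> fi <-; apply: ncard_eq; apply: card_eq_trans (card_eq_finType F).
by apply: inj_card_eq => x y _ _; exact: fi.
Qed.

Lemma ncard_seq (T : choiceType) (s : seq T) : uniq s -> ncard [set x | x \in s] = size s.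
Proof.
move=> us; rewrite (@ncard_finType _ _ 'I_(size s) (fun i => tnth (in_tuple s) i)).
- by rewrite card_ord.
- move=> i j; have x0 := tnth (in_tuple s) i.
  by rewrite !(tnth_nth x0) /= => /eqP; rewrite nth_uniq// => /eqP/val_inj.
- apply/seteqP; split=> [_ [i _ <-]|x /= xs]; first exact: mem_tnth.
  have h : (index x s < size s)%N by rewrite index_mem.
  exists (Ordinal h) => //; by rewrite (tnth_nth x) /= nth_index.
Qed.
End Ncard.

(** * Sublattices of Z^g *)

Section Lattice.

(** Induction on g: the first coordinates of the elements form an ideal of Z,
    generated by that of some element l0, and the elements with first coordinate 0
    form a lattice in Z^(g - 1). *)
Lemma lattice_fg (g : nat) (P : 'rV[int]_g -> Prop) :
  P 0 -> (forall u v, P u -> P v -> P (u - v)) ->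
  exists k (B : 'M[int]_(k, g)), forall c, P c <-> exists a, c = a *m B.
Proof.
elim: g P => [P P0 PB|g ih].
  exists 0%N, 0 => c; rewrite (thinmx0 c); split=> // _.
  by exists 0; rewrite !thinmx0.
change (forall P : 'rV[int]_(1 + g) -> Prop, P 0 ->
  (forall u v, P u -> P v -> P (u - v)) -> exists k (B : 'M[int]_(k, 1 + g)),
  forall c, P c <-> exists a, c = a *m B).
move=> P P0 PB.
have PN u : P u -> P (- u) by move=> Pu; rewrite -sub0r; exact: PB.
have PD u v : P u -> P v -> P (u + v) by move=> Pu Pv; rewrite -[v]opprK; apply: PB => //; exact: PN.
have PZn u (n : nat) : P u -> P (u *+ n).
  by move=> Pu; elim: n => [|n IH]; rewrite ?mulr0n// mulrS; exact: PD.
have PZ u (n : int) : P u -> P (u *~ n).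
  by case: n => n Pu; [exact: PZn|rewrite NegzE mulrNz; apply: PN; exact: PZn].
(* Unless all first coordinates vanish, l0 has a first coordinate of least
   nonzero absolute value. *)
have [l0 Pl0 l0P] : exists2 l0, P l0 & forall c, P c -> exists q : int, c 0 0 = l0 0 0 * q.
  have [[c [Pc c0]]|nz] := pselect (exists c, P c /\ c 0 0 != 0); last first.
    exists 0 => // c Pc; exists 0; rewrite mulr0; apply: contrapT => /eqP c0.
    by apply: nz; exists c.
  pose Q n := `[< exists c, P c /\ absz (c 0 0) = n.+1 >].
  have exQ : exists n, Q n.
    exists (absz (c 0 0)).-1; apply/asboolP; exists c; split=> //.
    by rewrite prednK// absz_gt0.
  case: (ex_minnP exQ) => m /asboolP[l [Pl lm]] mmin.
  exists l => // d Pd.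
  have l0 : l 0 0 != 0 by rewrite -absz_eq0 lm.
  exists (divz (d 0 0) (l 0 0)).
  pose e := d - l *~ (divz (d 0 0) (l 0 0)).
  have Pe : P e by apply: PB => //; exact: PZ.
  have e00 : e 0 0 = modz (d 0 0) (l 0 0).
    rewrite /modz /e !mxE; congr (_ - _).
    by rewrite -scaler_int mxE intz.
  rewrite {1}(divz_eq (d 0 0) (l 0 0)) -e00 mulrC.
  suff -> : e 0 0 = 0 by rewrite addr0.
  apply/eqP; apply: contraT => e0.
  have [n en] : exists n, absz (e 0 0) = n.+1.
    by exists (absz (e 0 0)).-1; rewrite prednK// absz_gt0.
  have /mmin : Q n by apply/asboolP; exists e.
  rewrite leqNgt -ltnS -en -lm e00 => /negP[].
  have := ltz_mod (d 0 0) l0; rewrite -{1}[modz _ _]gez0_abs ?modz_ge0//.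
pose Q (c : 'rV[int]_g) := P (row_mx (0 : 'rV_1) c).
have [||k [B hB]] := ih Q.
- by rewrite /Q row_mx0.
- move=> u v Qu Qv; rewrite /Q.
  rewrite (_ : row_mx 0 (u - v) = row_mx 0 u - row_mx 0 v); first exact: PB.
  by rewrite opp_row_mx add_row_mx oppr0 addr0.
exists (1 + k)%N, (col_mx l0 (row_mx (0 : 'cV_k) B)) => c; split.
  move=> Pc; have [q cq] := l0P c Pc.
  pose e := c - l0 *~ q.
  have Pe : P e by apply: PB => //; exact: PZ.
  have e0 : lsubmx (e : 'rV_(1 + g)) = 0.
    apply/rowP => i; rewrite !mxE (ord1 i) -scaler_int mxE.
    rewrite (_ : lshift g 0 = 0); last exact/val_inj.
    by rewrite cq intz mulrC subrr.
  have [a ha] : exists a, rsubmx (e : 'rV_(1 + g)) = a *m B.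
    by apply/hB; rewrite /Q -e0 hsubmxK.
  exists (row_mx (const_mx q) a).
  rewrite mul_row_col mul_mx_row mulmx0 -ha -e0 hsubmxK.
  rewrite (_ : const_mx q *m l0 = l0 *~ q) ?subrKC//; last first.
  by apply/rowP => i; rewrite !mxE big_ord1 mxE -scaler_int mxE intz.
move=> [a ->]; rewrite -[a]hsubmxK mul_row_col; apply: PD.
  rewrite (_ : _ *m l0 = l0 *~ (lsubmx a 0 0)); first exact: PZ.
  by apply/rowP => i; rewrite !mxE big_ord1 -scaler_int !mxE intz.
by rewrite mul_mx_row mulmx0; apply/hB; exists (rsubmx a).
Qed.
End Lattice.

(** * Bases of finitely generated abelian groups *)

Section Basis.
Variable V : zmodType.

Definition zcomb g (x : 'I_g -> V) (c : 'I_g -> int) : V := \sum_i x i *~ c i.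

Definition zgen g (x : 'I_g -> V) : Prop := forall v, exists c, v = zcomb x c.

(** The group is the direct sum of the cyclic subgroups generated by the x i,
    where x i has order d i, and infinite order if d i = 0. *)
Definition zbasis g (x : 'I_g -> V) (d : 'I_g -> nat) : Prop :=
  zgen x /\ forall c, zcomb x c = 0 <-> forall i, ((d i)%:Z %| c i)%Z.

Lemma zcombD g (x : 'I_g -> V) a b : zcomb x (fun i => a i + b i) = zcomb x a + zcomb x b.
Proof. by rewrite /zcomb -big_split; apply: eq_bigr => i _; rewrite mulrzDr. Qed.

Lemma zcombB g (x : 'I_g -> V) a b : zcomb x (fun i => a i - b i) = zcomb x a - zcomb x b.
Proof. by rewrite /zcomb -sumrB; apply: eq_bigr => i _; rewrite mulrzBr. Qed.

Lemma zcombZ g (x : 'I_g -> V) a (n : int) : zcomb x (fun i => a i * n) = zcomb x a *~ n.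
Proof. by rewrite /zcomb mulrz_suml; apply: eq_bigr => i _; rewrite mulrzA. Qed.

Lemma zcomb_mx g h (x : 'I_g -> V) (B : 'M[int]_(h, g)) (a : 'I_h -> int) :
  zcomb (fun i => zcomb x (B i)) a = zcomb x (fun j => \sum_i a i * B i j).
Proof.
rewrite /zcomb; under eq_bigr do rewrite mulrz_suml.
rewrite exchange_big /=; apply: eq_bigr => j _; rewrite mulrz_sumr.
by apply: eq_bigr => i _; rewrite mulrC mulrzA.
Qed.

Lemma zcomb_delta g (x : 'I_g -> V) i : zcomb x (fun j => (j == i)%:Z) = x i.
Proof.
rewrite /zcomb (bigD1 i)//= eqxx mulr1z big1 ?addr0// => j /negbTE ->.
by rewrite mulr0z.
Qed.

(** The relations between the generators form a finitely generated lattice, and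
    the Smith normal form diagonalizes a matrix whose rows generate it. *)
Lemma zgen_basis g (x : 'I_g -> V) : zgen x -> exists (y : 'I_g -> V) d, zbasis y d.
Proof.
move=> gx; pose P (c : 'rV[int]_g) := zcomb x (c 0) = 0.
have [||k [B hB]] := lattice_fg (P := P).
- by rewrite /P /zcomb big1// => i _; rewrite mxE mulr0z.
- move=> u v Pu Pv; rewrite /P -[RHS](subr0 0) -{1}Pu -Pv -zcombB.
  by apply: eq_bigr => i _; rewrite !mxE.
have [L uL [U uU [d _ BE]]] := int_Smith_normal_form B.
pose y (i : 'I_g) := zcomb x (U i).
have yx c : zcomb y c = zcomb x ((\row_i c i *m U) 0).
  rewrite zcomb_mx; apply: eq_bigr => j _; congr (_ *~ _).
  by rewrite mxE; apply: eq_bigr => i _; rewrite mxE.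
exists y, (fun i : 'I_g => if (i < k)%N then absz (d`_i) else 0%N); split.
  move=> v; have [c ->] := gx v; exists ((\row_i c i *m invmx U) 0).
  rewrite yx; apply: eq_bigr => i _; congr (_ *~ _).
  rewrite (_ : (\row_i _) = \row_i c i *m invmx U) ?mulmxKV ?mxE//.
  by apply/rowP => j; rewrite mxE.
move=> c; rewrite yx; set r := \row_i c i.
rewrite -[_ = 0]/(P (r *m U)).
pose D : 'M[int]_(k, g) := \matrix_(i, j) (d`_i *+ (i == j :> nat)).
have -> : P (r *m U) <-> exists b : 'rV_k, r = b *m D.
  split=> [/hB[a ha]|[b hb]].
    by exists (a *m L); rewrite -[r](mulmxK uU) ha BE -/D !mulmxA mulmxK.
  by apply/hB; exists (b *m invmx L); rewrite BE -/D hb !mulmxA mulmxKV.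
have bD (b : 'rV_k) (j : 'I_g) : (b *m D) 0 j =
    if insub (val j) is Some i then b 0 i * d`_j else 0.
  rewrite mxE; case: insubP => [i ik ij|jk].
    rewrite (bigD1 i)//= big1 ?addr0 => [|l li].
      by rewrite mxE ij eqxx mulr1n.
    by rewrite mxE (_ : (l == j :> nat) = false) ?mulr0n ?mulr0// -ij; apply/negbTE.
  rewrite big1// => l _; rewrite mxE (_ : (l == j :> nat) = false) ?mulr0n ?mulr0//.
  by apply: contraNF jk => /eqP lj; rewrite /= -lj.
split=> [[b hb] j|h].
  have := congr1 (fun m : 'rV_g => m 0 j) hb; rewrite bD mxE => ->.
  by case: insubP => [i /= ik ij|/= /negbTE ->]; rewrite ?dvd0z// ik dvdz_mull// dvdzE.
pose b : 'rV[int]_k := \row_i (if insub (val i) is Some j then (c j %/ d`_i)%Z else 0).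
exists b; apply/rowP => j; rewrite bD mxE.
have := h j; case: insubP => [i /= ik ij|/= /negbTE ->]; last by rewrite dvd0z => /eqP.
have {}ij : nat_of_ord i = j by [].
rewrite ik => dj; rewrite mxE; case: insubP => [l _ lj|/=]; last by rewrite ij ltn_ord.
have -> : l = j by apply: val_inj; rewrite lj /= ij.
by rewrite ij divzK.
Qed.
End Basis.

(** * Homomorphisms to finite cyclic groups *)

Section AdditiveMaps.
Variables V W : zmodType.

Lemma exists_additive (f : V -> W) : {morph f : x y / x - y} ->
  exists h : {additive V -> W}, h =1 f.
Proof.
move=> fB; pose a := GRing.isZmodMorphism.Build V W f fB.
pose h : {additive V -> W} := HB.pack_for {additive V -> W} f a.
by exists h.
Qed.

Lemma additive_ext (f g : {additive V -> W}) : f =1 g -> f = g.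
Proof.
case: f => f [[f1]]; case: g => g [[g1]] /= /funext e.
by rewrite e in f1 *; rewrite (Prop_irrelevance f1 g1).
Qed.
End AdditiveMaps.

Section Counting.

Lemma card_family_prod (g B : nat) (F : 'I_g -> pred 'I_B) :
  #|(family F : pred {ffun 'I_g -> 'I_B})| = (\prod_i #|F i|)%N.
Proof. by rewrite card_family foldrE big_map big_enum. Qed.

(** The product z m is divisible by d if and only if z is divisible by
    d / gcd(d, m). *)
Lemma card_kernel_cyclic (B d m : nat) : (0 < d)%N -> (d <= B)%N ->
  #|[pred z : 'I_B | (z < d)%N && (d %| z * m)%N]| = gcdn d m.
Proof.
move=> d0 dB; set e := gcdn d m; have e0 : (0 < e)%N by rewrite gcdn_gt0 d0.
have ed : (e %| d)%N by exact: dvdn_gcdl.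
set q := (d %/ e)%N; have dq : d = (q * e)%N by rewrite divnK.
have q0 : (0 < q)%N by rewrite -(ltn_pmul2r e0) mul0n -dq.
have dvd z : (d %| z * m)%N = (q %| z)%N.
  rewrite {1}dq -(divnK (dvdn_gcdr d m)) -/e mulnA dvdn_pmul2r// Gauss_dvdl//.
  by rewrite /coprime -(eqn_pmul2r e0) mul1n muln_gcdl -dq divnK ?dvdn_gcdr//.
transitivity (\sum_(0 <= z < d) nat_of_bool (q %| z))%N.
  rewrite -sum1_card big_mkcond /= big_mkord.
  rewrite (big_ord_widen B (fun z => nat_of_bool (q %| z))%N)// [RHS]big_mkcond.
  by apply: eq_bigr => z _; rewrite inE /= dvd; case: (z < d)%N; case: (q %| z)%N.
transitivity (\sum_(1 <= z < d.+1) nat_of_bool (q %| z))%N.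
  rewrite big_nat_recr// big_ltn// dvdn0 addnC; congr (_ + _)%N.
  by rewrite {1}dq dvdn_mulr.
by rewrite -divn_count_dvd {1}dq mulKn.
Qed.

Lemma mulrn_Zp (p n : nat) (z : 'I_p.+1) : z *+ n = inZp (z * n).
Proof. exact: Zp_mulrn. Qed.

Lemma mulrn_Zp_eq0 (p n : nat) (z : 'I_p.+1) : (z *+ n == 0) = (p.+1 %| z * n)%N.
Proof. by rewrite mulrn_Zp -val_eqE. Qed.

Variables (V : zmodType) (g : nat) (x : 'I_g -> V) (d : 'I_g -> nat).
Hypothesis bas : zbasis x d.

Definition torsion_annihilator : nat := \prod_(i | d i != 0) d i.
Let D := torsion_annihilator.

Lemma torsion_annihilator_gt0 : (0 < D)%N.
Proof. by apply: prodn_cond_gt0 => // i; rewrite lt0n. Qed.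

Definition free_rank : nat := #|[pred i | d i == 0%N]|.

Let bnd i := maxn 1 (d i).
Let bnd0 i : (0 < bnd i)%N. Proof. by rewrite /bnd leq_maxl. Qed.
Let B := (\sum_i bnd i)%N.
Let bndB i : (bnd i <= B)%N.
Proof. by rewrite /B (bigD1 i)//= leq_addr. Qed.

Let Fam : pred {ffun 'I_g -> 'I_B} := family (fun i => [pred z : 'I_B | (z < bnd i)%N]).
(** Coordinates are elements of a single ordinal type, large enough for all
    cyclic summands, so that torsion elements are counted as a family of sets. *)
Definition torsion_point (c : {ffun 'I_g -> 'I_B}) : V := zcomb x (fun i => (c i)%:Z).
Definition torsion_seq : seq V := [seq torsion_point c | c <- enum Fam].

Lemma torsion_point_inj : {in Fam &, injective torsion_point}.
Proof.
move=> c c' /familyP hc /familyP hc' e; apply/ffunP => i; apply: val_inj => /=.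
have /bas.2 /(_ i) : zcomb x (fun i => (c i)%:Z - (c' i)%:Z) = 0.
  by rewrite zcombB; apply/eqP; rewrite subr_eq0; apply/eqP; exact: e.
rewrite -eqz_mod_dvd; have := hc i; have := hc' i; rewrite !inE /bnd.
case: (d i) => [|k] h1 h2.
  by move: h1 h2; rewrite !ltnS !leqn0 => /eqP -> /eqP ->.
have bk : maxn 1 k.+1 = k.+1 by exact/maxn_idPr.
rewrite bk in h1 h2.
by rewrite !modz_nat eqz_nat !modn_small// => /eqP.
Qed.

Lemma torsion_seq_uniq : uniq torsion_seq.
Proof.
rewrite map_inj_in_uniq ?enum_uniq// => c c'; rewrite !mem_enum.
exact: torsion_point_inj.
Qed.

Lemma zcomb_mulrn (c : 'I_g -> int) (m : nat) :
  (zcomb x c *+ m = 0) <-> forall i, ((d i)%:Z %| c i * m%:Z)%Z.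
Proof. by rewrite -bas.2 zcombZ. Qed.

Lemma torsion_mulrn c m : torsion_point c *+ m = 0 <-> forall i, (d i %| c i * m)%N.
Proof. by rewrite zcomb_mulrn. Qed.

Lemma torsion_seq_killed v : v \in torsion_seq -> v *+ D = 0.
Proof.
move=> /mapP[c]; rewrite mem_enum => /familyP hc ->.
apply/torsion_mulrn => i; have := hc i; rewrite inE /bnd.
have [->|di] := eqVneq (d i) 0%N; first by rewrite ltnS leqn0 => /eqP ->.
by move=> _; rewrite dvdn_mull// /D /torsion_annihilator (bigD1 i)//= dvdn_mulr.
Qed.

Lemma mem_torsion_seq v : v \in torsion_seq <-> exists2 m, (0 < m)%N & v *+ m = 0.
Proof.
split=> [/torsion_seq_killed vD|[m m0 vm]].
  by exists D; first exact: torsion_annihilator_gt0.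
have [c vE] := bas.1 v; move: vm; rewrite vE => /zcomb_mulrn h.
have bp i : (absz (modz (c i) (bnd i)%:Z) < B)%N.
  apply: leq_trans (bndB i); have b0 : (bnd i)%:Z != 0 by rewrite eqz_nat -lt0n.
  by rewrite -ltz_nat gez0_abs ?modz_ge0// ltz_pmod// ltz_nat.
pose c' := [ffun i => Ordinal (bp i)].
have c'b i : (c' i < bnd i)%N.
  by rewrite ffunE /= -ltz_nat gez0_abs ?ltz_pmod ?modz_ge0// ?ltz_nat// eqz_nat -lt0n.
apply/mapP; exists c'; first by rewrite mem_enum; apply/familyP => i; rewrite inE.
apply/eqP; rewrite -subr_eq0 -zcombB; apply/eqP/bas.2 => i; rewrite ffunE /=.
have [di|di] := eqVneq (d i) 0%N.
  have := h i; rewrite di dvd0z mulf_eq0 => /orP[/eqP ->|].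
    by rewrite mod0z subr0.
  by rewrite eqz_nat; case: (m) m0.
have bd : bnd i = d i by apply/maxn_idPr; rewrite lt0n.
rewrite gez0_abs ?modz_ge0 ?eqz_nat ?bd//.
by rewrite -eqz_mod_dvd modz_mod.
Qed.

Lemma count_torsion m : (0 < m)%N ->
  count (fun v => v *+ m == 0) torsion_seq = (\prod_(i | d i != 0%N) gcdn (d i) m)%N.
Proof.
move=> m0; transitivity #|[pred c in Fam | torsion_point c *+ m == 0]|.
  rewrite count_map -size_filter.
  by rewrite cardE /enum_mem -filter_predI; congr size; apply: eq_filter => c; rewrite /= !inE andbC.
transitivity #|(family (fun i => [pred z : 'I_B | (z < bnd i)%N && (d i %| z * m)%N]) :
    pred {ffun 'I_g -> 'I_B})|.
  apply/esym/eq_card => c; rewrite !inE; apply/familyP/andP => [h|[/familyP h1 /eqP/torsion_mulrn h2] i].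
    split; first by apply/familyP => i; have /andP[] := h i.
    by apply/eqP/torsion_mulrn => i; have /andP[] := h i.
  by rewrite inE h2 andbT; exact: h1.
rewrite card_family_prod [RHS]big_mkcond; apply: eq_bigr => i _.
have [di|di] := eqVneq (d i) 0%N; last first.
  have bd : bnd i = d i by apply/maxn_idPr; rewrite lt0n.
  by rewrite bd card_kernel_cyclic ?lt0n// -bd.
have B0 : (0 < B)%N by apply: leq_trans (bndB i); rewrite leq_maxl.
rewrite (@fintype.eq_card1 _ (Ordinal B0))// => z; rewrite !inE /bnd di /= ltnS leqn0 dvd0n muln_eq0.
by rewrite -val_eqE /=; case: eqP => //= ->.
Qed.

(** A homomorphism is given by the images of the basis elements, and the image of
    x i may be any element killed by d i. *)
Lemma ncard_hom m : (0 < m)%N ->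
  ncard [set: {additive V -> Zmod m}] =
  (m ^ free_rank * \prod_(i | d i != 0%N) gcdn (d i) m)%N.
Proof.
move=> m0; pose F := {y : {ffun 'I_g -> Zmod m} | [forall i, y i *+ d i == 0]}.
pose coord v := projT1 (cid (bas.1 v)).
have coordE v : v = zcomb x (coord v) by exact: (projT2 (cid (bas.1 v))).
have wd (y : F) (c : 'I_g -> int) : zcomb x c = 0 -> \sum_i val y i *~ c i = 0.
  move=> /bas.2 h; apply: big1 => i _; have /dvdzP[q ->] := h i.
  by have /forallP/(_ i)/eqP := valP y; rewrite mulrC mulrzA -pmulrn => ->; rewrite mul0rz.
have ex (y : F) : exists h : {additive V -> Zmod m}, h =1 fun v => \sum_i val y i *~ coord v i.
  apply: exists_additive => u v; apply/eqP; rewrite -subr_eq0 -sumrB; apply/eqP.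
  rewrite -sumrB -[RHS](wd y (fun i => coord (u - v) i - (coord u i - coord v i))).
    by apply: eq_bigr => i _; rewrite !mulrzBr.
  by rewrite !zcombB -!coordE subrr.
pose f y := projT1 (cid (ex y)).
have fE y v : f y v = \sum_i val y i *~ coord v i by exact: (projT2 (cid (ex y)) v).
have fx y i : f y (x i) = val y i.
  rewrite fE; pose dl j : int := (j == i)%:Z.
  have <- : \sum_j val y j *~ dl j = val y i by exact: (zcomb_delta (val y)).
  apply/eqP; rewrite -subr_eq0 -sumrB; apply/eqP.
  rewrite -[RHS](wd y (fun j => coord (x i) j - dl j)).
    by apply: eq_bigr => j _; rewrite mulrzBr.
  by rewrite zcombB -coordE zcomb_delta subrr.
rewrite (@ncard_finType _ _ F f).
- rewrite card_sig.
  have -> : #|[pred y : {ffun 'I_g -> Zmod m} | [forall i, y i *+ d i == 0]]| =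
     #|(family (fun i => [pred z : Zmod m | z *+ d i == 0]) : pred {ffun 'I_g -> Zmod m})|.
    by apply: eq_card => y; rewrite [LHS]inE; apply/forallP/familyP => h i; have := h i; rewrite inE.
  rewrite card_family_prod (bigID (fun i => d i == 0%N)) /=; congr (_ * _)%N.
    rewrite (eq_bigr (fun=> m)); last first.
      move=> i /eqP di; transitivity #|Zmod m|; last by rewrite card_ord prednK.
      by apply: eq_card => z; rewrite [LHS]inE /= di; apply/eqP.
    by rewrite prod_nat_const.
  apply: eq_bigr => i di; rewrite gcdnC -(@card_kernel_cyclic m.-1.+1 m (d i)) ?prednK//.
  apply: eq_card => z; rewrite [LHS]inE [RHS]inE.
  transitivity (m.-1.+1 %| z * d i)%N; first exact: mulrn_Zp_eq0.
  rewrite -[X in (z < X)%N](prednK m0) ltn_ord andTb.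
  by congr (_ %| _)%N; exact: prednK.
- move=> y y' e; apply: val_inj; apply/ffunP => i.
  by rewrite -!fx e.
- apply/seteqP; split=> // h _.
  pose y0 := [ffun i => h (x i)].
  have hy : [forall i, y0 i *+ d i == 0].
    apply/forallP => i; rewrite ffunE -raddfMn /=; apply/eqP.
    suff -> : x i *+ d i = 0 by rewrite raddf0.
    rewrite -(zcomb_delta x i) pmulrn -zcombZ; apply/bas.2 => j.
    by case: eqP => [->|_]; rewrite ?mul1r ?mul0r ?dvdz0.
  exists (exist _ y0 hy : F) => //; apply: additive_ext => v.
  rewrite fE [in RHS](coordE v) /zcomb raddf_sum /=.
  by apply: eq_bigr => i _; rewrite ffunE raddfMz.
Qed.

Lemma mulrn_order v : v \in torsion_seq -> exists e : nat,
  [/\ (0 < e)%N, (e %| D)%N & forall m, (v *+ m == 0) = (e %| m)%N].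
Proof.
move=> /torsion_seq_killed vD.
have ex : exists m, (0 < m)%N && (v *+ m == 0).
  by exists D; rewrite torsion_annihilator_gt0 vD eqxx.
have [e /andP[e_gt0 /eqP ve] omin] := ex_minnP ex.
have hm m : (v *+ m == 0) = (e %| m)%N.
  apply/eqP/idP => [vm|/dvdnP[q ->]]; last by rewrite mulnC mulrnA ve mul0rn.
  apply: contraT => nd; have r0 : (0 < m %% e)%N by rewrite lt0n.
  have vr : v *+ (m %% e) == 0.
    move: vm; rewrite {1}(divn_eq m e) mulrnDr mulnC mulrnA ve mul0rn add0r => ->.
    by rewrite eqxx.
  have := omin (m %% e)%N; rewrite r0 vr => /(_ isT).
  by rewrite leqNgt ltn_mod e_gt0.
by exists e; rewrite -hm vD eqxx.
Qed.
End Counting.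

Section OrdersAndRank.
Variables (V : zmodType) (g : nat) (x : 'I_g -> V) (d : 'I_g -> nat).
Hypothesis bas : zbasis x d.
Local Notation D := (torsion_annihilator d).
Local Notation tors := (torsion_seq x d).

Definition has_order (v : V) (e : nat) : Prop :=
  (0 < e)%N /\ forall m, (v *+ m == 0) = (e %| m)%N.

Definition add_order (v : V) : nat := xget 1%N [set e | has_order v e].

Lemma has_order_uniq v e e' : has_order v e -> has_order v e' -> e = e'.
Proof.
move=> [_ h] [_ h']; apply/eqP; rewrite eqn_dvd.
by rewrite -h h' dvdnn -h' h dvdnn.
Qed.

Lemma add_order_eq v e : has_order v e -> add_order v = e.
Proof.
rewrite /add_order => ve; case: xgetP => [e' _ /= ve'|/(_ e)//].
exact: has_order_uniq ve' ve.
Qed.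

Lemma torsP v : v \in tors -> has_order v (add_order v).
Proof.
by move=> /(mulrn_order bas)[e [e0 _ h]]; rewrite (@add_order_eq v e).
Qed.

Lemma torsD v : v \in tors -> (add_order v %| D)%N.
Proof.
by move=> vt; have [_ <-] := torsP vt; rewrite (torsion_seq_killed bas vt).
Qed.

Lemma mem_tors v e : has_order v e -> v \in tors.
Proof.
by move=> [e0 h]; apply/(mem_torsion_seq bas); exists e => //; apply/eqP; rewrite h.
Qed.

Lemma Zmod_gen (e : nat) (z : Zmod e) : z = inZp 1 *+ z.
Proof.
by apply: val_inj; rewrite (mulrn_Zp z (inZp 1 : Zmod e)) /= modnMml mul1n modn_small ?ltn_ord.
Qed.

Lemma Zmod_gen_order (e m : nat) : (0 < e)%N ->
  ((inZp 1 : Zmod e) *+ m == 0) = (e %| m)%N.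
Proof.
move=> e0; rewrite (mulrn_Zp_eq0 m (inZp 1 : Zmod e)) /=.
by rewrite /dvdn modnMml mul1n prednK.
Qed.

(** An injective homomorphism from Z/e is determined by the image of 1, which may
    be any element of order e. *)
Lemma nu_count e : (0 < e)%N -> nu e V = count (fun v => add_order v == e) tors.
Proof.
move=> e0; rewrite -size_filter -ncard_seq; last exact/filter_uniq/torsion_seq_uniq.
apply: ncard_bij.
pose ev (f : {additive Zmod e -> V}) := f (inZp 1).
rewrite -(_ : ev @` [set f : {additive Zmod e -> V} | injective f] = [set v | v \in [seq v <- tors | add_order v == e]]).
  apply/card_esym/inj_card_eq => f h _ _ fh; apply: additive_ext => z.
  by rewrite (Zmod_gen z) !raddfMn; congr (_ *+ _); exact: fh.
apply/seteqP; split=> [_ [f /= fi <-]|v /=]; rewrite mem_filter.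
  have vo : has_order (ev f) e.
    split=> // m; rewrite -(Zmod_gen_order m e0) /ev -raddfMn.
    by apply/eqP/eqP => [|->]; rewrite ?raddf0// -(raddf0 f) => /fi.
  by rewrite (add_order_eq vo) eqxx (mem_tors vo).
move=> /andP[/eqP ve /torsP[_]]; rewrite ve => h.
have /eqP ve0 : v *+ e.-1.+1 == 0 by rewrite h prednK.
have vmod m : v *+ (m %% e.-1.+1) = v *+ m.
  by rewrite [in RHS](divn_eq m e.-1.+1) mulrnDr mulnC mulrnA ve0 mul0rn add0r.
have [|f fE] := @exists_additive (Zmod e) V (fun z => v *+ z).
  move=> y z /=; rewrite vmod mulrnDr vmod; congr (_ + _).
  rewrite mulrnBr ?ve0 ?sub0r//.
  exact/ltnW/ltn_ord.
exists f; last by rewrite /ev fE /= vmod mulr1n.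
move=> y z yz; apply/eqP; rewrite -subr_eq0; apply/eqP/val_inj.
have : f (y - z) == 0 by rewrite raddfB yz subrr.
rewrite fE h /dvdn modn_small => [/eqP//|].
by rewrite -[X in (_ < X)%N](prednK e0) ltn_ord.
Qed.

(** The number of elements killed by m; expressed through the orders, it is
    visibly periodic. *)
Definition torsion_count (m : nat) : nat := count (fun v => add_order v %| m)%N tors.

Lemma torsion_countE m : (0 < m)%N ->
  ncard [set: {additive V -> Zmod m}] = (m ^ free_rank d * torsion_count m)%N.
Proof.
move=> m0; rewrite (ncard_hom bas m0) -(count_torsion bas m0); congr (_ * _)%N.
by apply: eq_in_count => v /torsP[_ ->].
Qed.

Lemma torsion_count_per m : torsion_count (m + D) = torsion_count m.
Proof.
by apply: eq_in_count => v /torsD vD; rewrite dvdn_addl.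
Qed.

Lemma torsion_count_gt0 m : (0 < torsion_count m)%N.
Proof.
have o1 : has_order 0 1 by split=> // k; rewrite mul0rn eqxx dvd1n.
rewrite -has_count; apply/hasP; exists 0; first exact: mem_tors o1.
by rewrite (add_order_eq o1) dvd1n.
Qed.

(** The torsion elements are grouped according to their orders. *)
Lemma sum_nu_order :
  \sum_(e \in [set e : nat | (0 < e)%N]) (e%:R^-1 * (nu e V)%:R : rat) =
  \sum_(v <- tors) (add_order v)%:R^-1.
Proof.
pose G e : rat := e%:R^-1 * (nu e V)%:R.
have GE e : (0 < e)%N -> G e = \sum_(v <- tors | add_order v == e) (add_order v)%:R^-1.
  move=> e0; rewrite /G nu_count// -sum1_count natr_sum mulr_sumr.
  by apply: eq_bigr => v /eqP ->; rewrite mulr1.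
rewrite -[LHS]/(\sum_(e \in _) G e).
rewrite (@fsbig_widen _ _ _ _ _ setT)//; last first.
  by move=> e [_ /= /negP]; rewrite -leqNgt leqn0 => /eqP ->; rewrite /G invr0 mul0r.
rewrite -(@fsbig_widen _ _ _ _ `I_D.+1)//; last first.
  move=> e [_ /= /negP]; rewrite -leqNgt => De; rewrite GE ?(leq_trans _ De)//.
  rewrite big_seq_cond big1// => v /andP[/torsD vD /eqP ve]; move: De.
  by rewrite -ve ltnNge dvdn_leq// torsion_annihilator_gt0.
rewrite -fsbig_ord big_ord_recl /= [X in (X + _)%R](_ : _ = 0) ?add0r; last by rewrite /G invr0 mul0r.
under eq_bigr do rewrite GE// big_mkcond.
rewrite exchange_big big_seq [RHS]big_seq; apply: eq_bigr => v vt.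
have [v0 _] := torsP vt.
have vb : ((add_order v).-1 < D)%N by rewrite prednK// dvdn_leq ?torsD ?torsion_annihilator_gt0.
rewrite (bigD1 (Ordinal vb))//= /bump /= add1n prednK// eqxx big1 ?addr0// => i.
by rewrite -val_eqE /= /bump /= add1n -eqSS prednK// eq_sym => /negbTE ->.
Qed.

(** A torsion element v is killed by exactly M / ord(v) of the integers from 1 to
    M. *)
Lemma torsion_count_mean M : (D %| M)%N ->
  (\sum_(m < M) torsion_count m.+1)%:R =
  M%:R * \sum_(e \in [set e : nat | (0 < e)%N]) (e%:R^-1 * (nu e V)%:R : rat).
Proof.
move=> DM; rewrite sum_nu_order mulr_sumr.
under eq_bigr do rewrite /torsion_count -sum1_count big_mkcond.
rewrite exchange_big natr_sum big_seq [RHS]big_seq; apply: eq_bigr => v vt.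
have [v0 _] := torsP vt.
have /dvdnP[q ->] : (add_order v %| M)%N by rewrite (dvdn_trans _ DM)// torsD.
rewrite natrM mulfK ?pnatr_eq0 -?lt0n//; congr _%:R.
transitivity (\sum_(1 <= i < (q * add_order v).+1) nat_of_bool (add_order v %| i))%N.
  by rewrite big_add1 big_mkord; apply: eq_bigr => i _; case: (_ %| _)%N.
by rewrite -divn_count_dvd mulnK.
Qed.

Lemma lin_indep_free_rank r : (r <= free_rank d)%N -> exists v : 'I_r -> V, lin_indep v.
Proof.
move=> rf; pose J := [pred i : 'I_g | d i == 0%N].
pose idx (i : 'I_r) : 'I_g := enum_val (widen_ord rf i : 'I_#|J|).
have idx_inj : injective idx.
  by move=> i j /enum_val_inj/(congr1 val) /= ij; exact: val_inj.
exists (fun i => x (idx i)) => c e i.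
pose B : 'M[int]_(r, g) := \matrix_(i, j) (j == idx i)%:Z.
have : zcomb (fun i => zcomb x (B i)) c = 0.
  rewrite -[RHS]e; apply: eq_bigr => k _; congr (_ *~ _).
  by rewrite -[RHS]zcomb_delta; apply: eq_bigr => j _; rewrite mxE.
rewrite zcomb_mx => /bas.2/(_ (idx i)).
have /eqP -> : d (idx i) == 0%N by have := enum_valP (widen_ord rf i : 'I_#|J|).
rewrite dvd0z (bigD1 i)//= mxE eqxx mulr1 big1 ?addr0 => [/eqP//|k ki].
by rewrite mxE (inj_eq idx_inj) eq_sym (negbTE ki) mulr0.
Qed.

(** If there are more elements than free coordinates, their free coordinates
    satisfy a nontrivial relation: the last row of the inverse of the left factor
    of the Smith normal form. Multiplied by an integer that kills the torsion
    subgroup, it becomes a relation in V. *)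
Lemma lin_indep_le r (v : 'I_r -> V) : lin_indep v -> (r <= free_rank d)%N.
Proof.
case: r v => // r v vi; rewrite leqNgt; apply/negP => fr.
pose J := [pred i : 'I_g | d i == 0%N].
have /choice[A hA] : forall i, exists a, v i = zcomb x a by move=> i; exact: bas.1.
pose B : 'M[int]_(r.+1, #|J|) := \matrix_(i, j) A i (enum_val j).
have [L uL [U uU [dd _ BE]]] := int_Smith_normal_form B.
pose c : 'rV_r.+1 := row ord_max (invmx L).
have cB : c *m B = 0.
  rewrite BE /c rowE -!mulmxA (mulKmx uL) mulmxA -rowE.
  rewrite (_ : row _ _ = 0) ?mul0mx//; apply/rowP => j; rewrite !mxE.
  rewrite (_ : (_ == _) = false) ?mulr0n//=; apply/negbTE; rewrite neq_ltn.
  by rewrite (leq_trans (ltn_ord j) fr) orbT.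
have ci i : c 0 i = 0.
  pose a j := c 0 j * D%:Z.
  have : a i = 0.
    apply: vi; rewrite -[LHS]/(zcomb v a).
    pose AA : 'M[int]_(r.+1, g) := \matrix_(i, j) A i j.
    rewrite (_ : zcomb v a = zcomb (fun i => zcomb x (AA i)) a); last first.
      apply: eq_bigr => k _; rewrite hA; congr (_ *~ _).
      by apply: eq_bigr => j _; rewrite mxE.
    rewrite zcomb_mx; apply/bas.2 => j.
    have -> : \sum_i a i * AA i j = (\sum_i c 0 i * A i j) * D%:Z.
      by rewrite mulr_suml; apply: eq_bigr => k _; rewrite mxE mulrAC.
    have [dj|dj] := eqVneq (d j) 0%N; last first.
      by rewrite dvdz_mull// dvdzE /= /torsion_annihilator (bigD1 j)//= dvdn_mulr.
    have jJ : j \in J by rewrite inE dj.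
    have := congr1 (fun m : 'rV_#|J| => m 0 (enum_rank_in jJ j)) cB.
    rewrite !mxE (eq_bigr (fun i => c 0 i * A i j)).
      by move=> ->; rewrite mul0r dvdz0.
    by move=> k _; rewrite !mxE enum_rankK_in.
  move/eqP; rewrite mulf_eq0 eqz_nat (gtn_eqF (torsion_annihilator_gt0 d)) orbF.
  by move/eqP.
have c0 : c = 0 by apply/rowP => i; rewrite ci mxE.
have : c *m L = delta_mx 0 ord_max by rewrite /c rowE mulmxKV.
rewrite c0 mul0mx => /rowP/(_ ord_max); rewrite !mxE !eqxx.
by [].
Qed.

Lemma ab_rank_free : ab_rank V = free_rank d.
Proof.
rewrite /ab_rank (_ : [set r | _] = `I_(free_rank d).+1); last first.
  apply/seteqP; split=> r /=.
    by move=> [v /lin_indep_le]; rewrite ltnS.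
  by rewrite ltnS => /lin_indep_free_rank.
rewrite -fsbig_ord; apply/eqP; rewrite eqn_leq; apply/andP; split.
  by apply/bigmax_leqP => i _; rewrite -ltnS.
by rewrite (bigD1 ord_max)//= leq_maxl.
Qed.
End OrdersAndRank.

(** The factor tau m is the number of elements of V killed by m. *)
Lemma count_hom_fg (V : zmodType) g (x : 'I_g -> V) : zgen x ->
  exists (D : nat) (tau : nat -> nat),
  [/\ (0 < D)%N, forall m, tau (m + D)%N = tau m, forall m, (0 < tau m)%N,
      forall m, (0 < m)%N ->
        ncard [set: {additive V -> Zmod m}] = (m ^ ab_rank V * tau m)%N
    & forall M, (D %| M)%N -> (\sum_(m < M) tau m.+1)%:R =
        M%:R * \sum_(e \in [set e : nat | (0 < e)%N]) (e%:R^-1 * (nu e V)%:R : rat)].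
Proof.
move=> /zgen_basis[y [d bas]]; exists (torsion_annihilator d), (torsion_count y d).
split.
- exact: torsion_annihilator_gt0.
- exact: (torsion_count_per bas).
- exact: (torsion_count_gt0 bas).
- by move=> m m0; rewrite (ab_rank_free bas) (torsion_countE bas).
- exact: (torsion_count_mean bas).
Qed.

(** * Stalks at points of affine open subschemes *)

Local Notation pset := Defs.pset.

Section Germs.
Variables (X : mspace) (x : X).

Lemma germP (c : stalk x) : exists (U : opens X) (Ux : oset U x) s, c = germ Ux s.
Proof.
by rewrite -(prepK c); case: (prep c) => U Ux s; exists U, Ux, s.
Qed.

Lemma germ1 (U : opens X) (Ux : oset U x) : germ Ux one0 = one0.
Proof.
apply/pcls_eq; have UT : U `<=` setT_opens X by [].
by exists U, (@subset_refl _ _), UT; split=> //=; rewrite !mfun1.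
Qed.

Lemma germ0 (U : opens X) (Ux : oset U x) : germ Ux zero0 = zero0.
Proof.
apply/pcls_eq; have UT : U `<=` setT_opens X by [].
by exists U, (@subset_refl _ _), UT; split=> //=; rewrite !mfun0.
Qed.

Lemma germM (U : opens X) (Ux : oset U x) (s t : sect U) :
  germ Ux (mul0 s t) = mul0 (germ Ux s) (germ Ux t).
Proof.
rewrite [RHS]quot_mulE; apply/pcls_eq.
have UU : U `<=` capo U U by move=> y.
exists U, (@subset_refl _ _), UU; split=> //=.
by rewrite res_id mfunM !resT !res_id.
Qed.

Lemma germ2P (a b : stalk x) : exists (U : opens X) (Ux : oset U x) s t,
  a = germ Ux s /\ b = germ Ux t.
Proof.
have [U [Ux [s ->]]] := germP a; have [V [Vx [t ->]]] := germP b.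
have h : oset (capo U V) x by [].
exists (capo U V), h, (res (@capol _ U V) s), (res (@capor _ U V) t).
by rewrite !(germ_res _ _ h).
Qed.
End Germs.

Lemma sval_irr (M : mon0) (U : opens (spec M)) (s : spec_sect_car U) q
  (h h' : oset U q) : sval s q h = sval s q h'.
Proof. by congr (sval s q _); exact: Prop_irrelevance. Qed.

Section Evaluation.
Variables (M : mon0) (X : mspace) (j : morphism (Spec M) X) (p : spec M).

(** The stalk map of j at p, followed by the evaluation at p of germs of sections
    over the spectrum. *)
Definition stalk_eval (c : stalk (j p)) : loc p :=
  let r := prep c in sval (msec j (gopen r) (gsec r)) p (gmem r).

Lemma stalk_evalE (U : opens X) (Ux : oset U (j p)) s :
  stalk_eval (germ Ux s) = sval (msec j U s) p Ux.
Proof.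
rewrite /stalk_eval; have /pcls_eq := prepK (germ Ux s).
case: (prep _) => V Vx t /= [W [WV [WU [Wx /(congr1 (msec j W))]]]].
rewrite /= !mres => /(congr1 (fun u : spec_sect_car (open_preim (mcont j) W) => sval u p Wx)) /= e.
rewrite (Prop_irrelevance Vx (preimage_subset WV Wx : oset V (j p))).
by rewrite (Prop_irrelevance Ux (preimage_subset WU Wx : oset U (j p))); exact: e.
Qed.

Lemma stalk_eval1 : stalk_eval one0 = one0.
Proof.
have h : oset (setT_opens X) (j p) by [].
by rewrite -(germ1 h) stalk_evalE mfun1.
Qed.

Lemma stalk_eval0 : stalk_eval zero0 = zero0.
Proof.
have h : oset (setT_opens X) (j p) by [].
by rewrite -(germ0 h) stalk_evalE mfun0.
Qed.

Lemma stalk_evalM : {morph stalk_eval : a b / mul0 a b}.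
Proof.
move=> a b; have [U [Ux [s [t [-> ->]]]]] := germ2P a b.
by rewrite -germM !stalk_evalE mfunM.
Qed.

Lemma basic_open (a : M) : open [set q : spec M | ~ pset q a].
Proof.
apply/spec_openE; exists [set c | exists b, c = mul0 a b].
  split; first by exists zero0; rewrite mul0C mul0m.
  by move=> _ b [c ->]; exists (mul0 c b); rewrite mul0A.
apply/seteqP; split=> q /= h s; apply: h.
  by apply: s; exists one0; rewrite mul0C mul1m.
by move=> _ [b ->]; exact: (p_ideal q).2.
Qed.

Hypothesis jo : open_immersion j.

(** Sections over the spectrum are locally fractions, and an equality of
    fractions in the localization at p persists in a neighbourhood of p; the
    immersion carries it to X. *)
Lemma stalk_eval_inj : injective stalk_eval.
Proof.
move=> c c'; have [U [Ux [s [t [-> ->]]]]] := germ2P c c'.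
have [A [AU [a [f [hf [Ap sE]]]]]] := proj2_sig (msec j U s) p Ux.
have [B [BU [b [g [hg [Bp tE]]]]]] := proj2_sig (msec j U t) p Ux.
rewrite !stalk_evalE.
rewrite (_ : sval (msec j U s) p Ux = fracc a (hf p Ap)); last first.
  by rewrite -sE; exact: sval_irr.
rewrite (_ : sval (msec j U t) p Ux = fracc b (hg p Bp)); last first.
  by rewrite -tE; exact: sval_irr.
move=> /pcls_eq[h hp /= e].
pose W := capo (capo A B) (Opens (basic_open h)).
case: jo => ji jop jb.
pose W' := Opens (jop _ (osetP W)).
have W'U : W' `<=` U by move=> _ [q [[Aq _] _] <-]; exact: AU _ Aq.
have W'p : oset W' (j p) by exists p.
have preW q : oset (open_preim (mcont j) W') q -> oset W q.
  by move=> [r Wr /ji <-].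
rewrite -(germ_res W'U Ux W'p s) -(germ_res W'U Ux W'p t); congr (germ W'p _).
have /bij_inj : bijective (msec j W') by apply: jb => _ [q _ <-]; exists q.
apply; rewrite !mres; apply: spec_sect_ext => q hq.
have [[Aq Bq] hhq] := preW _ hq.
transitivity (fracc a (hf q Aq)).
  by rewrite -sE; exact: (@sval_irr M (open_preim (mcont j) U) (msec j U s)).
transitivity (fracc b (hg q Bq)); first by apply/pcls_eq; exists h.
by rewrite -tE; exact: (@sval_irr M (open_preim (mcont j) U) (msec j U t)).
Qed.

(** A fraction a/f is a section over the basic open set where f does not vanish,
    and the immersion carries it to X. *)
Lemma stalk_eval_surj c : exists a, stalk_eval a = c.
Proof.
rewrite -(prepK c); case: (prep c) => a f hf.
pose W := Opens (basic_open f).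
case: jo => ji jop jb; pose W' := Opens (jop _ (osetP W)).
have W'p : oset W' (j p) by exists p.
have preW q : oset (open_preim (mcont j) W') q -> ~ pset q f.
  by move=> [r Wr /ji <-].
have lt : @locally_frac M (open_preim (mcont j) W') (fun q hq => fracc a (preW q hq)).
  move=> q hq; exists (open_preim (mcont j) W'), (@subset_refl _ _), a, f.
  exists preW; split=> // r hr; congr fracc; exact: Prop_irrelevance.
have [m mK Km] : bijective (msec j W') by apply: jb => _ [q _ <-]; exists q.
exists (germ W'p (m (exist _ _ lt))).
by rewrite stalk_evalE Km /=; congr fracc; exact: Prop_irrelevance.
Qed.
End Evaluation.

(** * Unit groups of stalks and finiteness *)

Section UnitsOfLocalization.
Variables (M : mon0) (p : spec M).

Lemma loc_nontrivial : zero0 <> one0 :> loc p.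
Proof.
move=> /pcls_eq[h hp /=]; rewrite mul0m mul1m (mul0C h zero0) mul0m (mul0C h one0) mul1m.
move=> h0; apply: hp.
by rewrite -h0; exact: (p_ideal p).1.
Qed.

Definition locc (a : M) : loc p := fracc a (@p_proper _ p).

Lemma loccM a b : locc (mul0 a b) = mul0 (locc a) (locc b).
Proof.
rewrite /locc fracM; apply/pcls_eq; exists one0; first exact: p_proper.
by rewrite /= !mul1m.
Qed.

Lemma locc1 : locc one0 = one0. Proof. by []. Qed.

Lemma fracc_split (a f : M) (hf : ~ pset p f) : mul0 (fracc a hf) (locc f) = locc a.
Proof.
rewrite /locc fracM; apply/pcls_eq; exists one0; first exact: p_proper.
by rewrite /= !mul1m (mul0C _ one0) mul1m (mul0C _ one0) mul1m.
Qed.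

Lemma ideal_mul a b : pset p a \/ pset p b -> pset p (mul0 a b).
Proof. by case=> h; [|rewrite mul0C]; exact: (p_ideal p).2. Qed.

Lemma is_unit_locc f : ~ pset p f -> is_unit (locc f).
Proof.
move=> hf; exists (fracc one0 hf); rewrite mul0C fracM; apply/pcls_eq.
exists one0; first exact: p_proper.
by rewrite /= !mul1m (mul0C _ one0) mul1m.
Qed.

Lemma unit_frac a f (hf : ~ pset p f) : is_unit (fracc a hf) -> ~ pset p a.
Proof.
move=> [v]; rewrite -(prepK v); case: (prep v) => b k hk.
rewrite [X in X = _ -> _](fracM a b hf hk) => /pcls_eq[h hp /= e] pa.
have : pset p (mul0 h (mul0 (mul0 a b) one0)).
  by apply/ideal_mul; right; apply/ideal_mul; left; apply/ideal_mul; left.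
rewrite e mul1m => /p_prime[//|]; exact: compl_mul hf hk.
Qed.

Definition units_locc f (hf : ~ pset p f) : units (loc p) := exist _ _ (is_unit_locc hf).

(** A product lies outside a prime ideal if and only if all its factors do, so
    the complement is generated by those generators of the monoid that lie in
    it. The units of the localization are quotients of elements of the
    complement. *)
Lemma units_loc_fg : fg_monoid M ->
  exists (m : nat) (x : 'I_m -> units (loc p)), zgen x.
Proof.
move=> [m [g hg]]; exists m.
pose x i := if pselect (pset p (g i)) is right h then units_locc h else 0.
exists x; pose S : set M := [set a | pset p a \/ exists c, sval (zcomb x c) = locc a].
have ST : S = setT.
  apply: hg; rewrite /S /=.
  - by left; exact: (p_ideal p).1.
  - by right; exists (fun=> 0); rewrite /zcomb big1.
  - move=> a b [pa _|[c hc]]; first by left; apply: ideal_mul; left.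
    case=> [pb|[c' hc']]; first by left; apply: ideal_mul; right.
    by right; exists (fun i => c i + c' i); rewrite zcombD loccM -hc -hc'.
  - move=> i; rewrite /x; have [pg|pg] := pselect (pset p (g i)); first by left.
    right; exists (fun j => (j == i)%:Z); rewrite zcomb_delta.
    by case: pselect.
have Sa a : ~ pset p a -> exists c, sval (zcomb x c) = locc a.
  by move=> pa; have [|//] : S a by rewrite ST.
move=> u; have := proj2_sig u; have := prepK (sval u).
case: (prep _) => a f hf uE; rewrite -uE => /unit_frac/Sa[ca hca].
have [cf hcf] := Sa f hf.
exists (fun i => ca i - cf i); rewrite zcombB; apply/eqP.
rewrite -subr_eq opprK; apply/eqP/units_ext; rewrite hca -(fracc_split a hf).
by rewrite -hcf -[fracc a hf]/(pcls _) uE.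
Qed.
End UnitsOfLocalization.

Lemma units_fg_transfer (A B : mon0) (phi : A -> B) :
  phi one0 = one0 -> {morph phi : a b / mul0 a b} -> injective phi ->
  (forall b, exists a, phi a = b) ->
  (exists (m : nat) (x : 'I_m -> units B), zgen x) ->
  exists (m : nat) (x : 'I_m -> units A), zgen x.
Proof.
move=> phi1 phiM phii phis [m [x gx]].
have up (b : units B) : exists a : units A, phi (sval a) = sval b.
  case: b => b [b' bb'] /=; have [a ab] := phis b; have [a' ab'] := phis b'.
  have ua : is_unit a by exists a'; apply: phii; rewrite phiM ab ab' bb'.
  by exists (exist _ a ua).
have down (a : units A) : is_unit (phi (sval a)).
  by case: a => a [a' aa'] /=; exists (phi a'); rewrite -phiM aa'.
pose f (a : units A) : units B := exist _ _ (down a).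
have fB : {morph f : a b / a - b}.
  move=> a b; apply/eqP; rewrite eq_sym subr_eq; apply/eqP/units_ext => /=.
  by rewrite -phiM -[mul0 _ (sval b)]/(sval (a - b + b)) subrK.
have [h hE] := exists_additive fB.
have [y hy] := choice up; exists m, (y \o x) => a.
have [c hc] := gx (h a); exists c; apply: units_ext; apply: phii.
have fi u : phi (sval u) = sval (h u) by rewrite hE.
rewrite !fi hc /zcomb raddf_sum /=; congr sval.
apply: eq_bigr => i _; rewrite raddfMz.
suff -> : h (y (x i)) = x i by [].
by apply: units_ext; rewrite -fi hy.
Qed.

Section Finiteness.

(** A prime ideal of a finitely generated monoid is determined by the generators
    that it contains. *)
Lemma spec_finite (M : mon0) : fg_monoid M -> finite_set [set: spec M].
Proof.
move=> [m [g hg]]; pose f (p : spec M) : {ffun 'I_m -> bool} := [ffun i => `[< pset p (g i) >]].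
have fi : injective f.
  move=> p q /ffunP e; apply/spec_ext/seteqP.
  suff ST : [set a | pset p a <-> pset q a] = setT.
    by split=> a; have [] : [set a | pset p a <-> pset q a] a by rewrite ST.
  apply: hg => /=.
  - by split=> _; exact: (p_ideal _).1.
  - by split=> /p_proper.
  - move=> a b [pqa qpa] [pqb qpb]; split=> /p_prime[] h; apply: ideal_mul;
      [left; exact: pqa|right; exact: pqb|left; exact: qpa|right; exact: qpb].
  - move=> i; have := e i; rewrite !ffunE => h; exact: asbool_eq_equiv h.
rewrite -(preimage_setT f); apply: finite_preimage => //.
by move=> p q _ _; exact: fi.
Qed.
End Finiteness.

Section Noetherian.
Variable X : mspace.
Hypothesis noeth : noetherian_mo_scheme X.

Lemma noetherian_finite : finite_set [set: X].
Proof.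
have [m [M [j [Mfg _ cov]]]] := noeth.
apply: (@sub_finite_set _ _ (\bigcup_(i in [set: 'I_m]) range (j i))).
  by move=> x _; have [i hi] := cov x; exists i.
apply: bigcup_finite => // i _; exact/finite_image/spec_finite.
Qed.

Lemma stalk_nontrivial (x : X) : zero0 <> one0 :> stalk x.
Proof.
have [m [M [j [_ _ cov]]]] := noeth; have [i [p _ <-]] := cov x.
move=> /(congr1 (@stalk_eval _ _ (j i) p)); rewrite stalk_eval0 stalk_eval1.
exact: loc_nontrivial.
Qed.

Lemma stalk_units_fg (x : X) :
  exists (m : nat) (v : 'I_m -> units (stalk x)), zgen v.
Proof.
have [m [M [j [Mfg jo cov]]]] := noeth; have [i [p _ <-]] := cov x.
apply: (@units_fg_transfer _ _ (@stalk_eval _ _ (j i) p)).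
- exact: stalk_eval1.
- exact: stalk_evalM.
- exact: stalk_eval_inj.
- exact: stalk_eval_surj.
- exact: units_loc_fg.
Qed.
End Noetherian.

(** * Points with values in F_1[H] *)

Section PointOfF1.
Variable H : zmodType.
Local Notation A := (F1_mon H).
Implicit Types q : spec A.

Lemma F1_isSome (a : A) : is_unit a <-> a <> None.
Proof.
split=> [[v]|]; first by case: a.
by case: a => // a _; exists (Some (- a)); rewrite /= subrr.
Qed.

Lemma F1_pset q (a : A) : pset q a <-> a = None.
Proof.
split=> [qa|->]; last exact: (p_ideal q).1.
apply: contrapT => /F1_isSome[v av]; apply: (@p_proper _ q); rewrite -av.
exact: (p_ideal q).2.
Qed.

(** The only prime ideal of F_1[H] is the set of its zero element, all other
    elements being invertible. *)
Lemma F1_spec_eq q q' : q = q'.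
Proof.
apply/spec_ext/seteqP; split=> a; by move=> /F1_pset/F1_pset.
Qed.

Definition F1_point : spec A.
Proof.
apply: (@Spec_ A [set None]).
- by split=> // a b /= ->.
- by [].
- by move=> [a|] [b|] //= _; [right|left|left].
Defined.

Lemma F1_locc_inj q : injective (@locc A q).
Proof.
move=> a b /pcls_eq[h /F1_pset hn /=]; case: h hn => // h _.
case: a => [a|]; case: b => [b|] //= [].
by rewrite !addr0 => /addrI ->.
Qed.

Lemma F1_locc_surj q (c : loc q) : exists a, c = locc q a.
Proof.
rewrite -(prepK c); case: (prep c) => a f hf.
have /F1_isSome[f' ff'] : f <> None by move=> /F1_pset.
exists (mul0 f' a); rewrite -[pcls _]/(fracc a hf) loccM.
rewrite -(fracc_split a hf) mul0C -mul0A -loccM ff'.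
by rewrite locc1 mul0C mul1m.
Qed.

Definition F1_val q (c : loc q) : A := projT1 (cid (F1_locc_surj c)).

Lemma F1_valK q (c : loc q) : locc q (F1_val c) = c.
Proof. by rewrite /F1_val; case: cid. Qed.

Lemma F1_val_locc q a : F1_val (locc q a) = a.
Proof. by apply: (@F1_locc_inj q); rewrite F1_valK. Qed.

Lemma F1_unit_locc q a : is_unit (locc q a) <-> is_unit a.
Proof.
split=> [/unit_frac qa|[b ab]]; first by apply/F1_isSome => /F1_pset.
by exists (locc q b); rewrite -loccM ab.
Qed.

(** Since the space has a single point, a section is determined by its value, and
    it is invertible as soon as its value is. *)
Lemma F1_germ_unit q (U : opens (spec A)) (Uq : oset U q) (s : sect (m := Spec A) U) :
  is_unit (@germ (Spec A) q U Uq s) <-> is_unit (sval s q Uq).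
Proof.
split=> [/germ_unit[V [VU [Vq [t e]]]]|].
  have /(congr1 (fun u : spec_sect_car V => sval u q Vq)) := e.
  move=> e'; exists (sval t q Vq); rewrite -[RHS]e'.
  by congr mul0; exact: sval_irr.
rewrite -(F1_valK (sval s q Uq)) => /F1_unit_locc[b ab].
apply/germ_unit; exists U, (@subset_refl _ _); split=> //.
exists (exist _ _ (@lf_const A U b) : spec_sect U).
apply: spec_sect_ext => r; rewrite (F1_spec_eq r q) => Ur /=.
rewrite (sval_irr s _ Uq) -(F1_valK (sval s q Uq)).
by apply: etrans (esym (loccM q _ _)) _; rewrite ab.
Qed.
End PointOfF1.

Section MorphismsFromF1.
Variables (H : zmodType) (X : mspace).
Local Notation A := (F1_mon H).
Local Notation P := (F1_point H).

Section Make.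
Variables (x : X) (phi : mhom (stalk x) A).
Hypothesis phi_local : forall a, is_unit (phi a) <-> is_unit a.

(** The morphism attached to a point x of X and a local homomorphism phi from the
    stalk at x: the underlying map is constant, and a section s has the value phi
    of its germ at x. *)
Definition mk_pt (q : spec A) : X := x.

Lemma mk_cont : continuous (mk_pt : spec A -> X).
Proof. exact: cst_continuous. Qed.

Lemma mk_lf (V : opens X) (s : sect V) : @locally_frac A (open_preim mk_cont V)
  (fun q hq => locc q (phi (@germ X x V hq s))).
Proof.
move=> q hq; exists (open_preim mk_cont V), (@subset_refl _ _).
exists (phi (@germ X x V hq s)), one0, (fun r _ => @p_proper _ r).
by split=> // r hr; rewrite /locc (germ_irr _ hq).
Qed.

Definition mk_sec (V : opens X) : mhom (sect V) (spec_sect (open_preim mk_cont V)).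
Proof.
unshelve refine (@MHom (sect V) (spec_sect (open_preim mk_cont V))
  (fun s => exist _ _ (mk_lf s)) _ _ _).
- by apply: spec_sect_ext => q hq; rewrite /= germ1 mfun1.
- by apply: spec_sect_ext => q hq; rewrite /= germ0 mfun0.
- by move=> s t; apply: spec_sect_ext => q hq; rewrite /= germM mfunM loccM.
Defined.

Definition mk_morphism : morphism (Spec A) X.
Proof.
apply: (@Morphism (Spec A) X mk_pt mk_cont mk_sec).
- move=> U V VU s; apply: spec_sect_ext => q hq /=; congr (locc q (phi _)).
  exact: germ_res.
- move=> q V hV s; rewrite F1_germ_unit /= F1_unit_locc; exact: phi_local.
Defined.
End Make.

(** The value of f on a section over V, or zero if V does not contain the image of
    f. Its type does not depend on that image, so that it can be compared between
    morphisms. *)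
Definition read (f : morphism (Spec A) X) (V : opens X) (s : sect V) : A :=
  if pselect (oset V (f P)) is left h then F1_val (sval (msec f V s) P h) else None.

Lemma read_mk x phi hphi V (Vx : oset V x) s :
  read (@mk_morphism x phi hphi) s = phi (germ Vx s).
Proof.
rewrite /read; case: pselect => [h|//].
by rewrite -[sval _ _ _]/(locc P (phi (@germ X x V h s))) F1_val_locc (germ_irr _ Vx).
Qed.

(** Stalk maps of f take values in the localization of F_1[H] at its point, which
    is F_1[H] itself. *)
Lemma mk_surj (f : morphism (Spec A) X) : exists x (phi : mhom (stalk x) A)
  (hphi : forall a, is_unit (phi a) <-> is_unit a), f = mk_morphism hphi.
Proof.
have vM (a b : loc P) : F1_val (mul0 a b) = mul0 (F1_val a) (F1_val b).
  by apply: (@F1_locc_inj _ P); rewrite loccM !F1_valK.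
exists (f P).
have [phi phiE] : exists phi : mhom (stalk (f P)) A, forall c, locc P (phi c) = stalk_eval c.
  unshelve refine (ex_intro _ (@MHom _ _ (fun c => F1_val (@stalk_eval _ _ f P c)) _ _ _) _).
  - by rewrite stalk_eval1 -locc1 F1_val_locc.
  - by rewrite stalk_eval0 -[zero0]/(locc P zero0) F1_val_locc.
  - by move=> a b; rewrite stalk_evalM vM.
  - by move=> c; exact: F1_valK.
have hphi a : is_unit (phi a) <-> is_unit a.
  rewrite -(F1_unit_locc P) phiE; have [U [Ux [s ->]]] := germP a.
  by rewrite stalk_evalE -F1_germ_unit; exact: mlocal.
exists phi, hphi; apply: morphism_ext.
  by apply: funext => q; rewrite (F1_spec_eq q P).
move=> V W Wf Wg s; apply: spec_sect_ext => q; rewrite (F1_spec_eq q P) => hq /=.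
rewrite phiE stalk_evalE; exact: sval_irr.
Qed.
End MorphismsFromF1.

Section LocalMaps.
Variables (H : zmodType) (B : mon0).
Local Notation A := (F1_mon H).
Hypothesis nt : zero0 <> one0 :> B.

Section Extend.
Variable h : {additive units B -> H}.

(** A homomorphism defined on the units extends by zero to a local homomorphism:
    in a commutative monoid, the factors of a unit are units. *)
Definition unit_ext (b : B) : A :=
  if pselect (is_unit b) is left u then Some (h (exist _ b u)) else None.

Lemma unit_extE (u : units B) : unit_ext (sval u) = Some (h u).
Proof.
case: u => b hb; rewrite /unit_ext /=; case: pselect => [u|//].
by rewrite (Prop_irrelevance u hb).
Qed.

Lemma is_unit_mulP (a b : B) : is_unit (mul0 a b) -> is_unit a /\ is_unit b.
Proof.
move=> [v e]; split; first by exists (mul0 b v); rewrite mul0A.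
by exists (mul0 a v); rewrite mul0A (mul0C b).
Qed.

Definition unit_ext_mhom : mhom B A.
Proof.
apply: (@MHom B A unit_ext).
- by rewrite -[one0]/(sval (0 : units B)) unit_extE raddf0.
- rewrite /unit_ext; case: pselect => // u0; exfalso.
  by have [v] := u0; rewrite mul0m; exact: nt.
- move=> a b; have [ua|na] := pselect (is_unit a); last first.
    rewrite {1 2}/unit_ext; case: pselect => [/is_unit_mulP[]//|_].
    by case: pselect.
  have [ub|nb] := pselect (is_unit b); last first.
    rewrite mul0C {1 3}/unit_ext; case: pselect => [/is_unit_mulP[]//|_].
    by case: pselect => // _; case: (unit_ext a).
  pose u : units B := exist _ a ua; pose v : units B := exist _ b ub.
  by rewrite -[a]/(sval u) -[b]/(sval v) -[mul0 _ _]/(sval (u + v)) !unit_extE raddfD.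
Defined.

Lemma unit_ext_local b : is_unit (unit_ext_mhom b) <-> is_unit b.
Proof.
rewrite F1_isSome /=; split=> [|u]; first by rewrite /unit_ext; case: pselect.
by rewrite -[b]/(sval (exist _ b u : units B)) unit_extE.
Qed.
End Extend.

Lemma unit_ext_surj (phi : mhom B A) : (forall b, is_unit (phi b) <-> is_unit b) ->
  exists h : {additive units B -> H}, phi = unit_ext_mhom h.
Proof.
move=> hphi.
have /choice[f hf] : forall u : units B, exists v : H, phi (sval u) = Some v.
  move=> [b ub] /=; have /hphi/F1_isSome := ub; case: (phi b) => // v _.
  by exists v.
have [|h hE] := @exists_additive (units B) H f.
  move=> u v; apply/eqP; rewrite eq_sym subr_eq; apply/eqP.
  have := mfunM phi (sval (u - v)) (sval v).
  rewrite -[mul0 _ (sval v)]/(sval (u - v + v)) subrK !hf /= => -[].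
  by [].
exists h; apply: mhom_ext => b /=.
have [ub|nb] := pselect (is_unit b).
  by rewrite -[b]/(sval (exist _ b ub : units B)) unit_extE hf hE.
rewrite /unit_ext; case: pselect => // _; apply: contrapT => /F1_isSome.
by rewrite hphi.
Qed.
End LocalMaps.

Lemma ncard_sigma (X : choiceType) (xs : seq X) (T : X -> Type) :
  uniq xs -> (forall x, x \in xs) -> (forall x, (0 < ncard [set: T x])%N) ->
  ncard [set: {x : X & T x}] = (\sum_(x <- xs) ncard [set: T x])%N.
Proof.
move=> us xsT pos; pose n x := ncard [set: T x].
have bex x : exists b : 'I_(n x) -> T x, injective b /\ range b = setT.
  have Tn : ([set: T x] #= `I_(n x))%card.
    have := pos x; rewrite /n /ncard; case: xgetP => // m -> /=.
  have /card_set_bijP[f [fn fi fs]] := Tn.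
  have /choice[b bK] : forall i : 'I_(n x), exists t, f t = i.
    by move=> i; have [t _ ft] := fs i (ltn_ord i); exists t.
  exists b; split=> [i k e|]; first by apply: val_inj; rewrite /= -!bK e.
  apply/seteqP; split=> // t _; exists (Ordinal (fn t Logic.I)) => //.
  by apply: fi; rewrite ?inE// bK.
pose b x := projT1 (cid (bex x)).
have bi x : injective (b x) by exact: (projT2 (cid (bex x))).1.
have bs x : range (b x) = setT by exact: (projT2 (cid (bex x))).2.
pose F := {i : 'I_(size xs) & 'I_(n (tnth (in_tuple xs) i))}.
pose f (u : F) : {x : X & T x} := existT _ (tnth (in_tuple xs) (tag u)) (b _ (tagged u)).
rewrite (@ncard_finType _ _ F f).
- rewrite card_tagged sumnE big_map big_enum /= (big_tnth _ _ xs).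
  by apply: eq_bigr => i _; rewrite card_ord.
- move=> [i a] [k c] e.
  have ik : i = k.
    have x0 := tnth (in_tuple xs) i.
    have := congr1 (fun u => projT1 u) e; rewrite /= !(tnth_nth x0) /=.
    by move=> /eqP; rewrite nth_uniq// => /eqP/val_inj.
  case: k / ik c e => c e; suff -> : a = c by [].
  by apply: bi; exact: eq_from_Tagged e.
- apply/seteqP; split=> // -[x t] _.
  have xi : (index x xs < size xs)%N by rewrite index_mem.
  have tx : tnth (in_tuple xs) (Ordinal xi) = x by rewrite (tnth_nth x) /= nth_index.
  suff [a ha] : exists a, existT T (tnth (in_tuple xs) (Ordinal xi)) (b _ a) = existT T x t.
    by exists (existT _ (Ordinal xi) a).
  rewrite tx; have [a _ <-] : range (b x) t by rewrite bs.
  by exists a.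
Qed.

(** A morphism out of the one-point space Spec F_1[H] is a point x of X with
    a local homomorphism from the stalk at x to F_1[H], and local homomorphisms
    are the extensions by zero of homomorphisms from the units to H. *)
Lemma ncard_morphisms (H : zmodType) (X : mspace) (xs : seq X) :
  uniq xs -> (forall x, x \in xs) ->
  (forall x : X, zero0 <> one0 :> stalk x) ->
  (forall x : X, (0 < ncard [set: {additive units (stalk x) -> H}])%N) ->
  ncard [set: morphism (Spec (F1_mon H)) X] =
  (\sum_(x <- xs) ncard [set: {additive units (stalk x) -> H}])%N.
Proof.
move=> us xsT nt pos; rewrite -ncard_sigma//.
pose mk (u : {x : X & {additive units (stalk x) -> H}}) : morphism (Spec (F1_mon H)) X :=
  mk_morphism (unit_ext_local (nt (tag u)) (tagged u)).
have mki : injective mk.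
  move=> [x h] [y h'] e.
  have xy : x = y by exact: (congr1 (fun f : morphism (Spec (F1_mon H)) X => f (F1_point H)) e).
  case: y / xy h' e => h' e; congr existT; apply: additive_ext => u.
  have [V [Vx [s us']]] := germP (sval u).
  have := congr1 (fun f => @read H X f V s) e.
  by rewrite /mk !(read_mk _ Vx) /= -us' !unit_extE => -[].
apply/esym/ncard_bij; rewrite -(_ : range mk = setT).
  by apply/card_esym/inj_card_eq => u v _ _; exact: mki.
apply/seteqP; split=> // f _; have [x [phi [hphi ->]]] := mk_surj f.
have [h e] := unit_ext_surj (nt x) hphi; exists (existT _ x h) => //.
rewrite /mk /=; case: _ / (esym e) hphi => hphi; congr mk_morphism.
exact: Prop_irrelevance.
Qed.

(** * The zeta function of a Noetherian scheme *)

Lemma bigmax_attained (X : eqType) (r : X -> nat) (xs : seq X) x :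
  x \in xs -> exists2 y, y \in xs & r y = (\max_(z <- xs) r z)%N.
Proof.
elim: xs x => // a xs ih x _; rewrite big_cons.
case: xs ih => [|b xs] ih; first by rewrite big_nil maxn0; exists a; rewrite ?mem_head.
have [y yxs <-] := ih b (mem_head _ _).
rewrite /maxn; case: ifP => _; last by exists a; rewrite ?mem_head.
by exists y => //; rewrite inE yxs orbT.
Qed.

Lemma periodic_mul (T : Type) (tau : nat -> T) (D M : nat) :
  (forall m, tau (m + D)%N = tau m) -> (D %| M)%N -> forall m, tau (m + M)%N = tau m.
Proof.
move=> per /dvdnP[q ->] m; elim: q m => [|q ih] m; first by rewrite addn0.
by rewrite mulSn addnA ih per.
Qed.

Theorem corollary4p14 (R : realType)
    (F : functor MR) (hF : f1_scheme F)
    (X : mspace) (hX : geometric_mo_scheme X)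
    (hFX : is_realization X (mo_part F))
    (hnoeth : noetherian_f1_scheme F X)
    (N : R -> R) (hN : counting_function F N) :
  exists h : R[i] -> R[i], entire_fun h /\
    forall k : R, growth_bound N k ->
    forall zeta : R[i] -> R[i],
      is_zeta N k zeta <->
      exists2 c : R[i], c != 0 &
        forall s : R[i], k < complex.Re s ->
          zeta s = c * (cexp (h s) *
            \prod_(j < (dimension X).+1)
              cpow (s - j%:R) (ratr (zeta_exponent X j))).
Proof.
have [_ noeth] := hnoeth.
have [xs0 xs0T] := (finite_seqP _).1 (noetherian_finite noeth).
pose xs : seq X := undup xs0.
have uxs : uniq xs by exact: undup_uniq.
have xsT (x : X) : x \in xs by have : [set: X] x by []; rewrite xs0T mem_undup.
have setTE : [set: X] = [set` xs] by apply/seteqP; split=> x //= _; exact: xsT.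
have sumX (V : zmodType) (G : X -> V) : \sum_(x \in [set: X]) G x = \sum_(x <- xs) G x.
  by rewrite setTE -fsbig_seq.
pose invT (x : X) D (tau : nat -> nat) := [/\ (0 < D)%N,
  forall m, tau (m + D)%N = tau m, forall m, (0 < tau m)%N,
  forall m, (0 < m)%N ->
    ncard [set: {additive units (stalk x) -> Zmod m}] = (m ^ local_dim x * tau m)%N
  & forall M, (D %| M)%N -> (\sum_(m < M) tau m.+1)%:R =
     M%:R * \sum_(e \in [set e : nat | (0 < e)%N]) (e%:R^-1 * (nu e (units (stalk x)))%:R : rat)].
have /choice[Dt Dth] : forall x : X, exists Dt : nat * (nat -> nat), invT x Dt.1 Dt.2.
  move=> x; have [l [v gv]] := stalk_units_fg noeth x.
  by have [D [tau h]] := count_hom_fg gv; exists (D, tau).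
pose D x := (Dt x).1; pose tau x := (Dt x).2.
pose Mt := (\prod_(x <- xs) D x)%N.
have D_gt0 x : (0 < D x)%N by have [] := Dth x.
have Mt_gt0 : (0 < Mt)%N by apply: prodn_gt0 => x; exact: D_gt0.
have DMt x : (D x %| Mt)%N by rewrite /Mt (big_rem x (xsT x))//= dvdn_mulr.
have tauper x m : tau x (m + Mt)%N = tau x m.
  by apply: (periodic_mul (D := D x)) (DMt x) m; have [] := Dth x.
have taugt x m : (0 < tau x m)%N by have [_ _ -> _ _] := Dth x.
pose meanQ (x : X) : rat :=
  \sum_(e \in [set e : nat | (0 < e)%N]) (e%:R^-1 * (nu e (units (stalk x)))%:R : rat).
have taumean x M : (Mt %| M)%N ->
    \sum_(m < M) (tau x m.+1)%:R = M%:R * ratr (meanQ x) :> R.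
  move=> MtM; have [_ _ _ _ /(_ M (dvdn_trans (DMt x) MtM))] := Dth x.
  move=> /(congr1 (ratr : rat -> R)); rewrite rmorphM /= !ratr_nat => <-.
  by rewrite natr_sum.
have [g [Ncan [gE can NE]]] := hN.
have gE' (m : nat) : (0 < m)%N ->
    g (m%:Z + 1) = \sum_(x <- xs) m%:R ^+ local_dim x * (tau x m)%:R.
  move=> m0; rewrite gE//.
  have homE x : ncard [set: {additive units (stalk x) -> Zmod m}] = (m ^ local_dim x * tau x m)%N.
    by have [_ _ _ /(_ m m0) -> _] := Dth x.
  have -> : ncard [set: mo_part F (F1_ m)] = ncard [set: morphism (Spec (F1_mon (Zmod m))) X].
    have [eta /(_ (F1_ m)) etab] := hFX.
    apply: ncard_bij; rewrite -(_ : range (eta (F1_ m)) = setT).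
      by apply/card_esym/inj_card_eq => u v _ _; exact: bij_inj.
    have [inv _ invK] := etab.
    by apply/seteqP; split=> // u _; exists (inv u).
  rewrite (ncard_morphisms uxs xsT (stalk_nontrivial noeth)).
    by rewrite natr_sum; apply: eq_bigr => x _; rewrite homE natrM natrX.
  by move=> x; rewrite homE muln_gt0 expn_gt0 m0 taugt.
have dimE : dimension X = (\max_(x <- xs) local_dim x)%N.
  by rewrite /dimension setTE -fsbig_seq.
have [|||||h [hent hz]] := @zeta_of_count R X xs (@local_dim X)
  (fun x m => (tau x m)%:R) (dimension X) Mt (fun x => ratr (meanQ x)) _ _ Mt_gt0 _ _ _
  g Ncan N gE' can NE.
- by move=> x _; rewrite dimE; exact: leq_bigmax_seq.
- by move=> x; rewrite dimE; exact: bigmax_attained.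
- by move=> x m; rewrite tauper.
- by move=> x m _; rewrite ler1n.
- exact: taumean.
exists h; split=> // k gk zeta; rewrite (hz k gk zeta).
have expE j : ratr (zeta_exponent X j) =
    - mean_coef xs (@local_dim X) (fun x => ratr (meanQ x)) j :> R.
  rewrite /zeta_exponent sumX rmorphM rmorphXn rmorphN1 /= rmorph_sum /=.
  rewrite /mean_coef mulr_sumr -sumrN; apply: eq_bigr => x _.
  rewrite !rmorphM /= rmorphXn rmorphN1 ratr_nat exprS exprD -/(meanQ x).
  move: ((-1) ^+ j : R) ((-1) ^+ local_dim x : R) ('C(local_dim x, j)%:R : R) (ratr (meanQ x) : R).
  by move=> a b c d; rewrite mulN1r mulNr [b * c]mulrC -!mulrA mulrCA [a * (b * d)]mulrCA.
have prodE s : \prod_(j < (dimension X).+1) cpow (s - j%:R) (ratr (zeta_exponent X j)) =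
    \prod_(j < (dimension X).+1) cpow (s - j%:R)
      (- mean_coef xs (@local_dim X) (fun x => ratr (meanQ x)) j) :> R[i].
  by apply: eq_bigr => j _; rewrite expE.
split=> -[c c0 e]; exists c => //.
- by move=> s ks; rewrite prodE; exact: e.
- by move=> s ks; rewrite -prodE; exact: e.
Qed.
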